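(* Let $u$ be an optimal solution in $C_M^m$, that is, $u\in C_M^m$ and $J(u)\le J(w)$ for all $w\in C_M^m$, and write $u=(\delta_\Omega+M)\vee u_0$. Suppose that the function $x_1\mapsto u_0(x_1,0)$ is twice continuously differentiable on an interval $[\alpha,\beta]$, $-1\le\alpha<\beta\le1$. If $\frac{\partial^2}{\partial x_1^2}u_0(x_1,0)>0$ for $x_1\in(\alpha,\beta)$, then the function $v(p_1)=u_0^*(p_1,0)+M$ satisfies on the interval $(u_0'(\alpha),u_0'(\beta))$, where $u_0'(x_1)=\frac{\partial}{\partial x_1}u_0(x_1,0)$, the following equation (which does not depend on the parameter $M$): $$v''=\frac{v-p_1v'}{p_1^2-v^2}+\frac{2v\,(v')^2}{v^2+1}+\frac{v\,((v')^2-1)}{2(p_1^2-v^2)}.$$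
   Context: Let $n=2$, $\Omega=\{x\in\mathbb{R}^2:|x|\le1\}$, and $M\ge0$. $C_M$ is the set of closed (i.e. lower semicontinuous) convex functions $u:\mathbb{R}^2\to\mathbb{R}\cup\{+\infty\}$ with $\operatorname{dom}u=\{x:u(x)<+\infty\}=\Omega$, $\inf u=0$, and $u\le M$ on $\Omega$. For $u\in C_M$, $$J(u)=\int_\Omega\frac{1}{1+|u'(x)|^2}\,dx,$$ where the gradient $u'(x)$ exists almost everywhere. $\delta_\Omega$ is the indicator function of $\Omega$: $\delta_\Omega(x)=0$ if $x\in\Omega$ and $+\infty$ otherwise. For convex functions $v_1,v_2$, $$(v_1\vee v_2)(x)=\inf\{(1-\lambda)v_1(x_1)+\lambda v_2(x_2): (1-\lambda)x_1+\lambda x_2=x,\ 0\le\lambda\le1\}.$$ $C_M^m$ is the set of $u\in C_M$ of the form $u=(\delta_\Omega+M)\vee u_0$, where $u_0:\mathbb{R}^2\to\mathbb{R}\cup\{+\infty\}$ is a convex function equal to $+\infty$ outside the segment $\{(x_1,0):x_1\in[-1,1]\}$, with $0\le u_0(x_1,0)\le M$ for $x_1\in[-1,1]$ and $\min u_0=0$. The Legendre conjugate is $u_0^*(p)=\sup_{x}(\langle p,x\rangle-u_0(x))$, $p=(p_1,p_2)$; here $u_0^*$ depends only on $p_1$. *)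

(* Defs.v *)
From HB Require Import structures.
From mathcomp Require Import all_boot all_order all_algebra.
From mathcomp Require Import all_classical all_reals all_analysis.
Set Implicit Arguments.
Unset Strict Implicit.
Unset Printing Implicit Defensive.
Import Order.TTheory GRing.Theory Num.Theory.
Import numFieldNormedType.Exports.
Local Open Scope classical_set_scope.
Local Open Scope ring_scope.

(* The plane is R * R; the library norm on a product is the max norm, so the
   Euclidean norm and scalar product are written out in coordinates. *)

Definition disk {R : realType} : set (R * R) :=
  [set x | x.1 ^+ 2 + x.2 ^+ 2 <= 1].

(* Products follow the convention 0 * +oo = 0 of \bar R.  The value -oo is not
   excluded here; it is excluded by the conditions in [C_] and [generator]. *)
Definition convex_ext {R : realType} (u : R * R -> \bar R) : Prop :=
  forall (x y : R * R) (t : R), 0 <= t <= 1 ->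
    (u ((1 - t) *: x + t *: y)%R <= (1 - t)%:E * u x + t%:E * u y)%E.

Definition cvx_indic {R : realType} (A : set (R * R)) (x : R * R) : \bar R :=
  if x \in A then 0%E else +oo%E.

(* [cvx_hull v1 v2] is v1 \vee v2. *)
Definition cvx_hull {R : realType} (v1 v2 : R * R -> \bar R) (x : R * R) :
    \bar R :=
  ereal_inf [set r | exists (t : R) (x1 x2 : R * R),
    [/\ 0 <= t <= 1, (1 - t) *: x1 + t *: x2 = x
      & r = ((1 - t)%:E * v1 x1 + t%:E * v2 x2)%E]].

Definition C_ {R : realType} (M : R) : set (R * R -> \bar R) :=
  [set u | [/\ lower_semicontinuous u, convex_ext u,
              [set x | (u x < +oo)%E] = disk,
              ereal_inf (range u) = 0%E
            & forall x, disk x -> (u x <= M%:E)%E]].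

(* Total: the components are only meaningful where the partial derivatives
   exist, which for u in [C_ M] is almost everywhere on the disk; the other
   points do not contribute to the integral defining [J]. *)
Definition grad {R : realType} (u : R * R -> \bar R) (x : R * R) : R * R :=
  ('D_((1, 0) : R * R) (fine \o u : R * R -> R) x,
   'D_((0, 1) : R * R) (fine \o u : R * R -> R) x).

Definition J {R : realType} (u : R * R -> \bar R) : \bar R :=
  (\int[@lebesgue_measure R \x @lebesgue_measure R]_(x in disk)
     (1 / (1 + ((grad u x).1 ^+ 2 + (grad u x).2 ^+ 2)))%R%:E)%E.

Definition generator {R : realType} (M : R) : set (R * R -> \bar R) :=
  [set u0 | [/\ convex_ext u0,
      forall x : R * R, ~ (x.1 \in `[-1, 1] /\ x.2 = 0) -> u0 x = +oo%E,
      forall x1 : R, x1 \in `[-1, 1] -> (0 <= u0 (x1, 0%R) <= M%:E)%E,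
      ereal_inf (range u0) = 0%E
    & exists x, u0 x = 0%E]].

Definition generated {R : realType} (M : R) (u0 : R * R -> \bar R) :
    R * R -> \bar R :=
  cvx_hull (fun x => cvx_indic disk x + M%:E)%E u0.

Definition Cm {R : realType} (M : R) : set (R * R -> \bar R) :=
  [set u | C_ M u /\ exists2 u0, generator M u0 & u = generated M u0].

Definition conjugate {R : realType} (f : R * R -> \bar R) (p : R * R) :
    \bar R :=
  ereal_sup (range (fun x : R * R =>
    (p.1 * x.1 + p.2 * x.2)%:E - f x)%E).

(* Derivative of the restriction of f to A; for A = `[a, b] it is the ordinary
   derivative in the interior and the one-sided derivative at a and b. *)
Definition derivable_within {R : realType} (A : set R) (f : R -> R) (x : R) :
    Prop :=
  cvg ((y - x)^-1 * (f y - f x) @[y --> within A x^']).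

Definition derive_within {R : realType} (A : set R) (f : R -> R) (x : R) : R :=
  lim ((y - x)^-1 * (f y - f x) @[y --> within A x^']).

Definition C2_within {R : realType} (A : set R) (f : R -> R) : Prop :=
  [/\ forall x, A x -> derivable_within A f x,
      forall x, A x -> derivable_within A (derive_within A f) x
    & {within A, continuous (derive_within A (derive_within A f))}].

(* Main.v *)
Require Import Defs.
From HB Require Import structures.
From mathcomp Require Import all_boot all_order all_algebra.
From mathcomp Require Import all_classical all_reals all_analysis.
From mathcomp Require Import measurable_realfun ring lra.
Import Order.TTheory GRing.Theory Num.Theory.
Import numFieldNormedType.Exports.
Set Implicit Arguments.
Unset Strict Implicit.
Unset Printing Implicit Defensive.
Local Open Scope classical_set_scope.
Local Open Scope ring_scope.

(** Write v(c) = u0^*(c,0) + M and q = sqrt (v^2 - c^2).  The function u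
    spanned by the circle at height M and by u0 is ruled: the conjugate of u is
    the maximum of |p| - M and u0^*, and where both agree, that is at the
    gradients p = (c, q) and (c, -q), u is affine on the segment from the
    contact point (v'(c), 0) to the boundary point p / |p|.  Concretely,
    c x1 + q |x2| - v + M minorizes u on the disk (plane_le_hull) and equals u
    on these segments, the rulings of slope c (plane_eq_hull).  Two rulings do
    not meet inside the disk (rulings_disjoint), so they foliate the region
    they sweep, and there the integrand of J at a point of the ruling of slope
    c is 1 / (1 + v(c)^2) (hull_grad, integrand_ruling).

    Hence the part of J(u) collected between two rulings only depends on how
    fast the area to the left of a ruling grows.  This area is elementary: a
    circular cap plus or minus a triangle (left_of_area).  Its derivative times
    1 / (1 + v^2) is, up to an exact derivative, the Lagrangian
      L(c,v,v') = (v - c v') / (v q (1 + v^2)) + 2 v'^2 q / (1 + v^2)^2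
    (strip_resistance_boundary), and its Euler expression
      L_v - d/dc L_v' = - 4 q / (1 + v^2)^2 (v'' - rhs)
    (lagrW_along) vanishes exactly when the announced equation holds.

    It remains to see that optimality forces the Euler expression to vanish.
    If it did not, it would keep a strict sign near some slope different from
    0.  Add e times a bump supported there to v.  For small e the new v is
    still strictly convex, hence is the conjugate of a new generator, which
    differs from u0 only between two contact points (perturbed_contact).  Since
    min u0 = - u0^*(0,0), keeping the bump away from slope 0 preserves
    min u0 = 0; the bound u0 <= M persists because it only concerns the ends of
    the segment (perturbed_admissible).  The spanned function changes only
    between two fixed rulings (hull_agree) and stays lower semicontinuous
    (hull_lsc), so it is a competitor, and comparing J amounts to comparing the
    integrals over the strip between these rulings (strip_integral_le).  The
    mean value theorem turns the first variation into a strict decrease for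
    one sign of e, a contradiction (bump_contradiction, euler_vanishes).

    Finally u0 being C^2 with positive second derivative on the interval makes
    the conjugate C^2, with derivative the inverse of u0' (dual_arc), so that
    all of this applies to it. *)

(** * Functions spanned by a profile on the axis *)

(** The generators u0 are exactly these functions, for an [admissible] g. *)
Definition axis_fun {R : realType} (g : R -> R) (x : R * R) : \bar R :=
  if (x.1 \in `[-1, 1]) && (x.2 == 0) then (g x.1)%:E else +oo%E.

Record admissible {R : realType} (M : R) (g : R -> R) : Prop := Admissible {
  adm_cvx : forall x y t : R, x \in `[-1, 1] -> y \in `[-1, 1] -> 0 <= t <= 1 ->
    g ((1 - t) * x + t * y) <= (1 - t) * g x + t * g y;
  adm_bnd : forall x : R, x \in `[-1, 1] -> 0 <= g x <= M;
  adm_min : exists2 x : R, x \in `[-1, 1] & g x = 0 }.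

Section hull.
Context {R : realType}.
Implicit Types (M t m y : R) (g : R -> R) (x z : R * R).

Lemma itv11_conv (x y t : R) : x \in `[-1, 1] -> y \in `[-1, 1] ->
  0 <= t <= 1 -> (1 - t) * x + t * y \in `[-1, 1].
Proof.
rewrite !in_itv /= => /andP[x1 x2] /andP[y1 y2] /andP[t0 t1].
by apply/andP; split; nra.
Qed.

Lemma disk_conv x (y : R * R) t : disk x -> disk y -> 0 <= t <= 1 ->
  disk ((1 - t) *: x + t *: y).
Proof.
case: x => a b; case: y => c d; rewrite /disk /= => h1 h2 /andP[t0 t1].
rewrite /GRing.scale /=.
have h3 : a * c + b * d <= 1.
  have := sqr_ge0 (a - c); have := sqr_ge0 (b - d); rewrite !sqrrB !expr2 in h1 h2 *.
  lra.
have -> : ((1 - t) * a + t * c) ^+ 2 + ((1 - t) * b + t * d) ^+ 2 =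
  (1 - t) ^+ 2 * (a ^+ 2 + b ^+ 2) + t ^+ 2 * (c ^+ 2 + d ^+ 2)
  + 2 * (t * (1 - t)) * (a * c + b * d) by ring.
have h4 : 0 <= t * (1 - t) by rewrite mulr_ge0 // subr_ge0.
have := ler_wpM2l (sqr_ge0 (1 - t)) h1; have := ler_wpM2l (sqr_ge0 t) h2.
have := ler_wpM2l (mulr_ge0 (ler0n R 2) h4) h3.
lra.
Qed.

Lemma disk_axis (y : R) : y \in `[-1, 1] -> disk ((y, 0) : R * R).
Proof.
rewrite /disk /= in_itv /= => /andP[y1 y2].
rewrite expr0n addr0; nra.
Qed.

Lemma hull_ub M g z (y t : R) : disk z -> y \in `[-1, 1] -> 0 <= t <= 1 ->
  (generated M (axis_fun g) ((1 - t) *: z + t *: ((y, 0) : R * R))%R <=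
   ((1 - t) * M + t * g y)%:E)%E.
Proof.
move=> hz hy ht; apply: ereal_inf_lbound => /=.
exists t, z, (y, 0); split => //.
by rewrite /cvx_indic mem_set // /axis_fun /= hy eqxx /= add0e.
Qed.

(** The spanned function is an infimum over decompositions of x into a point of
    the disk at height M and a point of the axis.  The decompositions using a
    point where one of the functions is +oo matter only with weight 0, and
    these can be rewritten with both points in the domains. *)
Lemma hull_lb M g x m : (forall y, y \in `[-1, 1] -> 0 <= g y) -> 0 <= M ->
  (forall t z y, 0 <= t <= 1 -> disk z -> y \in `[-1, 1] ->
     (1 - t) *: z + t *: ((y, 0) : R * R) = x -> m <= (1 - t) * M + t * g y) ->
  (m%:E <= generated M (axis_fun g) x)%E.
Proof.
move=> g0 M0 H; apply/le_ereal_inf_tmp => r /= [t [x1 [x2 [ht hx ->]]]].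
have /andP[t0 t1] := ht.
have z11 : (0 : R) \in `[-1, 1] by rewrite in_itv /=; lra.
have [ts|ts] := boolP ((x2.1 \in `[-1, 1]) && (x2.2 == 0)).
- have /andP[h1 /eqP h2] := ts.
  have e2 : x2 = (x2.1, 0) by rewrite -h2 -surjective_pairing.
  rewrite /axis_fun ts.
  have [d1|d1] := boolP (x1 \in disk).
    rewrite /cvx_indic d1 add0e -!EFinM -EFinD lee_fin.
    by apply: (H t x1) => //; [exact: set_mem|rewrite -e2].
  rewrite /cvx_indic (negbTE d1) addye //.
  have [t1'|tn1] := eqVneq t 1.
    rewrite t1' subrr mul0e add0e -EFinM lee_fin.
    have := H 1 (0, 0) x2.1; rewrite subrr mul0r add0r; apply => //.
    + by rewrite ler01 lexx.
    + exact: disk_axis.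
    + by rewrite -hx -e2 t1' subrr scale0r scale0r.
  have tl : 0 < 1 - t by rewrite subr_gt0 lt_neqAle tn1.
  by rewrite gt0_muley ?lte_fin // -EFinM addye // leey.
- rewrite /axis_fun (negbTE ts).
  have [t0'|tn0] := eqVneq t 0.
    rewrite t0' mul0e adde0 subr0 mul1e.
    have [d1|d1] := boolP (x1 \in disk); last first.
      by rewrite /cvx_indic (negbTE d1) addye // leey.
    rewrite /cvx_indic d1 add0e lee_fin.
    have := H 0 x1 0; rewrite subr0 mul1r mul0r addr0; apply => //.
    + by rewrite lexx ler01.
    + exact: set_mem.
    + by rewrite -hx t0' subr0 !scale0r.
  have tl : 0 < t by rewrite lt_neqAle eq_sym tn0.
  rewrite gt0_muley ?lte_fin // addey ?leey //.
  rewrite /cvx_indic; case: ifP => _.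
    by rewrite add0e -EFinM.
  rewrite addye //.
  have [->|tn1] := eqVneq t 1; first by rewrite subrr mul0e.
  by rewrite gt0_muley // lte_fin subr_gt0 lt_neqAle tn1.
Qed.

Variables (M : R) (g : R -> R).
Hypothesis adm : admissible M g.
Let U := generated M (axis_fun g).

Lemma adm_ge0 y : y \in `[-1, 1] -> 0 <= g y.
Proof. by move=> /(adm_bnd adm)/andP[]. Qed.

Lemma adm_M_ge0 : 0 <= M.
Proof. by have [x hx] := adm_min adm; have /andP[] := adm_bnd adm hx; lra. Qed.

Lemma hull_offdisk x : ~ disk x -> U x = +oo%E.
Proof.
move=> nx.
have H m : (m%:E <= U x)%E.
  apply: hull_lb; [exact: adm_ge0|exact: adm_M_ge0|].
  move=> t z y ht hz hy e; exfalso; apply: nx; rewrite -e.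
  by apply: disk_conv => //; exact: disk_axis.
case: (U x) H => [r H|//|/(_ 0) //].
by have := H (r + 1); rewrite lee_fin gerDl ler10.
Qed.

Lemma hull_ge0 x : (0 <= U x)%E.
Proof.
apply: hull_lb; [exact: adm_ge0|exact: adm_M_ge0|] => t z y /andP[t0 t1] _ hy _.
by rewrite addr_ge0 // mulr_ge0 ?subr_ge0 ?adm_ge0 ?adm_M_ge0.
Qed.

Lemma hull_leM x : disk x -> (U x <= M%:E)%E.
Proof.
move=> dx.
have z11 : (0 : R) \in `[-1, 1] by rewrite in_itv /=; lra.
have := @hull_ub M g x 0 0 dx z11.
rewrite subr0 scale1r scale0r addr0 mul1r mul0r addr0; apply.
by rewrite lexx ler01.
Qed.

Lemma hull_fineK x : disk x -> (fine (U x))%:E = U x.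
Proof.
move=> dx; apply: fineK; rewrite ge0_fin_numE ?hull_ge0 //.
by apply: le_lt_trans (hull_leM dx) _; rewrite ltry.
Qed.

Lemma hull_fine_ub z (y t : R) : disk z -> y \in `[-1, 1] -> 0 <= t <= 1 ->
  fine (U ((1 - t) *: z + t *: ((y, 0%R) : R * R))) <= (1 - t) * M + t * g y.
Proof.
move=> hz hy ht; rewrite -lee_fin hull_fineK; first exact: hull_ub.
by apply: disk_conv => //; exact: disk_axis.
Qed.

Lemma hull_fine_lb x m : disk x ->
  (forall t z y, 0 <= t <= 1 -> disk z -> y \in `[-1, 1] ->
     (1 - t) *: z + t *: ((y, 0) : R * R) = x -> m <= (1 - t) * M + t * g y) ->
  m <= fine (U x).
Proof.
move=> dx H; rewrite -lee_fin hull_fineK //; apply: hull_lb => //.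
  exact: adm_ge0.
exact: adm_M_ge0.
Qed.

Lemma hull_approx x (e : R) : disk x -> 0 < e ->
  exists t z y, [/\ 0 <= t <= 1, disk z, y \in `[-1, 1],
    (1 - t) *: z + t *: ((y, 0) : R * R) = x &
    (1 - t) * M + t * g y < fine (U x) + e].
Proof.
move=> dx e0; apply: contrapT => H.
have : fine (U x) + e <= fine (U x).
  apply: hull_fine_lb => // t z y ht hz hy ex; rewrite leNgt; apply/negP => h.
  by apply: H; exists t, z, y.
by apply/negP; rewrite -ltNge ltrDl.
Qed.

(** Near optimal decompositions of x and y are merged: the weights of the two
    disk points and of the two axis points are added up, and g is convex. *)
Lemma hull_fine_cvx x (y : R * R) t : disk x -> disk y -> 0 <= t <= 1 ->
  fine (U ((1 - t) *: x + t *: y)) <= (1 - t) * fine (U x) + t * fine (U y).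
Proof.
move=> dx dy ht; have /andP[t0 t1] := ht.
apply/ler_addgt0Pr => e e0.
have [l [z [p [hl dz hp ex hx]]]] := hull_approx dx e0.
have [m [w [q [hm dw hq ey hy]]]] := hull_approx dy e0.
have /andP[l0 l1] := hl; have /andP[m0 m1] := hm.
set n := (1 - t) * l + t * m.
have n01 : 0 <= n <= 1 by rewrite /n; apply/andP; split; nra.
have /andP[n0 n1] := n01.
suff [zz [pos_part [dzz hpp E1 E2]]] : exists zz pos_part, [/\ disk zz, pos_part \in `[-1, 1],
  (1 - n) *: zz + n *: ((pos_part, 0) : R * R) = (1 - t) *: x + t *: y &
  n * g pos_part <= (1 - t) * l * g p + t * m * g q].
  rewrite -E1; apply: le_trans (hull_fine_ub dzz hpp n01) _.
  apply: le_trans (lerD (lexx _) E2) _.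
  have -> : (1 - n) * M + ((1 - t) * l * g p + t * m * g q) =
    (1 - t) * ((1 - l) * M + l * g p) + t * ((1 - m) * M + m * g q).
    by rewrite /n; ring.
  have t1' : 0 <= 1 - t by rewrite subr_ge0.
  have := ler_wpM2l t1' (ltW hx); have := ler_wpM2l t0 (ltW hy).
  lra.
have [pos_part [hpp F1 F2]] : exists pos_part, [/\ pos_part \in `[-1, 1],
    n * pos_part = (1 - t) * l * p + t * m * q &
    n * g pos_part <= (1 - t) * l * g p + t * m * g q].
  have [nz|nz] := eqVneq n 0.
    have a1 : (1 - t) * l = 0 by rewrite /n in nz; nra.
    have a2 : t * m = 0 by rewrite /n in nz; nra.
    by exists p; rewrite nz a1 a2 !mul0r !add0r.
  set r := t * m / n.
  have np : 0 < n by rewrite lt_neqAle eq_sym nz.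
  have r01 : 0 <= r <= 1.
    rewrite /r divr_ge0 ?mulr_ge0 //= ler_pdivrMr // mul1r /n lerDr mulr_ge0 //.
    by rewrite subr_ge0.
  have nr : n * r = t * m by rewrite /r mulrCA divff // mulr1.
  have nr1 : n * (1 - r) = (1 - t) * l by rewrite mulrBr mulr1 nr /n; ring.
  exists ((1 - r) * p + r * q); split; first exact: itv11_conv.
    by rewrite mulrDr 2!(mulrA n) nr nr1.
  have := ler_wpM2l n0 (adm_cvx adm hp hq r01).
  by rewrite (mulrDr n) 2!(mulrA n) nr nr1.
have [zz [dzz F3]] : exists zz, disk zz /\
    (1 - n) *: zz = ((1 - t) * (1 - l)) *: z + (t * (1 - m)) *: w.
  have [nz|nz] := eqVneq (1 - n) 0.
    have a1 : (1 - t) * (1 - l) = 0 by rewrite /n in nz; nra.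
    have a2 : t * (1 - m) = 0 by rewrite /n in nz; nra.
    by exists z; rewrite nz a1 a2 !scale0r addr0.
  set r := t * (1 - m) / (1 - n).
  have np : 0 < 1 - n by rewrite lt_neqAle eq_sym nz subr_ge0.
  have r01 : 0 <= r <= 1.
    rewrite /r divr_ge0 ?mulr_ge0 ?subr_ge0 //= ler_pdivrMr // mul1r /n; nra.
  have nr : (1 - n) * r = t * (1 - m) by rewrite /r mulrCA divff // mulr1.
  have nr1 : (1 - n) * (1 - r) = (1 - t) * (1 - l).
    by rewrite mulrBr mulr1 nr /n; ring.
  exists ((1 - r) *: z + r *: w); split; first exact: disk_conv.
  by rewrite scalerDr !scalerA nr nr1.
exists zz, pos_part; split => //; rewrite F3 -ex -ey.
rewrite !scalerDr !scalerA addrACA; congr (_ + _).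
by congr pair => /=; rewrite ?scaler0 ?addr0 //; exact: F1.
Qed.

Lemma hull_cvx_ext : convex_ext U.
Proof.
move=> x y t ht; have /andP[t0 t1] := ht.
have [t0'|tn0] := eqVneq t 0.
  by rewrite t0' subr0 scale1r scale0r addr0 mul1e mul0e adde0.
have [t1'|tn1] := eqVneq t 1.
  by rewrite t1' subrr scale1r scale0r add0r mul1e mul0e add0e.
have tp : 0 < t by rewrite lt_neqAle eq_sym tn0.
have tl : 0 < 1 - t by rewrite subr_gt0 lt_neqAle tn1.
have [dx|dx] := pselect (disk x); last first.
  rewrite (hull_offdisk dx) gt0_muley ?lte_fin // addye ?leey //.
  by rewrite gt_eqF // (lt_le_trans ltNy0) // mule_ge0 ?lee_fin ?hull_ge0.
have [dy|dy] := pselect (disk y); last first.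
  rewrite (hull_offdisk dy) gt0_muley ?lte_fin // addey ?leey //.
  by rewrite gt_eqF // (lt_le_trans ltNy0) // mule_ge0 ?lee_fin ?hull_ge0 // ltW.
rewrite -(hull_fineK dx) -(hull_fineK dy) -!EFinM -EFinD.
rewrite -hull_fineK; last exact: disk_conv.
by rewrite lee_fin; exact: hull_fine_cvx.
Qed.

Lemma hull_min : exists2 x, disk x & U x = 0%E.
Proof.
have [x hx gx] := adm_min adm; exists (x, 0); first exact: disk_axis.
apply/eqP; rewrite eq_le hull_ge0 andbT.
have d0 : disk ((0, 0) : R * R) by apply: disk_axis; rewrite in_itv /=; lra.
have := @hull_ub M g (0, 0) x 1 d0 hx; rewrite subrr mul0r add0r mul1r gx.
have -> : 0 *: ((0, 0) : R * R) + 1 *: ((x, 0) : R * R) = (x, 0).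
  by rewrite scale0r scale1r add0r.
by apply; rewrite ler01 lexx.
Qed.

Lemma hull_in_C : lower_semicontinuous U -> C_ M U.
Proof.
move=> lsc; split => //.
- exact: hull_cvx_ext.
- apply/seteqP; split => x /= hx.
    by apply: contrapT => /hull_offdisk ex; rewrite ex ltxx in hx.
  by apply: le_lt_trans (hull_leM hx) _; rewrite ltry.
- apply/eqP; rewrite eq_le; apply/andP; split.
    by have [x _ <-] := hull_min; apply: ereal_inf_lbound; exists x.
  by apply/le_ereal_inf_tmp => _ [x _ <-]; exact: hull_ge0.
- exact: hull_leM.
Qed.

Lemma axis_fun_generator : generator M (axis_fun g).
Proof.
split.
- move=> x y t ht; have /andP[t0 t1] := ht.
  have segNy z : axis_fun g z != -oo%E by rewrite /axis_fun; case: ifP.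
  have [t0'|tn0] := eqVneq t 0.
    by rewrite t0' subr0 scale1r scale0r addr0 mul1e mul0e adde0.
  have [t1'|tn1] := eqVneq t 1.
    by rewrite t1' subrr scale1r scale0r add0r mul1e mul0e add0e.
  have tp : 0 < t by rewrite lt_neqAle eq_sym tn0.
  have tl : 0 < 1 - t by rewrite subr_gt0 lt_neqAle tn1.
  rewrite {2 3}/axis_fun; case: ifP => [/andP[x1 /eqP x2]|_]; last first.
    rewrite gt0_muley ?lte_fin // addye ?leey //; case: ifP => _ //.
    by rewrite gt0_muley ?lte_fin.
  case: ifP => [/andP[y1 /eqP y2]|_]; last by rewrite gt0_muley ?lte_fin // addey ?leey.
  rewrite /axis_fun /= x2 y2 !scaler0 addr0 eqxx itv11_conv //=.
  rewrite -!EFinM -EFinD lee_fin; exact: (adm_cvx adm).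
- move=> x hx; rewrite /axis_fun; case: ifP => // /andP[h1 /eqP h2]; exfalso; exact: hx.
- move=> x hx; rewrite /axis_fun /= hx eqxx /= !lee_fin; exact: (adm_bnd adm).
- have [x hx gx] := adm_min adm.
  apply/eqP; rewrite eq_le; apply/andP; split.
    by apply: ereal_inf_lbound; exists (x, 0) => //; rewrite /axis_fun /= hx eqxx gx.
  apply/le_ereal_inf_tmp => _ [[a b] _ <-]; rewrite /axis_fun; case: ifP => // /andP[ha _].
  by rewrite lee_fin; have /andP[] := adm_bnd adm ha.
- by have [x hx gx] := adm_min adm; exists (x, 0); rewrite /axis_fun /= hx eqxx gx.
Qed.

End hull.

Lemma generator_axis_fun {R : realType} (M : R) (u0 : R * R -> \bar R) :
  generator M u0 -> let g := fun x => fine (u0 (x, 0)) in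
  admissible M g /\ u0 = axis_fun g.
Proof.
move=> [cvx out bnd inf0 [x0 ux0]] g.
have fg x : x \in `[-1, 1] -> u0 (x, 0) = (g x)%:E.
  move=> hx; rewrite /g fineK // ge0_fin_numE; have /andP[h1 h2] := bnd x hx => //.
  by apply: le_lt_trans h2 _; rewrite ltry.
have uE : u0 = axis_fun g.
  apply/funext => -[a b]; rewrite /axis_fun /=; case: ifP => [/andP[ha /eqP ->]|h].
    exact: fg.
  by apply: out => /= -[h1 h2]; move: h; rewrite h1 h2 eqxx.
split => //; split.
- move=> x y t hx hy ht; rewrite -lee_fin EFinD !EFinM -!fg ?itv11_conv //.
  have := cvx (x, 0) (y, 0) t ht.
  have -> // : (1 - t) *: ((x, 0) : R * R) + t *: ((y, 0) : R * R) = ((1 - t) * x + t * y, 0).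
  by congr pair; rewrite /= !scaler0 addr0.
- by move=> x hx; rewrite -!lee_fin -fg //; exact: bnd.
- move: ux0; rewrite uE /axis_fun; case: ifP => // /andP[h1 _] [e].
  by exists x0.1.
Qed.

(** * Rulings *)

(** The slope c gives the gradient (c, ordinate v c) of norm v c at which the
    conjugate |p| - M of the circle at height M meets the conjugate v - M of
    the profile. *)
Definition ordinate {R : realType} (v : R -> R) (c : R) := Num.sqrt (v c ^+ 2 - c ^+ 2).

(** The ruling of slope c joins (v1 c, 0) to (c / v c, +- ordinate v c / v c).
    This is v c times a normal form of its equation; it is negative to the left
    of the ruling.  The absolute value treats the two symmetric rulings at
    once. *)
Definition side {R : realType} (v v1 : R -> R) (c : R) (x : R * R) :=
  ordinate v c * (x.1 - v1 c) - `|x.2| * (c - v c * v1 c).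

(** Maximum of the two affine functions of gradient (c, +- ordinate v c) that
    support the spanned function, up to the constant M. *)
Definition plane {R : realType} (v : R -> R) (c : R) (x : R * R) :=
  c * x.1 + ordinate v c * `|x.2| - v c.

(** What is used of v = u0^* + M over an open interval of slopes; v1 and v2 are
    its first two derivatives. *)
Record arc {R : realType} (lo hi : R) (v v1 v2 : R -> R) : Prop := Arc {
  arc_d1 : forall c, c \in `]lo, hi[ -> is_derive c 1 v (v1 c);
  arc_d2 : forall c, c \in `]lo, hi[ -> is_derive c 1 v1 (v2 c);
  arc_pos : forall c, c \in `]lo, hi[ -> 0 < v2 c;
  arc_cont : forall c, c \in `]lo, hi[ -> {for c, continuous v2};
  arc_v1 : forall c, c \in `]lo, hi[ -> -1 < v1 c < 1;
  arc_lt : forall c, c \in `]lo, hi[ -> - v c < c < v c }.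

(** The line of slope c and height M - v c at 0 supports g exactly at v1 c. *)
Record contact {R : realType} (M lo hi : R) (g v v1 : R -> R) : Prop := Contact {
  contact_eq : forall c, c \in `]lo, hi[ -> g (v1 c) = c * v1 c - v c + M;
  contact_le : forall c y, c \in `]lo, hi[ -> y \in `[-1, 1] ->
    c * y - v c + M <= g y }.

Section calc.
Context {R : realType}.

Lemma derive_continuous (f : R -> R) (x d : R) :
  is_derive x 1 f d -> {for x, continuous f}.
Proof. by move=> h; apply/differentiable_continuous/derivable1_diffP. Qed.

Lemma mvt (f df : R -> R) (a b : R) : a < b ->
  (forall x, x \in `[a, b] -> is_derive x 1 f (df x)) ->
  exists2 c, c \in `]a, b[ & f b - f a = df c * (b - a).
Proof.
move=> ab h.
have h1 x : x \in `]a, b[ -> is_derive x 1 f (df x).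
  by move=> xab; apply: h; exact: subset_itv_oo_cc xab.
have h2 : {within `[a, b], continuous f}.
  by apply: derivable_within_continuous => x xab; case: (h x xab).
exact: MVT ab h1 h2.
Qed.

End calc.

Section ruling.
Context {R : realType}.
Variables (c v q B : R).
Hypotheses (q0 : 0 < q) (v0 : 0 < v) (hq : q ^+ 2 = v ^+ 2 - c ^+ 2)
  (hB : -1 < B < 1).

Lemma ruling_dot_le (a b : R) : a ^+ 2 + b ^+ 2 <= 1 -> c * a + q * b <= v.
Proof.
move=> h; have [|h1] := leP (c * a + q * b) v => //.
have : (c * a + q * b) ^+ 2 <= v ^+ 2.
  have -> : (c * a + q * b) ^+ 2 =
    (c ^+ 2 + q ^+ 2) * (a ^+ 2 + b ^+ 2) - (c * b - q * a) ^+ 2 by ring.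
  rewrite hq (addrC (c ^+ 2)) subrK.
  have := ler_wpM2l (sqr_ge0 v) h; have := sqr_ge0 (c * b - q * a); lra.
have p1 : 0 < c * a + q * b - v by rewrite subr_gt0.
have p2 : 0 < c * a + q * b + v by rewrite addr_gt0 // (lt_trans v0).
have := mulr_gt0 p1 p2; lra.
Qed.

(** On the line through (B, 0) and the boundary point (c, q) / v, the function
    x |-> |x|^2 - 1 is quadratic with one root at the boundary point and its
    other root beyond (B, 0), so the disk cuts out the segment. *)
Lemma ruling_param (x : R * R) : disk x -> q * (x.1 - B) = `|x.2| * (c - v * B) ->
  exists t, [/\ 0 <= t <= 1, x.1 = (1 - t) * B + t * (c / v), `|x.2| = t * (q / v) &
    x.1 ^+ 2 + x.2 ^+ 2 < 1 -> t < 1].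
Proof.
move=> dx hx; set t := `|x.2| * v / q.
have qn : q != 0 by rewrite gt_eqF.
have vn : v != 0 by rewrite gt_eqF.
have t0 : 0 <= t by rewrite /t divr_ge0 ?mulr_ge0 // ltW.
have e2 : `|x.2| = t * (q / v) by rewrite /t; field; rewrite qn vn.
have e1 : x.1 = (1 - t) * B + t * (c / v).
  have -> : x.1 = B + `|x.2| * (c - v * B) / q by rewrite -hx; field.
  by rewrite /t; field; rewrite qn vn.
have key : x.1 ^+ 2 + x.2 ^+ 2 - 1 =
    (t - 1) * (t * ((c / v - B) ^+ 2 + (q / v) ^+ 2) + (1 - B ^+ 2)).
  rewrite -(real_normK (num_real x.2)) e2 e1.
  have h1 : (q / v) ^+ 2 = 1 - (c / v) ^+ 2.
    by rewrite !expr_div_n hq mulrBl divff // sqrf_eq0.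
  rewrite exprMn h1; ring.
have pos : 0 < t * ((c / v - B) ^+ 2 + (q / v) ^+ 2) + (1 - B ^+ 2).
  have h1 : 0 <= t * ((c / v - B) ^+ 2 + (q / v) ^+ 2).
    by rewrite mulr_ge0 ?addr_ge0 ?sqr_ge0.
  have h2 : 0 < 1 - B ^+ 2 by case/andP: hB => b1 b2; rewrite expr2; nra.
  exact: ltr_wpDl h1 h2.
exists t; split => //.
  rewrite t0 /=; move: dx; rewrite /disk /= -subr_le0 key.
  by rewrite pmulr_lle0 // subr_le0.
by rewrite -subr_lt0 key pmulr_llt0 // subr_lt0.
Qed.

End ruling.

Section arc_theory.
Context {R : realType}.
Variables (lo hi : R) (v v1 v2 : R -> R).
Hypothesis A : arc lo hi v v1 v2.
Implicit Types (c : R) (x : R * R).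

Local Notation Q := (fun c : R => c \in `]lo, hi[).

Lemma arc_pos_v c : Q c -> 0 < v c.
Proof. by move=> /(arc_lt A)/andP[h1 h2]; lra. Qed.

Lemma ordinate_gt0 c : Q c -> 0 < ordinate v c.
Proof.
move=> /(arc_lt A)/andP[h1 h2]; rewrite sqrtr_gt0 !expr2; nra.
Qed.

Lemma ordinate_sqr c : Q c -> ordinate v c ^+ 2 = v c ^+ 2 - c ^+ 2.
Proof.
move=> /(arc_lt A)/andP[h1 h2]; rewrite sqr_sqrtr // !expr2; nra.
Qed.

Lemma arc_sub a b c : Q a -> Q b -> c \in `[a, b] -> Q c.
Proof.
rewrite !in_itv /= => /andP[a1 a2] /andP[b1 b2] /andP[c1 c2].
by rewrite (lt_le_trans a1) //= (le_lt_trans c2).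
Qed.

Lemma arc_v1_incr a b : Q a -> Q b -> a < b -> v1 a < v1 b.
Proof.
move=> Qa Qb ab; have := @mvt R v1 v2 a b ab.
case=> [x xab|x xab e]; first by apply: (arc_d2 A); exact: (arc_sub Qa Qb).
rewrite -subr_gt0 e mulr_gt0 ?subr_gt0 //; apply: (arc_pos A).
by apply: (arc_sub Qa Qb); exact: subset_itv_oo_cc.
Qed.

(** Strict convexity of v. *)
Lemma arc_tangent a b : Q a -> Q b -> a != b -> v a + v1 a * (b - a) < v b.
Proof.
move=> Qa Qb; rewrite neq_lt => /orP[ab|ba].
- have [x xab|x xab e] := @mvt R v v1 a b ab.
    by apply: (arc_d1 A); exact: (arc_sub Qa Qb).
  have Qx : Q x by apply: (arc_sub Qa Qb); exact: subset_itv_oo_cc.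
  have ax : a < x by move: xab; rewrite in_itv => /andP[].
  rewrite addrC -ltrBrDr e ltr_pM2r ?subr_gt0 //; exact: arc_v1_incr.
- have [x xab|x xab e] := @mvt R v v1 b a ba.
    by apply: (arc_d1 A); exact: (arc_sub Qb Qa).
  have Qx : Q x by apply: (arc_sub Qb Qa); exact: subset_itv_oo_cc.
  have ax : x < a by move: xab; rewrite in_itv => /andP[].
  have := arc_v1_incr Qx Qa ax; nra.
Qed.

Lemma arc_tangent_le a b : Q a -> Q b -> v a + v1 a * (b - a) <= v b.
Proof.
move=> Qa Qb; have [->|ab] := eqVneq a b; first by rewrite subrr mulr0 addr0.
exact: ltW (arc_tangent Qa Qb ab).
Qed.

Lemma arc_ruling c x : Q c -> disk x -> side v v1 c x = 0 ->
  exists t, [/\ 0 <= t <= 1, x.1 = (1 - t) * v1 c + t * (c / v c),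
    `|x.2| = t * (ordinate v c / v c) & x.1 ^+ 2 + x.2 ^+ 2 < 1 -> t < 1].
Proof.
move=> Qc dx /eqP; rewrite subr_eq0 => /eqP.
apply: ruling_param => //; [exact: ordinate_gt0|exact: arc_pos_v|exact: ordinate_sqr|].
exact: (arc_v1 A).
Qed.

Lemma arc_dot_le c a b : Q c -> a ^+ 2 + b ^+ 2 <= 1 -> c * a + ordinate v c * b <= v c.
Proof.
move=> Qc; apply: (@ruling_dot_le R c (v c) (ordinate v c)) => //.
exact: arc_pos_v.
exact: ordinate_sqr.
Qed.

Lemma arc_unit c : Q c -> (c / v c) ^+ 2 + (ordinate v c / v c) ^+ 2 = 1.
Proof.
move=> Qc; rewrite !expr_div_n (ordinate_sqr Qc) -mulrDl addrC subrK divff //.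
by rewrite sqrf_eq0 gt_eqF // arc_pos_v.
Qed.

Lemma arc_unit_plane c : Q c -> c * (c / v c) + ordinate v c * (ordinate v c / v c) = v c.
Proof.
move=> Qc; rewrite !mulrA -mulrDl -!expr2 (ordinate_sqr Qc) addrC subrK expr2 mulfK //.
by rewrite gt_eqF // arc_pos_v.
Qed.

(** At the boundary end of the ruling of slope c, the plane of slope d is at most
    M by Cauchy-Schwarz; at the axis end it is strictly lower because v is
    strictly convex.  Inside the disk the axis end has positive weight. *)
Lemma plane_ruling_lt c d x : Q c -> Q d -> c != d -> x.1 ^+ 2 + x.2 ^+ 2 < 1 ->
  side v v1 c x = 0 -> plane v d x < plane v c x.
Proof.
move=> Qc Qd cd x1 sx.
have [t [/andP[t0 _] e1 e2 /(_ x1) t1]] := arc_ruling Qc (ltW x1) sx.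
rewrite /plane e1 e2.
have h1 : d * (c / v c) + ordinate v d * (ordinate v c / v c) <= v d.
  by apply: arc_dot_le => //; rewrite arc_unit.
have h2 := arc_tangent Qc Qd cd.
have h3 := arc_unit_plane Qc.
have h4 : d * v1 c - v d < c * v1 c - v c by lra.
have h5 : (1 - t) * (d * v1 c - v d) < (1 - t) * (c * v1 c - v c).
  by rewrite ltr_pM2l // subr_gt0.
have h6 := ler_wpM2l t0 h1.
have -> : c * ((1 - t) * v1 c + t * (c / v c)) + ordinate v c * (t * (ordinate v c / v c)) - v c
  = (1 - t) * (c * v1 c - v c).
  transitivity ((1 - t) * (c * v1 c - v c) +
    t * (c * (c / v c) + ordinate v c * (ordinate v c / v c) - v c)); first by ring.
  by rewrite h3 subrr mulr0 addr0.
have -> : d * ((1 - t) * v1 c + t * (c / v c)) + ordinate v d * (t * (ordinate v c / v c)) - v d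
  = (1 - t) * (d * v1 c - v d) +
    t * (d * (c / v c) + ordinate v d * (ordinate v c / v c) - v d) by ring.
have h7 : t * (d * (c / v c) + ordinate v d * (ordinate v c / v c) - v d) <= 0.
  by rewrite mulr_ge0_le0 // subr_le0.
lra.
Qed.

End arc_theory.

Definition open_disk {R : realType} : set (R * R) := [set x | x.1 ^+ 2 + x.2 ^+ 2 < 1].

Section side_theory.
Context {R : realType}.
Variables (lo hi : R) (v v1 v2 : R -> R).
Hypothesis A : arc lo hi v v1 v2.
Implicit Types (c : R) (x : R * R).

Local Notation Q := (fun c : R => c \in `]lo, hi[).

(** The point at parameter th on the segment from (b, 0) to x; the function
    [side] is affine along it, because the sign of the ordinate is constant. *)
Definition toward (b : R) (th : R) (x : R * R) : R * R := ((1 - th) * b + th * x.1, th * x.2).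

Lemma side_toward c b th x : 0 <= th ->
  side v v1 c (toward b th x) =
  (1 - th) * (ordinate v c * (b - v1 c)) + th * side v v1 c x.
Proof. by move=> t0; rewrite /side /toward /= normrM (ger0_norm t0); ring. Qed.

Lemma open_disk_toward b th x : b ^+ 2 <= 1 -> open_disk x -> 0 < th <= 1 -> open_disk (toward b th x).
Proof.
rewrite /open_disk /toward /= => b1 x1 /andP[t0 t1].
have -> : ((1 - th) * b + th * x.1) ^+ 2 + (th * x.2) ^+ 2 =
  (1 - th) * b ^+ 2 + th * (x.1 ^+ 2 + x.2 ^+ 2)
  - th * (1 - th) * ((b - x.1) ^+ 2 + x.2 ^+ 2) by ring.
have h1 : 0 <= th * (1 - th) * ((b - x.1) ^+ 2 + x.2 ^+ 2).
  by apply: mulr_ge0; [apply: mulr_ge0; lra|rewrite addr_ge0 ?sqr_ge0].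
have h2 : (1 - th) * b ^+ 2 <= (1 - th) by rewrite ler_piMr // subr_ge0.
have h3 : th * (x.1 ^+ 2 + x.2 ^+ 2) < th by rewrite gtr_pMr.
lra.
Qed.

Lemma open_disk_sub x : open_disk x -> disk x.
Proof. exact: ltW. Qed.

Lemma arc_v1_sqr c : Q c -> v1 c ^+ 2 < 1.
Proof. by move=> /(arc_v1 A)/andP[h1 h2]; rewrite expr2; nra. Qed.

Lemma zero_between (a b : R) : 0 < a -> b <= 0 -> exists th, 0 < th <= 1 /\ (1 - th) * a + th * b = 0.
Proof.
move=> a0 b0; have h : 0 < a - b by lra.
exists (a / (a - b)); split.
  by rewrite divr_gt0 //= ler_pdivrMr // mul1r lerDl oppr_ge0.
by field; rewrite gt_eqF.
Qed.

(** At a common point each of the two planes would be strictly below the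
    other. *)
Lemma rulings_disjoint c d x : Q c -> Q d -> open_disk x ->
  side v v1 c x = 0 -> side v v1 d x = 0 -> c = d.
Proof.
move=> Qc Qd ox sc sd; apply/eqP; apply: contraT => cd.
have := plane_ruling_lt A Qc Qd cd ox sc.
rewrite eq_sym in cd.
have := plane_ruling_lt A Qd Qc cd ox sd.
by move=> /lt_trans h /h; rewrite ltxx.
Qed.

(** If x were left of the ruling c but not left of the ruling d > c, then z, the
    point where the segment from (v1 d, 0) to x crosses the ruling c, would not
    be left of d either, whereas (v1 c, 0) is.  So the two rulings would meet
    between (v1 c, 0) and z. *)
Lemma side_decr c d x : Q c -> Q d -> c < d -> open_disk x ->
  side v v1 c x <= 0 -> side v v1 d x < 0.
Proof.
move=> Qc Qd cd ox sc; rewrite ltNge; apply/negP => sd.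
have B : v1 c < v1 d by exact: (arc_v1_incr A).
have qc := ordinate_gt0 A Qc; have qd := ordinate_gt0 A Qd.
have h1 : 0 < ordinate v c * (v1 d - v1 c) by rewrite mulr_gt0 // subr_gt0.
have [th [ht e]] := zero_between h1 sc.
have th0 : 0 <= th by case/andP: ht => /ltW.
set z := toward (v1 d) th x.
have oz : open_disk z by apply: open_disk_toward => //; exact: ltW (arc_v1_sqr Qd).
have sz : side v v1 c z = 0 by rewrite side_toward.
have sdz : 0 <= side v v1 d z.
  by rewrite side_toward // subrr mulr0 mulr0 add0r mulr_ge0.
have h2 : 0 < - (ordinate v d * (v1 c - v1 d)).
  by rewrite -mulrN opprB mulr_gt0 // subr_gt0.
have h3 : - side v v1 d z <= 0 by rewrite oppr_le0.
have [et [he e']] := zero_between h2 h3.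
have et0 : 0 <= et by case/andP: he => /ltW.
set w := toward (v1 c) et z.
have ow : open_disk w by apply: open_disk_toward => //; exact: ltW (arc_v1_sqr Qc).
have : c = d.
  apply: (@rulings_disjoint _ _ w) => //.
    by rewrite side_toward // subrr mulr0 mulr0 add0r sz mulr0.
  by rewrite side_toward //; lra.
by move=> e0; rewrite e0 ltxx in cd.
Qed.

Lemma ordinate_cont c : Q c -> {for c, continuous (ordinate v)}.
Proof.
move=> Qc; have cv := derive_continuous (arc_d1 A Qc).
apply: (@continuous_comp _ _ _ (fun c => v c ^+ 2 - c ^+ 2) Num.sqrt); last exact: sqrt_continuous.
by apply: cvgB; apply: cvgM => //; exact: cvg_id.
Qed.

Lemma side_cont c x : Q c -> {for c, continuous (fun c => side v v1 c x)}.
Proof.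
move=> Qc; have cv := derive_continuous (arc_d1 A Qc).
have cv1 := derive_continuous (arc_d2 A Qc).
apply: cvgB; apply: cvgM.
- exact: ordinate_cont.
- by apply: cvgB => //; exact: cvg_cst.
- exact: cvg_cst.
- by apply: cvgB; [exact: cvg_id|exact: cvgM].
Qed.

Lemma side_zero a b x : Q a -> Q b -> a <= b -> side v v1 b x <= 0 -> 0 <= side v v1 a x ->
  exists2 c, c \in `[a, b] & side v v1 c x = 0.
Proof.
move=> Qa Qb ab sb sa.
have [||c cab e] := @IVT R (fun c => side v v1 c x) a b 0 ab.
- apply: continuous_in_subspaceT => c; rewrite inE /= => cab.
  by apply: side_cont; exact: (arc_sub Qa Qb).
- by rewrite ge_min le_max sb sa orbT.
- by exists c.
Qed.

Section with_hull.
Variables (M : R) (g : R -> R).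
Hypothesis adm : admissible M g.
Hypothesis ct : contact M lo hi g v v1.
Let U := generated M (axis_fun g).

Lemma v1_itv c : Q c -> v1 c \in `[-1, 1].
Proof. by move=> /(arc_v1 A)/andP[h1 h2]; rewrite in_itv /= !ltW. Qed.

(** The plane lies below M on the disk by Cauchy-Schwarz, and below g on the
    axis by contact. *)
Lemma plane_le_hull c x : Q c -> disk x -> plane v c x + M <= fine (U x).
Proof.
move=> Qc dx; apply: hull_fine_lb => // t z y /andP[t0 t1] dz hy <-.
rewrite /plane /= scaler0 addr0.
have -> : `|(1 - t) *: z.2| = (1 - t) * `|z.2|.
  by rewrite normrM ger0_norm // subr_ge0.
have h1 : c * z.1 + ordinate v c * `|z.2| <= v c.
  by apply: (arc_dot_le A) => //; rewrite real_normK // num_real.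
have h2 := contact_le ct Qc hy.
have t1' : 0 <= 1 - t by rewrite subr_ge0.
have := ler_wpM2l t1' h1; have := ler_wpM2l t0 h2.
rewrite /GRing.scale /=; lra.
Qed.

(** A point of the ruling is a convex combination of its ends, where the plane
    takes the values M and g (v1 c). *)
Lemma plane_eq_hull c x : Q c -> disk x -> side v v1 c x = 0 ->
  fine (U x) = plane v c x + M.
Proof.
move=> Qc dx sc; apply/eqP; rewrite eq_le plane_le_hull // andbT.
have [t [ht e1 e2 _]] := arc_ruling A Qc dx sc.
have /andP[t0 t1] := ht.
have qv : 0 <= ordinate v c / v c by rewrite ltW // divr_gt0 ?(ordinate_gt0 A) ?(arc_pos_v A).
have [z [dz ez]] : exists z, disk z /\ (1 - (1 - t)) *: z + (1 - t) *: ((v1 c, 0) : R * R) = x.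
  exists (c / v c, if 0 <= x.2 then ordinate v c / v c else - (ordinate v c / v c)); split.
    by rewrite /disk /=; case: ifP => _; rewrite ?sqrrN (arc_unit A Qc).
  case: x e1 e2 {dx sc} => a b /= e1 e2; congr pair; rewrite /= ?scaler0 ?addr0 /GRing.scale /=.
    by rewrite e1; ring.
  case: ifPn => [b0|]; first by rewrite ger0_norm // in e2; rewrite e2; ring.
  by rewrite -ltNge => /ltr0_norm b0; rewrite b0 in e2; rewrite mulrN opprB addrC subrK -e2 opprK.
have ht' : 0 <= 1 - t <= 1 by apply/andP; split; lra.
rewrite -{1}ez; apply: le_trans (hull_fine_ub adm dz (v1_itv Qc) ht') _.
rewrite (contact_eq ct Qc) /plane e1 e2.
have h3 := arc_unit_plane A Qc.
have -> : c * ((1 - t) * v1 c + t * (c / v c)) + ordinate v c * (t * (ordinate v c / v c)) =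
  (1 - t) * (c * v1 c) + t * (c * (c / v c) + ordinate v c * (ordinate v c / v c)) by ring.
rewrite h3; lra.
Qed.

End with_hull.
End side_theory.

Section agree.
Context {R : realType}.
Variables (lo hi : R) (v v1 v2 w w1 w2 : R -> R).
Hypotheses (A : arc lo hi v v1 v2) (A' : arc lo hi w w1 w2).
Variables (M : R) (g h : R -> R).
Hypotheses (ag : admissible M g) (ah : admissible M h).
Hypotheses (cg : contact M lo hi g v v1) (ch : contact M lo hi h w w1).
Local Notation Q := (fun c : R => c \in `]lo, hi[).

(** A segment from a point y of the axis to a point z of the disk that passes
    through x after crossing the ruling c cannot give x a value below that of
    the function spanned by g: at the crossing point the two spanned functions
    agree, and from there on convexity of the first one applies. *)
Lemma hull_cross c t z (y : R) x : Q c -> v c = w c -> v1 c = w1 c ->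
  0 <= t <= 1 -> disk z -> y \in `[-1, 1] ->
  (1 - t) *: z + t *: ((y, 0) : R * R) = x ->
  side v v1 c x * (y - v1 c) < 0 ->
  fine (generated M (axis_fun g) x) <= (1 - t) * M + t * h y.
Proof.
move=> Qc e0 e1 ht dz hy ex sxy; have /andP[t0 t1] := ht.
have dx : disk x by rewrite -ex; apply: disk_conv => //; exact: disk_axis.
have q0 := ordinate_gt0 A Qc.
set s := side v v1 c x in sxy *.
set p := ordinate v c * (y - v1 c).
have sp : s * p < 0 by rewrite /p mulrCA pmulr_rlt0.
have ps : p - s != 0.
  by rewrite subr_eq0; apply: contraTneq sp => ->; rewrite -expr2 -leNgt sqr_ge0.
pose th := p / (p - s).
have th01 : 0 < th < 1.
  case: (ltgtP p 0) => hp.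
  - have s0 : 0 < s by rewrite nmulr_llt0 in sp.
    rewrite /th ltr_ndivlMr ?ltr_ndivrMr; lra.
  - have s0 : s < 0 by rewrite pmulr_llt0 in sp.
    rewrite /th ltr_pdivlMr ?ltr_pdivrMr; lra.
  - by rewrite hp mulr0 ltxx in sp.
have /andP[th0 th1] := th01.
have hth : 0 <= th <= 1 by rewrite !ltW.
pose x' := toward y th x.
have sx' : side v v1 c x' = 0.
  by rewrite side_toward ?ltW // -/p -/s /th; field.
have ex' : x' = (1 - th) *: ((y, 0) : R * R) + th *: x.
  by rewrite /x' /toward; congr pair => /=; rewrite scaler0 add0r.
have dx' : disk x' by rewrite ex'; apply: disk_conv => //; exact: disk_axis.
have eqx' : fine (generated M (axis_fun h) x') = fine (generated M (axis_fun g) x').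
  rewrite (plane_eq_hull A ag cg Qc dx' sx') (plane_eq_hull A' ah ch Qc dx').
    by rewrite /plane /ordinate e0.
  by rewrite -[RHS]sx' /side /ordinate e0 e1.
(* the decomposition of x passes through x', which gives an upper bound there *)
pose n := 1 - th + th * t.
have n01 : 0 <= n <= 1 by rewrite /n; apply/andP; split; nra.
have en : (1 - n) *: z + n *: ((y, 0) : R * R) = x'.
  rewrite ex' -ex /n; case: (z) => z1 z2; congr pair; rewrite /= /GRing.scale /=; ring.
have up : fine (generated M (axis_fun g) x') <= (1 - n) * M + n * h y.
  by rewrite -eqx' -en; exact: hull_fine_ub.
have n0 : 0 < n by rewrite /n ltr_wpDr ?subr_gt0 // mulr_ge0 // ltW.
pose k := t / n.
have kn : k * n = t by rewrite /k divfK // gt_eqF.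
have k01 : 0 <= k <= 1.
  rewrite /k divr_ge0 ?ler_pdivrMr ?mul1r ?(ltW n0) //= /n; nra.
have /andP[k0 k1] := k01.
have exk : (1 - k) *: z + k *: x' = x.
  rewrite -ex -en scalerDr !scalerA kn addrA -scalerDl; congr (_ *: _ + _).
  by rewrite mulrBr kn; ring.
have := hull_fine_cvx ag dz dx' k01; rewrite exk => H.
apply: le_trans H _.
have h1 : fine (generated M (axis_fun g) z) <= M.
  by rewrite -lee_fin (hull_fineK ag dz); exact: hull_leM.
have k1' : 0 <= 1 - k by rewrite subr_ge0.
have := ler_wpM2l k1' h1; have := ler_wpM2l k0 up.
have -> : k * ((1 - n) * M + n * h y) = (k - k * n) * M + k * n * h y by ring.
rewrite kn; lra.
Qed.

Variables (a b : R).
Hypotheses (Qa : Q a) (Qb : Q b) (ab : a < b).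
Hypotheses (va : v a = w a) (v1a : v1 a = w1 a) (vb : v b = w b) (v1b : v1 b = w1 b).
Hypothesis gh : forall y, y \in `[-1, 1] -> y \notin `]v1 a, v1 b[ -> g y = h y.

Lemma hull_le_off x : disk x -> side v v1 a x < 0 \/ 0 < side v v1 b x ->
  fine (generated M (axis_fun g) x) <= fine (generated M (axis_fun h) x).
Proof.
move=> dx sx; apply: (hull_fine_lb ah dx) => t z y ht dz hy ex.
have [yab|yab] := boolP (y \in `]v1 a, v1 b[); last first.
  by rewrite -gh // -ex; exact: hull_fine_ub.
move: yab; rewrite in_itv /= => /andP[ya yb].
case: sx => sx.
- by apply: (@hull_cross a t z y x) => //; rewrite pmulr_llt0 // subr_gt0.
- by apply: (@hull_cross b t z y x) => //; rewrite pmulr_rlt0 // subr_lt0.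
Qed.

End agree.

(** * Gradient and semicontinuity of a spanned function *)

Section gradient.
Context {R : realType}.

(** A supporting slope on one side and nearby supporting slopes on the other
    determine the directional derivative. *)
Lemma sandwich_derive (f : R * R -> R) (x e : R * R) (l : R) :
  (forall eta : R, 0 < eta -> \forall h \near (0 : R)^',
     exists2 l' : R, `|l - l'| <= eta & l * h <= f (h *: e + x) - f x <= l' * h) ->
  'D_e f x = l.
Proof.
move=> H; apply: (@cvg_lim R) => //.
apply/cvgrPdist_le => eta eta0.
have := H eta eta0.
apply: filterS2; last exact: (nbhs_dnbhs_neq (0 : R)).
move=> h hn [l' hl /andP[h1 h2]].
set D := f (h *: e + x) - f x in h1 h2 *.
rewrite /GRing.scale /=.
have e1 : h^-1 * D * h = D by field.
have [hp|hp|h0] := ltgtP h 0; last by rewrite h0 eqxx in hn.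
- have k1 : h^-1 * D <= l by rewrite -(ler_nM2r hp) e1.
  have k2 : l' <= h^-1 * D by rewrite -(ler_nM2r hp) e1.
  apply: le_trans hl; rewrite !ger0_norm; lra.
- have k1 : l <= h^-1 * D by rewrite -(ler_pM2r hp) e1.
  have k2 : h^-1 * D <= l' by rewrite -(ler_pM2r hp) e1.
  apply: le_trans hl; rewrite !ler0_norm; lra.
Qed.

Lemma near_line (x e : R * R) (P : set (R * R)) :
  (\forall y \near x, P y) -> \forall h \near (0 : R)^', P (h *: e + x).
Proof.
move=> H; apply: cvg_within => /=.
have c : (fun h : R => h *: e + x) @ (0 : R) --> x.
  suff : (fun h : R => h *: e + x) @ (0 : R) --> 0 *: e + x by rewrite scale0r add0r.
  by apply: cvgD; [apply: (@cvgZr_tmp _ _ _ _ _ (fun h : R => h)); exact: cvg_id|exact: cvg_cst].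
exact: (c P H).
Qed.


Lemma fst_cont (x : R * R) : {for x, continuous (fst : R * R -> R)}.
Proof. exact: cvg_fst. Qed.

Lemma snd_cont (x : R * R) : {for x, continuous (snd : R * R -> R)}.
Proof. exact: cvg_snd. Qed.

Lemma sqnorm_cont (x : R * R) : {for x, continuous (fun x : R * R => x.1 ^+ 2 + x.2 ^+ 2)}.
Proof.
apply: cvgD; apply: cvgM; (exact: fst_cont || exact: snd_cont).
Qed.

Lemma side_cont_pt (v v1 : R -> R) c (x : R * R) : {for x, continuous (side v v1 c)}.
Proof.
apply: cvgB; apply: cvgM; (try exact: cvg_cst).
- by apply: cvgB; [exact: fst_cont|exact: cvg_cst].
- by apply: cvg_norm; exact: snd_cont.
Qed.

Lemma plane_cont_pt (v : R -> R) c (x : R * R) : {for x, continuous (plane v c)}.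
Proof.
apply: cvgB; last exact: cvg_cst.
apply: cvgD; apply: cvgM; (try exact: cvg_cst).
- exact: fst_cont.
- by apply: cvg_norm; exact: snd_cont.
Qed.

Lemma near_gt (f : R * R -> R) (x : R * R) (a : R) : {for x, continuous f} -> a < f x ->
  \forall y \near x, a < f y.
Proof. by move=> cf af; exact: (cvgr_gt _ cf). Qed.

Lemma near_lt (f : R * R -> R) (x : R * R) (a : R) : {for x, continuous f} -> f x < a ->
  \forall y \near x, f y < a.
Proof. by move=> cf af; exact: (cvgr_lt _ cf). Qed.

End gradient.

Section hull_gradient.
Context {R : realType}.
Variables (lo hi : R) (v v1 v2 : R -> R).
Hypothesis A : arc lo hi v v1 v2.
Variables (M : R) (g : R -> R).
Hypothesis adm : admissible M g.
Hypothesis ct : contact M lo hi g v v1.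
Let U := generated M (axis_fun g).
Local Notation Q := (fun c : R => c \in `]lo, hi[).

Lemma side_sign c d (x : R * R) : Q c -> Q d -> open_disk x -> side v v1 c x = 0 ->
  (side v v1 d x <= 0) = (c <= d).
Proof.
move=> Qc Qd ox sc; have [cd|dc] := leP c d.
- move: cd; rewrite le_eqVlt => /orP[/eqP <-|cd]; first by rewrite sc lexx.
  by rewrite (ltW (side_decr A Qc Qd cd ox _)) // sc.
- apply/negbTE/negP => h.
  by have := side_decr A Qd Qc dc ox h; rewrite sc ltxx.
Qed.

(** Rulings of slopes slightly smaller and slightly larger than c0 have x strictly
    on their two sides, and still do so for points near x. *)
Lemma near_ruling (c0 : R) (x : R * R) (P : set R) : Q c0 -> open_disk x -> side v v1 c0 x = 0 ->
  nbhs c0 P ->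
  \forall y \near x, open_disk y /\ exists2 c, Q c /\ P c & side v v1 c y = 0.
Proof.
move=> Qc ox sx nP.
have nQ : nbhs c0 [set c | Q c] by exact: near_in_itvoo.
have /nbhs_ballP[d /= d0 hd] : nbhs c0 (P `&` [set c | Q c]) by exact: filterI.
pose a := c0 - d / 2; pose b := c0 + d / 2.
have hab c : c \in `[a, b] -> Q c /\ P c.
  rewrite in_itv /= => /andP[h1 h2].
  have /hd[Pc Qc'] : ball c0 d c.
    by rewrite /ball /= ltr_norml; rewrite /a /b in h1 h2; apply/andP; split; lra.
  by split.
have Qa : Q a by apply: (proj1 (hab _ _)); rewrite in_itv /= /a /b; lra.
have Qb : Q b by apply: (proj1 (hab _ _)); rewrite in_itv /= /a /b; lra.
have sa : 0 < side v v1 a x.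
  by rewrite ltNge (side_sign Qc Qa ox sx) -ltNge /a; lra.
have sb : side v v1 b x < 0.
  by apply: (side_decr A Qc Qb) => //; rewrite ?sx // /b; lra.
near=> y; split; first by near: y; apply: near_lt => //; exact: sqnorm_cont.
have [c cab sc] : exists2 c, c \in `[a, b] & side v v1 c y = 0.
  apply: (side_zero A Qa Qb); first by rewrite /a /b; lra.
    by apply: ltW; near: y; apply: near_lt => //; exact: side_cont_pt.
  by apply: ltW; near: y; apply: near_gt => //; exact: side_cont_pt.
by exists c => //; exact: hab.
Unshelve. all: by end_near. Qed.

(** The plane of slope c0 supports the spanned function at x; at a nearby y the
    plane of the ruling through y does, and its slope is close to c0. *)
Lemma hull_grad (c0 : R) (x : R * R) : Q c0 -> open_disk x -> x.2 != 0 -> side v v1 c0 x = 0 ->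
  grad U x = (c0, Num.sg x.2 * ordinate v c0).
Proof.
move=> Qc ox x2 sx.
have bounds c (y : R * R) : Q c -> open_disk y -> side v v1 c y = 0 ->
    plane v c0 y - plane v c0 x <= fine (U y) - fine (U x) <= plane v c y - plane v c x.
  move=> Qc' oy sy.
  have dx := open_disk_sub ox; have dy := open_disk_sub oy.
  have h1 := plane_eq_hull A adm ct Qc dx sx.
  have h2 := plane_eq_hull A adm ct Qc' dy sy.
  have h3 := plane_le_hull A adm ct Qc dy.
  have h4 := plane_le_hull A adm ct Qc' dx.
  apply/andP; split; rewrite -/U in h1 h2 h3 h4; lra.
rewrite /grad; congr pair; apply: sandwich_derive => eta eta0.
- have nP : nbhs c0 [set c | `|c0 - c| <= eta].
    apply: filterS (nbhsx_ballx c0 eta eta0) => c; exact: ltW.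
  have := near_line ((1, 0) : R * R) (near_ruling Qc ox sx nP).
  apply: filterS => h [oy [c [Qc' Pc] sy]]; exists c => //.
  have := bounds c _ Qc' oy sy; rewrite /plane /= scaler0 add0r.
  have -> : h *: (1 : R) = h by rewrite /GRing.scale /= mulr1.
  move=> /andP[h1 h2]; apply/andP; split; rewrite /=; lra.
- set s := Num.sg x.2.
  have nP : nbhs c0 [set c | `|ordinate v c0 - ordinate v c| <= eta].
    by have /cvgrPdist_le := ordinate_cont A Qc; exact.
  have nS : \forall y \near x, 0 < s * y.2.
    apply: (@near_gt R (fun y : R * R => s * y.2)).
      by apply: cvgM; [exact: cvg_cst|exact: snd_cont].
    by rewrite /s -normrEsg normr_gt0.
  have nR := near_ruling Qc ox sx nP.
  have nSR : \forall y \near x, 0 < s * y.2 /\ open_disk y /\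
      exists2 c, Q c /\ `|ordinate v c0 - ordinate v c| <= eta & side v v1 c y = 0.
    by move: nS nR; apply: filterS2 => y.
  have := near_line ((0, 1) : R * R) nSR.
  apply: filterS => h [hs [oy [c [Qc' Pc] sy]]]; exists (s * ordinate v c).
    rewrite -mulrBr normrM /s normr_sg x2 mul1r; exact: Pc.
  have := bounds c _ Qc' oy sy; rewrite /plane /= scaler0 add0r.
  have -> : h *: (1 : R) = h by rewrite /GRing.scale /= mulr1.
  have -> : `|h + x.2| = s * (h + x.2).
    move: hs; rewrite /= /GRing.scale /= mulr1 => hs.
    have s1 : `|s| = 1 by rewrite /s normr_sg x2.
    by rewrite -(ger0_norm (ltW hs)) normrM s1 mul1r.
  rewrite (normrEsg x.2) -/s.
  move=> /andP[h1 h2]; apply/andP; split; rewrite /=; lra.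
Qed.

End hull_gradient.

Section lsc.
Context {R : realType}.
Variables (lo hi : R) (v v1 v2 w w1 w2 : R -> R).
Hypotheses (A : arc lo hi v v1 v2) (A' : arc lo hi w w1 w2).
Variables (M : R) (g h : R -> R).
Hypotheses (ag : admissible M g) (ah : admissible M h).
Hypotheses (cg : contact M lo hi g v v1) (ch : contact M lo hi h w w1).
Local Notation Q := (fun c : R => c \in `]lo, hi[).
Variables (a b : R).
Hypotheses (Qa : Q a) (Qb : Q b) (ab : a < b).
Hypotheses (va : v a = w a) (v1a : v1 a = w1 a) (vb : v b = w b) (v1b : v1 b = w1 b).
Hypothesis gh : forall y, y \in `[-1, 1] -> y \notin `]v1 a, v1 b[ -> g y = h y.
Let U := generated M (axis_fun g).
Let W := generated M (axis_fun h).

(** The complement of the closed region swept by the rulings of slopes a to b. *)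
Definition off_arc (v v1 : R -> R) (a b : R) : set (R * R) :=
  [set x | [\/ ~ disk x, side v v1 a x < 0 | 0 < side v v1 b x]].

Lemma off_arc_open x : off_arc v v1 a b x -> \forall y \near x, off_arc v v1 a b y.
Proof.
move=> [dx|sx|sx].
- have := near_gt (@sqnorm_cont R x) (_ : 1 < _); rewrite ltNge => /(_ (introN idP dx)).
  by apply: filterS => y hy; apply: Or31; apply/negP; rewrite -ltNge.
- have := near_lt (@side_cont_pt R v v1 a x) sx.
  by apply: filterS => y hy; apply: Or32.
- have := near_gt (@side_cont_pt R v v1 b x) sx.
  by apply: filterS => y hy; apply: Or33.
Qed.

Lemma sideE_a x : side v v1 a x = side w w1 a x.
Proof. by rewrite /side /ordinate va v1a. Qed.

Lemma sideE_b x : side v v1 b x = side w w1 b x.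
Proof. by rewrite /side /ordinate vb v1b. Qed.

Lemma hull_agree x : off_arc v v1 a b x -> U x = W x.
Proof.
have [dx|dx _] := pselect (disk x); last by rewrite /U /W !(hull_offdisk _ dx).
case=> // sx; rewrite /U /W -(hull_fineK ag dx) -(hull_fineK ah dx); congr EFin;
  apply/eqP; rewrite eq_le; apply/andP; split.
- by apply: (hull_le_off A A' ag ah cg ch Qa Qb) => //; left.
- apply: (hull_le_off A' A ah ag ch cg Qa Qb) => //; last by left; rewrite -sideE_a.
  by move=> y hy hy'; rewrite gh // v1a v1b.
- by apply: (hull_le_off A A' ag ah cg ch Qa Qb) => //; right.
- apply: (hull_le_off A' A ah ag ch cg Qa Qb) => //; last by right; rewrite -sideE_b.
  by move=> y hy hy'; rewrite gh // v1a v1b.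
Qed.

Lemma hull_grad_agree x : off_arc v v1 a b x -> grad U x = grad W x.
Proof.
move=> ox; have H : {near x, fine \o U =1 fine \o W}.
  apply: filterS (off_arc_open ox) => y oy /=; by rewrite hull_agree.
by rewrite /grad; congr pair; exact: near_eq_derive.
Qed.

(** Off the swept region the function is the old one.  On that region it
    coincides at x with a continuous minorant, the plane of the ruling through
    x. *)
Lemma hull_lsc : lower_semicontinuous U -> lower_semicontinuous W.
Proof.
move=> lscU x m mx.
have [ox|nox] := pselect (off_arc v v1 a b x).
  rewrite -hull_agree // in mx.
  have [V nV hV] := lscU x m mx.
  exists (V `&` off_arc v v1 a b); first exact: filterI nV (off_arc_open ox).
  by move=> y [Vy oy]; rewrite -hull_agree //; exact: hV.
have dx : disk x by apply: contrapT => dx; apply: nox; apply: Or31.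
have sa : 0 <= side w w1 a x.
  by rewrite -sideE_a leNgt; apply/negP => h'; apply: nox; apply: Or32.
have sb : side w w1 b x <= 0.
  by rewrite -sideE_b leNgt; apply/negP => h'; apply: nox; apply: Or33.
have [c cab sc] := side_zero A' Qa Qb (ltW ab) sb sa.
have Qc : Q c by exact: (arc_sub Qa Qb).
have Wx : W x = (plane w c x + M)%:E.
  by rewrite -(plane_eq_hull A' ah ch Qc dx sc) hull_fineK.
rewrite Wx lte_fin in mx.
exists [set y | m < plane w c y + M].
  apply: near_gt => //; apply: cvgD; [exact: plane_cont_pt|exact: cvg_cst].
move=> y /= hy; have [dy|dy] := pselect (disk y); last first.
  by rewrite /W (hull_offdisk _ dy) ?ltry.
rewrite /W -hull_fineK // lte_fin; apply: lt_le_trans hy _.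
exact (plane_le_hull A' ah ch Qc dy).
Qed.

End lsc.

(** * The area cut off from the disk by a ruling *)

Section area.
Context {R : realType}.
Local Notation mu := (@lebesgue_measure R).
Local Notation mu2 := (mu \x mu)%E.

Lemma measurable_le0 (f : R * R -> R) : measurable_fun setT f -> measurable [set x | f x <= 0].
Proof.
move=> mf; rewrite -[X in measurable X]setTI.
have -> : [set x | f x <= 0] = f @^-1` `]-oo, 0].
  by apply/seteqP; split => x /=; rewrite in_itv.
exact: mf.
Qed.

Lemma measurable_lt0 (f : R * R -> R) : measurable_fun setT f -> measurable [set x | f x < 0].
Proof.
move=> mf; rewrite -[X in measurable X]setTI.
have -> : [set x | f x < 0] = f @^-1` `]-oo, 0[.
  by apply/seteqP; split => x /=; rewrite in_itv.
exact: mf.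
Qed.

Lemma measurable_coord1 : measurable_fun setT (fst : R * R -> R). Proof. exact: measurable_fst. Qed.
Lemma measurable_coord2 : measurable_fun setT (snd : R * R -> R). Proof. exact: measurable_snd. Qed.
Lemma measurable_abs_coord2 : measurable_fun setT (fun x : R * R => `|x.2|).
Proof. by apply: measurableT_comp => //; exact: measurable_coord2. Qed.
Lemma measurable_side_form (a b c : R) : measurable_fun setT (fun x : R * R => a * (x.1 - b) - `|x.2| * c).
Proof.
apply: measurable_funB; apply: measurable_funM => //; last exact: measurable_abs_coord2.
by apply: measurable_funB => //; exact: measurable_coord1.
Qed.
Lemma measurable_sqnorm : measurable_fun setT (fun x : R * R => x.1 ^+ 2 + x.2 ^+ 2 - 1).
Proof.
apply: measurable_funB => //; apply: measurable_funD; apply: measurable_funX.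
  exact: measurable_coord1.
exact: measurable_coord2.
Qed.

Lemma measurable_disk : measurable (disk : set (R * R)).
Proof.
have -> : disk = [set x : R * R | x.1 ^+ 2 + x.2 ^+ 2 - 1 <= 0].
  by apply/seteqP; split => x; rewrite /disk /= subr_le0.
by apply: measurable_le0; exact: measurable_sqnorm.
Qed.

Lemma measurable_open_disk : measurable (open_disk : set (R * R)).
Proof.
have -> : open_disk = [set x : R * R | x.1 ^+ 2 + x.2 ^+ 2 - 1 < 0].
  by apply/seteqP; split => x; rewrite /open_disk /= subr_lt0.
by apply: measurable_lt0; exact: measurable_sqnorm.
Qed.

Lemma mu2_ge0 (A : set (R * R)) : (0 <= mu2 A)%E.
Proof. exact: (measure_ge0 (product_measure1 mu mu)). Qed.

Lemma mu2U (A B : set (R * R)) : measurable A -> measurable B -> A `&` B = set0 ->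
  mu2 (A `|` B) = (mu2 A + mu2 B)%E.
Proof. by move=> mA mB AB; apply: (measureU (product_measure1 mu mu)). Qed.

(** Cavalieri's principle. *)
Lemma area_sections (I : set R) (f : R -> R) (E : set (R * R)) :
  (forall x, I x -> mu (xsection E x) = (f x)%:E) ->
  (forall x, ~ I x -> xsection E x = set0) ->
  mu2 E = (\int[mu]_(x in I) (f x)%:E)%E.
Proof.
move=> h1 h2; rewrite /product_measure1 /= [RHS]integral_mkcond; apply: eq_integral => x _ /=.
rewrite patchE; case: ifPn => xI; first by rewrite h1 //; exact: set_mem.
by rewrite h2 ?measure0 // => /mem_set; exact/negP.
Qed.

Lemma lebesgue_cc (h : R) : 0 <= h -> mu `[- h, h] = (2 * h)%:E.
Proof.
move=> h0; rewrite lebesgue_measure_itv /= lte_fin; case: ltP => hh.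
  by rewrite -EFinD opprK; congr EFin; ring.
by congr EFin; lra.
Qed.

Lemma lebesgue_oo (h : R) : 0 <= h -> mu `]- h, h[ = (2 * h)%:E.
Proof.
move=> h0; rewrite lebesgue_measure_itv /= lte_fin; case: ltP => hh.
  by rewrite -EFinD opprK; congr EFin; ring.
by congr EFin; lra.
Qed.

Definition cap_area (k : R) : R := (\int[mu]_(t in `[-1, k]) (2 * Num.sqrt (1 - t ^+ 2)))%R.

Lemma sqrt_circle_cont : continuous (fun t : R => 2 * Num.sqrt (1 - t ^+ 2)).
Proof.
move=> t; apply: cvgM; first exact: cvg_cst.
apply: (@continuous_comp _ _ _ (fun t : R => 1 - t ^+ 2) Num.sqrt); last exact: sqrt_continuous.
by apply: cvgB; [exact: cvg_cst|apply: cvgM; exact: cvg_id].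
Qed.

Lemma circle_integrable (a b : R) : mu.-integrable `[a, b] (EFin \o (fun t : R => 2 * Num.sqrt (1 - t ^+ 2))).
Proof.
apply: continuous_compact_integrable; first exact: segment_compact.
by apply: continuous_subspaceT; exact: sqrt_circle_cont.
Qed.

Lemma is_derive_cap_area (k : R) : -1 < k < 1 -> is_derive k 1 cap_area (2 * Num.sqrt (1 - k ^+ 2)).
Proof.
move=> /andP[k1 k2].
have [h1 h2] := @continuous_FTC1_closed R _ (-1) k 1 k2 (circle_integrable _ _) k1 (sqrt_circle_cont (x := k)).
by apply: DeriveDef; [exact: h1|rewrite -derive1E h2].
Qed.

Definition cap (k : R) : set (R * R) := [set x | disk x /\ x.1 <= k].

Lemma measurable_cap k : measurable (cap k).
Proof.
have -> : cap k = disk `&` [set x | x.1 - k <= 0].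
  by apply/seteqP; split => x /=; rewrite /cap /= subr_le0.
apply: measurableI; first exact: measurable_disk.
by apply: measurable_le0; apply: measurable_funB => //; exact: measurable_coord1.
Qed.

Lemma sqr_le_abs (a b : R) : 0 <= b -> (a ^+ 2 <= b ^+ 2) = (`|a| <= b).
Proof.
by move=> b0; rewrite -(real_normK (num_real a)) ler_sqr ?nnegrE.
Qed.

Lemma capE (k : R) : -1 < k < 1 -> mu2 (cap k) = (cap_area k)%:E.
Proof.
move=> /andP[k1 k2].
rewrite (@area_sections `[-1, k] (fun t => 2 * Num.sqrt (1 - t ^+ 2))).
- rewrite /cap_area /Rintegral fineK //.
  exact: (integrable_fin_num _ (circle_integrable _ _)).
- move=> x; rewrite /= in_itv /= => /andP[x1 x2].
  rewrite -lebesgue_cc ?sqrtr_ge0 //; congr (mu _); apply/seteqP; split => y /=.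
    rewrite /xsection /= inE /cap /disk /= => -[h _].
    rewrite in_itv /= -ler_norml -sqr_le_abs ?sqrtr_ge0 // sqr_sqrtr; first lra.
    by have := sqr_ge0 y; lra.
  rewrite in_itv /= -ler_norml -sqr_le_abs ?sqrtr_ge0 // sqr_sqrtr; last by rewrite expr2; nra.
  by move=> h; rewrite /xsection /= inE /cap /disk /=; split => //; lra.
- move=> x hx; apply/seteqP; split => // y; rewrite /xsection /= inE /cap /disk /= => -[h1 h2].
  apply: hx; rewrite /= in_itv /= h2 andbT.
  by have := sqr_ge0 y; rewrite leNgt; move=> y0; apply/negP => x1; nra.
Qed.

Lemma integral_affine (m x0 l r : R) : l < r ->
  (\int[mu]_(x in `[l, r]) (2 * (m * (x - x0)))%:E = (m * (r - x0) ^+ 2 - m * (l - x0) ^+ 2)%:E)%E.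
Proof.
move=> lr.
have d (x : R) : is_derive x 1 (fun x : R => m * (x - x0) ^+ 2) (2 * (m * (x - x0))).
  have -> : (fun x : R => m * (x - x0) ^+ 2) = m \*: (fun x : R => x - x0) ^+ 2 by apply/funext.
  by apply: is_derive_eq; rewrite /GRing.scale /=; ring.
have c : continuous (fun x : R => m * (x - x0) ^+ 2).
  by move=> x; exact: derive_continuous (d x).
rewrite (@continuous_FTC2 R (fun x => 2 * (m * (x - x0))) (fun x => m * (x - x0) ^+ 2)) //.
- apply: continuous_subspaceT => x; apply: cvgM; first exact: cvg_cst.
  apply: cvgM; first exact: cvg_cst.
  by apply: cvgB; [exact: cvg_id|exact: cvg_cst].
- split => [x _||]; first by case: (d x).
    by apply: cvg_at_right_filter; exact: c.
  by apply: cvg_at_left_filter; exact: c.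
- by move=> x _; rewrite derive1E derive_val.
Qed.

Section half_plane.
Variables (k s B : R).
Hypotheses (s0 : 0 < s) (ks : k ^+ 2 + s ^+ 2 = 1) (hB : -1 < B < 1).

Let hk : -1 < k < 1.
Proof. by apply/andP; split; have := s0; have := ks; nra. Qed.

(** The line through (B, 0) and (k, s) leaves the unit disk at t = 1. *)
Lemma ray_norm (t : R) : (B + t * (k - B)) ^+ 2 + (s * t) ^+ 2 - 1 =
  (t - 1) * (t * ((k - B) ^+ 2 + s ^+ 2) + (1 - B ^+ 2)).
Proof.
have -> : s ^+ 2 = 1 - k ^+ 2 by rewrite -ks addrC addKr.
rewrite exprMn; have -> : s ^+ 2 = 1 - k ^+ 2 by rewrite -ks addrC addKr.
by ring.
Qed.

Let pos (t : R) : 0 <= t -> 0 < t * ((k - B) ^+ 2 + s ^+ 2) + (1 - B ^+ 2).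
Proof.
move=> t0.
have h1 : 0 <= t * ((k - B) ^+ 2 + s ^+ 2) by rewrite mulr_ge0 ?addr_ge0 ?sqr_ge0.
have h2 : 0 < 1 - B ^+ 2 by case/andP: hB => b1 b2; rewrite expr2; nra.
exact: ltr_wpDl h1 h2.
Qed.

Lemma ray_in (t y : R) : 0 <= t <= 1 -> `|y| <= s * t -> (B + t * (k - B)) ^+ 2 + y ^+ 2 <= 1.
Proof.
move=> /andP[t0 t1] hy.
have hy2 : y ^+ 2 <= (s * t) ^+ 2 by rewrite sqr_le_abs // mulr_ge0 // ltW.
have := ray_norm t.
have : (t - 1) * (t * ((k - B) ^+ 2 + s ^+ 2) + (1 - B ^+ 2)) <= 0.
  by rewrite pmulr_lle0 ?subr_le0 // pos.
lra.
Qed.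

Lemma ray_out (t y : R) : 1 < t -> s * t <= `|y| -> 1 < (B + t * (k - B)) ^+ 2 + y ^+ 2.
Proof.
move=> t1 hy; have t0 : 0 < t by lra.
have hy2 : (s * t) ^+ 2 <= y ^+ 2.
  by rewrite -(real_normK (num_real y)) ler_sqr ?nnegrE // mulr_ge0 // ltW.
have := ray_norm t.
have : 0 < (t - 1) * (t * ((k - B) ^+ 2 + s ^+ 2) + (1 - B ^+ 2)).
  by rewrite mulr_gt0 ?subr_gt0 // pos // ltW.
lra.
Qed.

Lemma ray_out' (t y : R) : 1 <= t -> s * t < `|y| -> 1 < (B + t * (k - B)) ^+ 2 + y ^+ 2.
Proof.
move=> t1 hy; have t0 : 0 < t by lra.
have hy2 : (s * t) ^+ 2 < y ^+ 2.
  by rewrite -(real_normK (num_real y)) ltr_sqr ?nnegrE // mulr_ge0 // ltW.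
have := ray_norm t.
have : 0 <= (t - 1) * (t * ((k - B) ^+ 2 + s ^+ 2) + (1 - B ^+ 2)).
  by rewrite mulr_ge0 ?subr_ge0 // ltW // pos // ltW.
lra.
Qed.

Definition left_of : set (R * R) := [set x | disk x /\ s * (x.1 - B) - `|x.2| * (k - B) <= 0].

Lemma measurable_left_of : measurable left_of.
Proof.
have -> : left_of = disk `&` [set x | s * (x.1 - B) - `|x.2| * (k - B) <= 0] by [].
apply: measurableI; first exact: measurable_disk.
by apply: measurable_le0; exact: measurable_side_form.
Qed.

(** The part of the disk to the left of the ray differs from the cap x1 <= k by
    a triangle (and its mirror image), removed if B < k and added if k < B.
    The signed area s (B - k) covers both cases. *)
Lemma left_of_area : mu2 left_of = (cap_area k + s * (B - k))%:E.
Proof.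
have [Bk|cont_sub|eBk] := ltgtP B k.
- pose T := [set x : R * R | (B <= x.1 <= k) /\ `|x.2| * (k - B) < s * (x.1 - B)].
  have d0 : 0 < k - B by rewrite subr_gt0.
  have mT : measurable T.
    have -> : T = ([set x : R * R | B - x.1 <= 0] `&` [set x | x.1 - k <= 0]) `&`
        [set x : R * R | (- s) * (x.1 - B) - `|x.2| * (- (k - B)) < 0].
      apply/seteqP; split => x; rewrite /T /=.
        by move=> [/andP[h1 h2] h3]; split; [split|]; lra.
      by move=> [[h1 h2] h3]; split; [apply/andP; split|]; lra.
    apply: measurableI; last by apply: measurable_lt0; exact: measurable_side_form.
    by apply: measurableI; apply: measurable_le0; apply: measurable_funB => //; exact: measurable_coord1.
  have muT : mu2 T = (s * (k - B))%:E.
    rewrite (@area_sections `[B, k] (fun x => 2 * (s / (k - B) * (x - B)))).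
    + rewrite integral_affine // subrr expr0n mulr0 subr0; congr EFin; field; lra.
    + move=> x; rewrite /= in_itv /= => /andP[x1 x2].
      rewrite -lebesgue_oo; last by rewrite mulr_ge0 ?divr_ge0 ?subr_ge0 // ltW.
      congr (mu _); apply/seteqP; split => y /=; rewrite /xsection /= inE /T /= in_itv /= -ltr_norml.
        by move=> [_ h]; rewrite mulrAC ltr_pdivlMr.
      by rewrite mulrAC ltr_pdivlMr // => h; split => //; rewrite x1.
    + move=> x hx; apply/seteqP; split => // y; rewrite /xsection /= inE /T /= => -[h1 h2].
      by apply: hx; rewrite /= in_itv.
  have e : cap k = left_of `|` T.
    apply/seteqP; split => x.
      move=> [dx xk]; have [h|h] := leP (s * (x.1 - B) - `|x.2| * (k - B)) 0; [by left|right].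
      split; last by lra.
      rewrite xk andbT leNgt; apply/negP => xB.
      have h1 : 0 <= `|x.2| * (k - B) by rewrite mulr_ge0 // ltW.
      have h2 : s * (x.1 - B) < 0 by rewrite pmulr_rlt0 // subr_lt0.
      by lra.
    move=> [[dx h]|[/andP[x1 x2] h]]; split => //; last first.
      pose t := (x.1 - B) / (k - B).
      have et : B + t * (k - B) = x.1 by rewrite /t; field; lra.
      rewrite /disk /= -et; apply: ray_in; last first.
        by rewrite /t mulrA ler_pdivlMr // ltW.
      by rewrite /t divr_ge0 ?ler_pdivrMr ?mul1r /=; lra.
    rewrite leNgt; apply/negP => xk.
    pose t := (x.1 - B) / (k - B).
    have et : B + t * (k - B) = x.1 by rewrite /t; field; lra.
    have : 1 < (B + t * (k - B)) ^+ 2 + x.2 ^+ 2.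
      apply: ray_out; first by rewrite /t ltr_pdivlMr; lra.
      by rewrite /t mulrA ler_pdivrMr; lra.
    by rewrite et ltNge => /negP; apply.
  have := capE hk; rewrite e mu2U //; first last.
  + apply/seteqP; split => // x [[_ h1] [_ h2]]; lra.
  + exact: measurable_left_of.
  have -> : cap_area k + s * (B - k) = cap_area k - s * (k - B) by ring.
  move=> H; have : mu2 left_of \is a fin_num.
    rewrite ge0_fin_numE ?mu2_ge0 //; apply: le_lt_trans (ltry (cap_area k)).
    by rewrite -H leeDl ?mu2_ge0.
  move: H; rewrite muT => H f; move: H; rewrite -(fineK f) -EFinD => -[<-].
  by rewrite addrK.
- pose T := [set x : R * R | (k < x.1 <= B) /\ `|x.2| * (B - k) <= s * (B - x.1)].
  have d0 : 0 < B - k by rewrite subr_gt0.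
  have mT : measurable T.
    have -> : T = ([set x : R * R | k - x.1 < 0] `&` [set x | x.1 - B <= 0]) `&`
        [set x : R * R | s * (x.1 - B) - `|x.2| * (k - B) <= 0].
      apply/seteqP; split => x; rewrite /T /=.
        by move=> [/andP[h1 h2] h3]; split; [split|]; lra.
      by move=> [[h1 h2] h3]; split; [apply/andP; split|]; lra.
    apply: measurableI; last by apply: measurable_le0; exact: measurable_side_form.
    by apply: measurableI; [apply: measurable_lt0|apply: measurable_le0];
       apply: measurable_funB => //; exact: measurable_coord1.
  have muT : mu2 T = (s * (B - k))%:E.
    rewrite (@area_sections `]k, B] (fun x => 2 * (- (s / (B - k)) * (x - B)))).
    + rewrite integral_itv_obnd_cbnd; last first.
        apply/measurable_EFinP; apply: measurable_funM => //; apply: measurable_funM => //.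
        by apply: measurable_funB.
      rewrite integral_affine // subrr expr0n mulr0 sub0r; congr EFin; field; lra.
    + move=> x; rewrite /= in_itv /= => /andP[x1 x2].
      have -> : - (s / (B - k)) * (x - B) = s * (B - x) / (B - k) by field; lra.
      rewrite -lebesgue_cc; last by rewrite divr_ge0 ?mulr_ge0 ?subr_ge0 // ltW.
      congr (mu _); apply/seteqP; split => y /=; rewrite /xsection /= inE /T /= in_itv /= -ler_norml.
        by move=> [_ h]; rewrite ler_pdivlMr.
      by rewrite ler_pdivlMr // => h; split => //; rewrite x1.
    + move=> x hx; apply/seteqP; split => // y; rewrite /xsection /= inE /T /= => -[h1 h2].
      by apply: hx; rewrite /= in_itv.
  have e : left_of = cap k `|` T.
    apply/seteqP; split => x.
      move=> [dx h]; have [xk|xk] := leP x.1 k; [by left|right].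
      split; last by lra.
      rewrite xk /= leNgt; apply/negP => xB.
      have h1 : 0 <= `|x.2| * (B - k) by rewrite mulr_ge0 // ltW.
      have h2 : 0 < s * (x.1 - B) by rewrite pmulr_rgt0 // subr_gt0.
      by lra.
    pose t := (B - x.1) / (B - k).
    have et : B + t * (k - B) = x.1 by rewrite /t; field; lra.
    move=> [[dx xk]|[/andP[x1 x2] h]]; split => //; last 2 first.
    + rewrite /disk /= -et; apply: ray_in; last first.
        by rewrite /t mulrA ler_pdivlMr.
      by rewrite /t divr_ge0 ?ler_pdivrMr ?mul1r /=; lra.
    + lra.
    rewrite leNgt; apply/negP => h.
    have : 1 < (B + t * (k - B)) ^+ 2 + x.2 ^+ 2.
      apply: ray_out'; first by rewrite /t ler_pdivlMr; lra.
      by rewrite /t mulrA ltr_pdivrMr; lra.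
    by rewrite et ltNge => /negP; apply.
  rewrite e mu2U //; first by rewrite muT capE.
  + exact: measurable_cap.
  + by apply/seteqP; split => // x [[_ h1] [/andP[h2 _] _]]; lra.
- rewrite eBk subrr mulr0 addr0 -(capE hk); congr (mu2 _).
  apply/seteqP; split => x [dx h]; split => //.
    by move: h; rewrite eBk subrr mulr0 subr0 pmulr_rle0 // subr_le0.
  by rewrite eBk subrr mulr0 subr0 pmulr_rle0 // subr_le0.
Qed.

End half_plane.
End area.

(** * Localizing an inequality between integrals *)

Import HBNNSimple.

Section le_integral_local.
Local Open Scope ereal_scope.
Context d (T : measurableType d) (R : realType) (mu : {measure set T -> \bar R}).

(** The integral of a nonnegative function is a supremum over the simple
    functions below it, so it is monotone without any measurability.  This is
    needed because the integrand of J is only known to be measurable where u is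
    ruled smoothly. *)
Lemma le_integral_nomeas (X : set T) (f g : T -> \bar R) :
  (forall x, X x -> 0 <= f x) -> (forall x, X x -> f x <= g x) ->
  \int[mu]_(x in X) f x <= \int[mu]_(x in X) g x.
Proof.
move=> f0 fg; have g0 x : X x -> 0 <= g x by move=> Xx; rewrite (le_trans (f0 x Xx)) // fg.
rewrite (ge0_integralE mu f0) (ge0_integralE mu g0); apply: le_ereal_sup => _ [h /= hf <-].
exists h => // x; apply: le_trans (hf x) _.
by rewrite !patchE; case: ifPn => // /set_mem; exact: fg.
Qed.

(** If f and g agree off D, an inequality between their integrals over X passes
    to D, even when they are measurable on D only: every simple function below
    g can be replaced on D by f, and this gives a lower bound for the integral
    of f. *)
Lemma le_integral_local (X D N : set T) (f g : T -> R) :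
  measurable X -> measurable D -> measurable N -> mu X < +oo -> D `<=` X -> mu N = 0 ->
  (forall x, 0 <= f x <= 1)%R -> (forall x, 0 <= g x <= 1)%R ->
  measurable_fun D f -> measurable_fun D g ->
  (forall x, X x -> ~ D x -> ~ N x -> f x = g x) ->
  \int[mu]_(x in X) (f x)%:E <= \int[mu]_(x in X) (g x)%:E ->
  \int[mu]_(x in D) (f x)%:E <= \int[mu]_(x in D) (g x)%:E.
Proof.
move=> mX mD mN Xfin DX N0 f01 g01 mf mg fg le_fg.
have f0 x : 0 <= (f x)%:E by rewrite lee_fin; case/andP: (f01 x).
have g0 x : 0 <= (g x)%:E by rewrite lee_fin; case/andP: (g01 x).
have fin01 (p : T -> R) (Y : set T) : (forall x, 0 <= p x <= 1)%R -> measurable Y -> Y `<=` X ->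
    \int[mu]_(x in Y) (p x)%:E \is a fin_num.
  move=> p01 mY YX; rewrite ge0_fin_numE; last first.
    by apply: integral_ge0 => x _; rewrite lee_fin; case/andP: (p01 x).
  apply: (@le_lt_trans _ _ (\int[mu]_(x in Y) (cst 1 x))).
    by apply: le_integral_nomeas => x _; rewrite lee_fin; case/andP: (p01 x).
  rewrite integral_cst // mul1e; apply: le_lt_trans Xfin.
  by apply: le_measure => //; rewrite inE.
set Y := X `\` (D `|` N).
have mY : measurable Y by apply: measurableD => //; exact: measurableU.
have fX := fin01 f X f01 mX (@subset_refl _ X).
have gX := fin01 g X g01 mX (@subset_refl _ X).
have fD := fin01 f D f01 mD DX; have gD := fin01 g D g01 mD DX.
suff H : \int[mu]_(x in X) (g x)%:E <=
    \int[mu]_(x in D) (g x)%:E + (\int[mu]_(x in X) (f x)%:E - \int[mu]_(x in D) (f x)%:E).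
  move: H le_fg; rewrite -(fineK fX) -(fineK gX) -(fineK fD) -(fineK gD).
  by rewrite -EFinB -EFinD !lee_fin; lra.
rewrite (ge0_integralE mu (fun x _ => g0 x)); apply: ge_ereal_sup => _ [h /= hg <-].
have hX x : ~ X x -> h x = 0%R.
  move=> Xx; apply/eqP; rewrite eq_le fun_ge0 andbT -lee_fin; apply: le_trans (hg x) _.
  by rewrite patchE memNset.
have hle x : (h x <= g x)%R.
  rewrite -lee_fin; apply: le_trans (hg x) _; rewrite patchE; case: ifP => // _.
have mh : measurable_fun setT (EFin \o h) by exact/measurable_EFinP.
have h0 x : 0 <= (EFin \o h) x by rewrite /= lee_fin fun_ge0.
have hD : \int[mu]_(x in D) (h x)%:E <= \int[mu]_(x in D) (g x)%:E.
  by apply: le_integral_nomeas => x _; rewrite lee_fin.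
have YD0 : [disjoint Y & D].
  by rewrite disj_set2E; apply/eqP/seteqP; split => // x [[_ nDN] Dx]; apply: nDN; left.
have hE : sintegral mu h <= \int[mu]_(x in D) (h x)%:E + \int[mu]_(x in Y) (h x)%:E.
  rewrite -integralT_nnsfun.
  rewrite (@ge0_negligible_integral _ _ _ mu setT N) //.
  rewrite setTD addeC -ge0_integral_setU //.
  - rewrite (integral_mkcond (~` N)) (integral_mkcond (Y `|` D)).
    apply: le_integral_nomeas => x _; first by apply: erestrict_ge0 => y _; exact: h0.
    rewrite !patchE /=; case: ifPn => hN; last by case: ifP => _ //; exact: h0.
    case: ifPn => hYD //; rewrite hX //= => Xx.
    move/negP: hYD; apply; rewrite inE.
    have [Dx|nDx] := pselect (D x); [by right|left].
    by split=> // -[//|Nx]; move: hN; rewrite inE; exact.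
  - exact: measurable_funTS.
  - by move=> x _; exact: h0.
  by move=> x _; exact: h0.
apply: le_trans hE _; apply: leeD => //.
rewrite leeBrDr // addeC.
(* h off D, f on D: a measurable minorant of f *)
pose k x := if x \in D then (f x)%:E else ((EFin \o h) \_ Y) x.
have mk : measurable_fun (Y `|` D) k.
  apply/measurable_funU => //; split.
    apply: (eq_measurable_fun (EFin \o h)); last exact: measurable_funTS.
    move=> x xY; rewrite /k patchE xY; case: ifPn => // xD.
    by exfalso; move: xY xD; rewrite !inE => -[_ nDN] Dx; apply: nDN; left.
  apply: (eq_measurable_fun (EFin \o f)); last exact/measurable_EFinP.
  by move=> x xD; rewrite /k xD.
have k0 x : 0 <= k x.
  by rewrite /k; case: ifP => // _; apply: erestrict_ge0 => y _; exact: h0.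
apply: (@le_trans _ _ (\int[mu]_(x in Y `|` D) k x)).
  rewrite ge0_integral_setU // addeC; apply: leeD.
    rewrite le_eqVlt; apply/orP; left; apply/eqP; apply: eq_integral => x xY.
    rewrite /k patchE xY; case: ifPn => // xD.
    by exfalso; move: xY xD; rewrite !inE => -[_ nDN] Dx; apply: nDN; left.
  rewrite le_eqVlt; apply/orP; left; apply/eqP; apply: eq_integral => x xD.
  by rewrite /k xD.
rewrite (integral_mkcond (Y `|` D)) (integral_mkcond X).
apply: le_integral_nomeas => x _; first by apply: erestrict_ge0 => y _; exact: k0.
rewrite !patchE; case: ifPn => xYD; last by case: ifP.
have Xx : X x by move: xYD; rewrite inE => -[[]//|/DX].
rewrite mem_set // /k; case: ifPn => // xD.
have Yx : Y x by move: xYD xD; rewrite !inE => -[//|Dx /negP]; rewrite inE.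
rewrite patchE mem_set //= lee_fin.
have [_ nDN] := Yx; rewrite fg //.
  by move=> Dx; apply: nDN; left.
by move=> Nx; apply: nDN; right.
Qed.

End le_integral_local.

(** * The resistance of a strip between two rulings *)

Section slit.
Context {R : realType}.
Local Notation mu := (@lebesgue_measure R).
Local Notation mu2 := (mu \x mu)%E.

(** Off the axis and inside the circle the gradient on a ruling is computed by
    [hull_grad]; the rest of the disk is negligible. *)
Definition slit_disk : set (R * R) := [set x | open_disk x /\ x.2 != 0].

Lemma measurable_slit_disk : measurable slit_disk.
Proof.
have -> : slit_disk = open_disk `&` ([set x | x.2 < 0] `|` [set x : R * R | - x.2 < 0]).
  by apply/seteqP; split => x; rewrite /slit_disk /= oppr_lt0 neq_lt => -[h1 /orP].
apply: measurableI; first exact: measurable_open_disk.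
apply: measurableU; apply: measurable_lt0; first exact: measurable_coord2.
by apply: measurableT_comp => //; exact: measurable_coord2.
Qed.

(** Each vertical line meets the circle and the axis in at most three points. *)
Lemma slit_null : mu2 (disk `\` slit_disk) = 0%E.
Proof.
rewrite (@area_sections R setT (fun=> 0)) //; [by rewrite integral0| |by move=> x []].
move=> x _; apply: (@countable_lebesgue_measure0 R).
apply: (@sub_countable _ _ _ [set y | y \in [:: 0; Num.sqrt (1 - x ^+ 2); - Num.sqrt (1 - x ^+ 2)]]).
  apply: subset_card_le => y; rewrite /xsection /= inE /disk /slit_disk /open_disk /= => -[h1 h2].
  have [->|y0] := eqVneq y 0; first by rewrite !inE eqxx.
  have e : x ^+ 2 + y ^+ 2 = 1.
    apply/eqP; rewrite eq_le h1 /= leNgt; apply/negP => h; exact: h2.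
  have : y ^+ 2 = Num.sqrt (1 - x ^+ 2) ^+ 2.
    by rewrite sqr_sqrtr; have := sqr_ge0 y; lra.
  by move/eqP; rewrite eqf_sqr => /orP[] /eqP ->; rewrite !inE eqxx ?orbT.
by apply: finite_set_countable; exact: finite_seq.
Qed.

Lemma mu2_disk_lty : (mu2 disk < +oo)%E.
Proof.
apply: (@le_lt_trans _ _ (mu2 (`[-1, 1]%classic `*` `[-1, 1]%classic))).
  apply: (le_measure (product_measure1 mu mu)); rewrite ?inE.
  - exact: measurable_disk.
  - exact: measurableX.
  - move=> x; rewrite /disk /= !in_itv /= -!ler_norml => h.
    rewrite -!sqr_le_abs // expr1n; have := sqr_ge0 x.1; have := sqr_ge0 x.2; split; lra.
rewrite product_measure1E //= lebesgue_measure_itv /= lte_fin; case: ifP => _; last by rewrite mul0e.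
by rewrite -EFinD -EFinM ltry.
Qed.

Lemma mu2_slit_disk (X : set (R * R)) : measurable X -> X `<=` disk -> mu2 (X `&` slit_disk) = mu2 X.
Proof.
move=> mX XD.
have mXi : measurable (X `\` slit_disk) by apply: measurableD => //; exact: measurable_slit_disk.
rewrite -[in RHS](setUIDK X slit_disk) mu2U //; last first.
- by apply/seteqP; split => // x [[_ h1] [_ h2]].
- by apply: measurableI => //; exact: measurable_slit_disk.
rewrite [X in (_ + X)%E](_ : _ = 0%E) ?adde0 //.
apply: (subset_measure0 (mu := product_measure1 mu mu) _ _ _ slit_null) => //.
  by apply: measurableD; [exact: measurable_disk|exact: measurable_slit_disk].
by move=> x [Xx ix]; split => //; exact: XD.
Qed.

End slit.

Section strips.
Context {R : realType}.
Local Notation mu := (@lebesgue_measure R).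
Local Notation mu2 := (mu \x mu)%E.

Definition strip (v v1 : R -> R) (a b : R) : set (R * R) :=
  [set x | slit_disk x /\ (0 < side v v1 a x /\ side v v1 b x <= 0)].

(** The measure given by [left_of_area] for the ruling of slope c; the second
    term is twice the signed area of a triangle. *)
Definition left_area (v v1 : R -> R) (c : R) : R :=
  cap_area (c / v c) + ordinate v c / v c * (v1 c - c / v c).

Definition integrand (u : R * R -> \bar R) (x : R * R) : R :=
  1 / (1 + ((grad u x).1 ^+ 2 + (grad u x).2 ^+ 2)).

(** The integrand of J on the ruling of slope c, see [integrand_ruling]. *)
Definition density (v : R -> R) (c : R) : R := (1 + v c ^+ 2)^-1.

Lemma integrand01 u x : 0 <= integrand u x <= 1.
Proof.
have h : 1 <= 1 + ((grad u x).1 ^+ 2 + (grad u x).2 ^+ 2).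
  by rewrite lerDl addr_ge0 ?sqr_ge0.
have h0 : 0 < 1 + ((grad u x).1 ^+ 2 + (grad u x).2 ^+ 2) by lra.
by rewrite /integrand divr_ge0 ?(ltW h0) //= ler_pdivrMr // mul1r.
Qed.

Lemma measurable_side (v v1 : R -> R) c : measurable_fun setT (side v v1 c).
Proof. exact: measurable_side_form. Qed.

Lemma measurable_side_gt0 (v v1 : R -> R) c : measurable [set x | 0 < side v v1 c x].
Proof.
have -> : [set x | 0 < side v v1 c x] = [set x | - side v v1 c x < 0].
  by apply/seteqP; split => x /=; rewrite oppr_lt0.
by apply: measurable_lt0; apply: measurableT_comp => //; exact: measurable_side.
Qed.

Lemma measurable_strip (v v1 : R -> R) a b : measurable (strip v v1 a b).
Proof.
have -> : strip v v1 a b = slit_disk `&` ([set x | 0 < side v v1 a x] `&` [set x | side v v1 b x <= 0]) by [].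
apply: measurableI; first exact: measurable_slit_disk.
apply: measurableI; first exact: measurable_side_gt0.
by apply: measurable_le0; exact: measurable_side.
Qed.

Section one_arc.
Variables (lo hi : R) (v v1 v2 : R -> R).
Hypothesis A : arc lo hi v v1 v2.
Local Notation Q := (fun c : R => c \in `]lo, hi[).

Lemma arc_left_area c : Q c ->
  mu2 [set x | disk x /\ side v v1 c x <= 0] = (left_area v v1 c)%:E.
Proof.
move=> Qc; have v0 := arc_pos_v A Qc; have q0 := ordinate_gt0 A Qc.
rewrite /left_area -(left_of_area (k := c / v c) (s := ordinate v c / v c) (B := v1 c)).
- congr (mu2 _); apply/seteqP; split => x [dx h]; split => //; move: h; rewrite /side.
  + have -> : ordinate v c * (x.1 - v1 c) - `|x.2| * (c - v c * v1 c) = 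
      v c * (ordinate v c / v c * (x.1 - v1 c) - `|x.2| * (c / v c - v1 c)).
      by field; rewrite gt_eqF.
    by rewrite pmulr_rle0.
  + have -> : ordinate v c * (x.1 - v1 c) - `|x.2| * (c - v c * v1 c) = 
      v c * (ordinate v c / v c * (x.1 - v1 c) - `|x.2| * (c / v c - v1 c)).
      by field; rewrite gt_eqF.
    by rewrite pmulr_rle0.
- by rewrite divr_gt0.
- exact: (arc_unit A).
- exact: (arc_v1 A).
Qed.

Lemma strip_area a b : Q a -> Q b -> a < b ->
  mu2 (strip v v1 a b) = (left_area v v1 b - left_area v v1 a)%:E.
Proof.
move=> Qa Qb ab.
pose E c : set (R * R) := [set x | disk x /\ side v v1 c x <= 0].
have mE c : measurable (E c).
  have -> : E c = disk `&` [set x | side v v1 c x <= 0] by [].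
  apply: measurableI; first exact: measurable_disk.
  by apply: measurable_le0; exact: measurable_side.
have ED c : E c `<=` disk by move=> x [].
have e : E b `&` slit_disk = (E a `&` slit_disk) `|` strip v v1 a b.
  apply/seteqP; split => x.
    move=> [[dx sb] ix]; have [sa|sa] := leP (side v v1 a x) 0; [by left|by right].
  move=> [[[dx sa] ix]|[ix [sa sb]]]; split => //; split => //.
    by apply: ltW; apply: (side_decr A Qa Qb ab) => //; case: ix.
  by apply: open_disk_sub; case: ix.
have := mu2_slit_disk (mE b) (@ED b); rewrite arc_left_area // e mu2U.
- rewrite (mu2_slit_disk (mE a) (@ED a)) arc_left_area // => H.
  have f : mu2 (strip v v1 a b) \is a fin_num.
    rewrite ge0_fin_numE ?mu2_ge0 //; apply: le_lt_trans mu2_disk_lty.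
    apply: (le_measure (product_measure1 mu mu)); rewrite ?inE.
    + exact: measurable_strip.
    + exact: measurable_disk.
    + by move=> x [[ox _] _]; exact: open_disk_sub.
  move: H; rewrite -(fineK f) -EFinD => -[<-]; congr EFin; ring.
- by apply: measurableI => //; exact: measurable_slit_disk.
- exact: measurable_strip.
- by apply/seteqP; split => // x [[[_ h1] _] [_ [h2 _]]]; lra.
Qed.

Lemma strip_zero a b x : Q a -> Q b -> a < b -> strip v v1 a b x ->
  exists c, [/\ a < c, c <= b & side v v1 c x = 0].
Proof.
move=> Qa Qb ab [ix [sa sb]].
have [c + sc] := side_zero A Qa Qb (ltW ab) sb (ltW sa).
rewrite in_itv /= => /andP[ac cb]; exists c; split => //.
by rewrite lt_neqAle ac andbT; apply: contraTneq sa => ->; rewrite sc ltxx.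
Qed.

(** The slope of the ruling through x.  On a strip it is measurable because its
    sublevel sets are given by the sign of [side]. *)
Definition slope (x : R * R) : R := xget lo [set c | Q c /\ side v v1 c x = 0].

Lemma slopeE c x : Q c -> open_disk x -> side v v1 c x = 0 -> slope x = c.
Proof.
move=> Qc ox sc; rewrite /slope; case: xgetP => [d _ [Qd sd]|/(_ c) /=].
  exact: (rulings_disjoint A Qd Qc ox).
by case.
Qed.

Lemma measurable_slope a b : Q a -> Q b -> a < b -> measurable_fun (strip v v1 a b) slope.
Proof.
move=> Qa Qb ab mD; apply: (measurability _ (RGenOInfty.measurableE R)) => //.
move=> /= _ [_ [m ->] <-]; rewrite preimage_itvoy.
have S x : strip v v1 a b x -> [/\ a < slope x, slope x <= b &
    forall d, Q d -> (side v v1 d x <= 0) = (slope x <= d)].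
  move=> Sx; have [c [ac cb sc]] := strip_zero Qa Qb ab Sx.
  have Qc : Q c by apply: (arc_sub Qa Qb); rewrite in_itv /= ltW.
  have ox : open_disk x by case: Sx => -[].
  rewrite (slopeE Qc ox sc); split => // d Qd; exact: (side_sign A Qc Qd ox sc).
have [ma|am] := ltP m a.
  rewrite (_ : _ `&` _ = strip v v1 a b) //; apply/seteqP; split => [x []//|x Sx].
  by split => //=; have [h _ _] := S x Sx; exact: lt_trans ma h.
have [mb|bm] := ltP m b.
  have Qm : Q m by apply: (arc_sub Qa Qb); rewrite in_itv /= am ltW.
  rewrite (_ : _ `&` _ = strip v v1 a b `&` [set x | 0 < side v v1 m x]).
    by apply: measurableI; [exact: measurable_strip|exact: measurable_side_gt0].
  by apply/seteqP; split => x [Sx /= h]; split => //=; have [_ _ H] := S x Sx;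
    move: h; rewrite !ltNge H.
rewrite (_ : _ `&` _ = set0) //; apply/seteqP; split => // x [Sx /=].
by have [_ h _] := S x Sx; rewrite ltNge (le_trans h bm).
Qed.

Lemma density_cont c : Q c -> {for c, continuous (density v)}.
Proof.
move=> Qc; apply: cvgV; first by rewrite gt_eqF // ltr_wpDr ?sqr_ge0.
apply: cvgD; first exact: cvg_cst.
by apply: cvgM; exact: derive_continuous (arc_d1 A Qc).
Qed.

Lemma measurable_density_slope a b : Q a -> Q b -> a < b ->
  measurable_fun (strip v v1 a b) (density v \o slope).
Proof.
move=> Qa Qb ab.
apply: (measurable_comp (F := [set c | Q c])) => //; last 2 first.
- apply: open_continuous_measurable_fun; first exact: interval_open.
  by move=> c /set_mem Qc; exact: density_cont.
- exact: measurable_slope.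
move=> _ [x Sx <-] /=; have [c [ac cb sc]] := strip_zero Qa Qb ab Sx.
have Qc : Q c by apply: (arc_sub Qa Qb); rewrite in_itv /= ltW.
by rewrite (slopeE Qc _ sc) //; case: Sx => -[].
Qed.

Section one_hull.
Variables (M : R) (g : R -> R).
Hypothesis adm : admissible M g.
Hypothesis ct : contact M lo hi g v v1.
Let U := generated M (axis_fun g).

Lemma integrand_ruling c x : Q c -> slit_disk x -> side v v1 c x = 0 ->
  integrand U x = density v c.
Proof.
move=> Qc [ox x2] sc; rewrite /integrand (hull_grad A adm ct Qc ox x2 sc) /= /density div1r.
congr (_ ^-1); rewrite exprMn (ordinate_sqr A Qc) -(real_normK (num_real (Num.sg x.2))) normr_sg x2.
by congr (1 + _); rewrite expr1n mul1r addrC subrK.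
Qed.

Lemma strip_integrand a b x : Q a -> Q b -> a < b -> strip v v1 a b x ->
  exists c, [/\ a < c, c <= b, integrand U x = density v c & slope x = c].
Proof.
move=> Qa Qb ab Sx; have [c [ac cb sc]] := strip_zero Qa Qb ab Sx.
have Qc : Q c by apply: (arc_sub Qa Qb); rewrite in_itv /= ltW.
exists c; split => //; first by apply: integrand_ruling => //; case: Sx.
by apply: slopeE => //; case: Sx => -[].
Qed.

Lemma measurable_integrand a b : Q a -> Q b -> a < b ->
  measurable_fun (strip v v1 a b) (integrand U).
Proof.
move=> Qa Qb ab; apply: (eq_measurable_fun (density v \o slope)); last exact: measurable_density_slope.
move=> x /set_mem Sx; have [c [_ _ -> /= ->]] := strip_integrand Qa Qb ab Sx; by [].
Qed.

Definition strip_integral (a b : R) : \bar R := (\int[mu2]_(x in strip v v1 a b) (integrand U x)%:E)%E.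

Lemma strip_integral_bounds a b (m m' : R) : Q a -> Q b -> a < b -> 0 <= m ->
  (forall c, c \in `[a, b] -> m <= density v c <= m') ->
  ((m * (left_area v v1 b - left_area v v1 a))%:E <= strip_integral a b)%E /\
  (strip_integral a b <= (m' * (left_area v v1 b - left_area v v1 a))%:E)%E.
Proof.
move=> Qa Qb ab m0 H.
have m'0 : 0 <= m'.
  have /H/andP[h1 h2] : a \in `[a, b] by rewrite in_itv /= lexx ltW.
  exact: le_trans m0 (le_trans h1 h2).
have mS := measurable_strip v v1 a b.
rewrite !EFinM -!(strip_area Qa Qb ab).
rewrite -!(integral_cst (product_measure1 mu mu) mS).
split; apply: le_integral_nomeas => x Sx; rewrite /= ?lee_fin //.
- have [c [ac cb -> _]] := strip_integrand Qa Qb ab Sx.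
  by have /H/andP[] : c \in `[a, b] by rewrite in_itv /= ltW.
- by case/andP: (integrand01 U x).
- have [c [ac cb -> _]] := strip_integrand Qa Qb ab Sx.
  by have /H/andP[] : c \in `[a, b] by rewrite in_itv /= ltW.
Qed.

Lemma strip_integral_fin a b : Q a -> Q b -> a < b -> strip_integral a b \is a fin_num.
Proof.
move=> Qa Qb ab; have [|h1 h2] := @strip_integral_bounds a b 0 1 Qa Qb ab (lexx 0).
  move=> c _; rewrite /density invr_ge0 addr_ge0 ?sqr_ge0 //= invf_le1 ?lerDl ?sqr_ge0 //.
  by rewrite ltr_wpDr ?sqr_ge0.
rewrite fin_numE; apply/andP; split.
  by rewrite gt_eqF // (lt_le_trans _ h1) // ltNyr.
by rewrite lt_eqF // (le_lt_trans h2) // ltry.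
Qed.

Lemma strip_integral_add a b c : Q a -> Q b -> Q c -> a < b -> b < c ->
  strip_integral a c = (strip_integral a b + strip_integral b c)%E.
Proof.
move=> Qa Qb Qc ab bc; have ac := lt_trans ab bc.
have e : strip v v1 a c = strip v v1 a b `|` strip v v1 b c.
  apply/seteqP; split => x.
    move=> [ix [sa sc]]; have [sb|sb] := leP (side v v1 b x) 0; [by left|by right].
  move=> [[ix [sa sb]]|[ix [sb sc]]]; split => //; split => //.
    by apply: ltW; apply: (side_decr A Qb Qc bc) => //; case: ix.
  rewrite ltNge; apply/negP => sa.
  have := side_decr A Qa Qb ab (proj1 ix) sa; lra.
have mI := measurable_integrand Qa Qc ac.
rewrite /strip_integral e (ge0_integral_setU (product_measure1 mu mu)) //.
- exact: measurable_strip.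
- exact: measurable_strip.
- by rewrite -e; exact/measurable_EFinP.
- by move=> x _; rewrite lee_fin; case/andP: (integrand01 U x).
- rewrite disj_set2E; apply/eqP/seteqP; split => // x [[_ [_ h1]] [_ [h2 _]]]; lra.
Qed.

End one_hull.
End one_arc.
End strips.

Section squeeze.
Context {R : realType}.

(** A Stieltjes-type mean value property, G b - G a lying between the extreme
    values of P times S b - S a, makes G differentiable wherever S is, with
    derivative P S'. *)
Lemma squeeze_derive (lo hi : R) (G S P : R -> R) (c sg : R) : c \in `]lo, hi[ ->
  is_derive c 1 S sg -> {for c, continuous P} -> 0 < P c ->
  (forall a b m m' : R, a \in `]lo, hi[ -> b \in `]lo, hi[ -> a < b -> 0 <= m ->
    (forall d, d \in `[a, b] -> m <= P d <= m') ->
    m * (S b - S a) <= G b - G a <= m' * (S b - S a)) ->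
  is_derive c 1 G (P c * sg).
Proof.
move=> Qc [dS vS] cP P0 H.
suff : (fun h : R => h^-1 *: ((G \o shift c) (h *: (1 : R)) - G c)) @ 0^' --> P c * sg.
  by move=> K; apply: DeriveDef; [apply/cvg_ex; exists (P c * sg)|exact: cvg_lim K].
have cS : (fun h : R => h^-1 *: ((S \o shift c) (h *: (1 : R)) - S c)) @ 0^' --> sg.
  by rewrite -vS; exact: dS.
apply/cvgrPdist_le => e e0.
pose eta := Num.min (P c) (e / (2 * (`|sg| + 1))).
have sg1 : 0 < `|sg| + 1 by rewrite ltr_wpDl.
have eta0 : 0 < eta by rewrite lt_min P0 divr_gt0 // mulr_gt0.
have eta1 : eta <= P c by rewrite ge_min lexx.
have eta2 : eta * (`|sg| + 1) <= e / 2.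
  have : eta <= e / (2 * (`|sg| + 1)) by rewrite ge_min lexx orbT.
  rewrite ler_pdivlMr ?mulr_gt0 //; lra.
pose th := Num.min 1 (e / (2 * P c)).
have th0 : 0 < th by rewrite lt_min ltr01 divr_gt0 // mulr_gt0.
have th1 : th <= 1 by rewrite ge_min lexx.
have th2 : P c * th <= e / 2.
  have : th <= e / (2 * P c) by rewrite ge_min lexx orbT.
  rewrite ler_pdivlMr ?mulr_gt0 //; lra.
have nP : nbhs c [set d | `|P c - P d| <= eta].
  by have /cvgrPdist_le := cP; apply.
have nQ : nbhs c [set d | d \in `]lo, hi[] by exact: near_in_itvoo.
have /nbhs_ballP[d /= d0 hd] : nbhs c ([set d | `|P c - P d| <= eta] `&` [set d | d \in `]lo, hi[]).
  exact: filterI.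
have key a b : a < b -> `|c - a| < d -> `|c - b| < d ->
    `|(G b - G a) - P c * (S b - S a)| <= eta * (S b - S a).
  move=> ab ad bd.
  have ball_ab x : x \in `[a, b] -> `|c - x| < d.
    rewrite in_itv /= => /andP[x1 x2]; move: ad bd; rewrite !ltr_norml => /andP[? ?] /andP[? ?].
    by apply/andP; split; lra.
  have [_ Qa] := hd _ (ad : ball c d a); have [_ Qb] := hd _ (bd : ball c d b).
  have m0 : 0 <= P c - eta by rewrite subr_ge0.
  have := H a b (P c - eta) (P c + eta) Qa Qb ab m0.
  have HH x : x \in `[a, b] -> P c - eta <= P x <= P c + eta.
    move=> /ball_ab hx; have [/= + _] := hd _ (hx : ball c d x).
    by rewrite ler_norml => /andP[h1 h2]; apply/andP; split; lra.
  move=> /(_ HH)/andP[k1 k2]; rewrite ler_norml; apply/andP; split; lra.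
have /cvgrPdist_le /(_ th th0) nS := cS.
have nB : \forall h \near (0 : R)^', `|h| < d.
  apply: nbhs_dnbhs; have := nbhsx_ballx (0 : R) d d0.
  by apply: filterS => h; rewrite /ball /= sub0r normrN.
near=> h.
have hn : h != 0 by near: h; exact: nbhs_dnbhs_neq.
have hd' : `|h| < d by near: h.
have hS : `|sg - h^-1 *: ((S \o shift c) (h *: (1 : R)) - S c)| <= th by near: h.
move: hS; rewrite /GRing.scale /= !mulr1.
set dS' := S (h + c) - S c; set dG' := G (h + c) - G c => hS.
have kk : `|dG' - P c * dS'| <= eta * `|dS'|.
  have hcd : `|c - (h + c)| < d by rewrite opprD addrCA subrr addr0 normrN.
  have ccd : `|c - c| < d by rewrite subrr normr0.
  have [hp|hp|h0] := ltgtP h 0; last by rewrite h0 eqxx in hn.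
  - have hc : h + c < c by rewrite gtrDr.
    have K := key _ _ hc hcd ccd.
    rewrite -normrN -(normrN dS').
    have -> : - (dG' - P c * dS') = G c - G (h + c) - P c * (S c - S (h + c)) by rewrite /dG' /dS'; ring.
    have -> : - dS' = S c - S (h + c) by rewrite /dS'; ring.
    by apply: le_trans K _; rewrite ler_pM2l // ler_norm.
  - have hc : c < h + c by rewrite ltrDr.
    have K := key _ _ hc ccd hcd.
    by apply: le_trans K _; rewrite ler_pM2l // ler_norm.
have q1 : `|h^-1 * dS'| <= `|sg| + 1.
  rewrite -[h^-1 * dS'](subrK sg) addrC; apply: le_trans (ler_normD _ _) _.
  by rewrite lerD2l distrC; exact: le_trans hS th1.
have q2 : `|h^-1 * dG' - P c * (h^-1 * dS')| <= eta * `|h^-1 * dS'|.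
  rewrite mulrCA -mulrBr !normrM mulrCA ler_pM2l // normr_gt0; exact: invr_neq0.
have -> : P c * sg - h^-1 * dG' = P c * (sg - h^-1 * dS') - (h^-1 * dG' - P c * (h^-1 * dS')) by ring.
apply: le_trans (ler_normB _ _) _.
rewrite normrM (gtr0_norm P0).
have r1 : P c * `|sg - h^-1 * dS'| <= P c * th by rewrite ler_pM2l.
have r2 : eta * `|h^-1 * dS'| <= eta * (`|sg| + 1) by rewrite ler_pM2l.
have := le_trans q2 r2; lra.
Unshelve. all: by end_near. Qed.

End squeeze.

Section strip_derive.
Context {R : realType}.
Variables (lo hi : R) (v v1 v2 : R -> R).
Hypothesis A : arc lo hi v v1 v2.
Local Notation Q := (fun c : R => c \in `]lo, hi[).
Variables (M : R) (g : R -> R).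
Hypothesis adm : admissible M g.
Hypothesis ct : contact M lo hi g v v1.

Definition strip_resistance (a c : R) : R := fine (strip_integral v v1 M g a c).

Lemma strip_resistance_derive a c (sg : R) : Q a -> Q c -> a < c -> is_derive c 1 (left_area v v1) sg ->
  is_derive c 1 (strip_resistance a) (density v c * sg).
Proof.
move=> Qa Qc ac dS.
have Qlo b : b \in `]a, hi[ -> Q b.
  move: Qa; rewrite !in_itv /= => /andP[h1 _] /andP[h2 ->]; rewrite andbT; exact: lt_trans h1 h2.
apply: (@squeeze_derive R a hi _ (left_area v v1) (density v)) => //.
- by move: Qc; rewrite !in_itv /= ac => /andP[].
- exact: density_cont A _ Qc.
- by rewrite /density invr_gt0 ltr_wpDr ?sqr_ge0.
move=> b d m m' Qb Qd bd m0 H.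
have ab : a < b by move: Qb; rewrite in_itv => /andP[].
have [h1 h2] := strip_integral_bounds A adm ct (Qlo _ Qb) (Qlo _ Qd) bd m0 H.
have f := strip_integral_fin A adm ct (Qlo _ Qb) (Qlo _ Qd) bd.
have -> : strip_resistance a d - strip_resistance a b = fine (strip_integral v v1 M g b d).
  rewrite /strip_resistance (strip_integral_add A adm ct Qa (Qlo _ Qb) (Qlo _ Qd) ab bd) fineD //.
    by rewrite addrC addKr.
  exact: (strip_integral_fin A adm ct Qa (Qlo _ Qb) ab).
by rewrite -!lee_fin fineK // h1 h2.
Qed.

Lemma strip_resistance_sub a b c : Q a -> Q b -> Q c -> a < b -> b < c ->
  strip_resistance a c - strip_resistance a b = fine (strip_integral v v1 M g b c).
Proof.
move=> Qa Qb Qc ab bc.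
have fb := strip_integral_fin A adm ct Qa Qb ab.
have fc := strip_integral_fin A adm ct Qb Qc bc.
have e : strip_resistance a c = strip_resistance a b + fine (strip_integral v v1 M g b c).
  by rewrite /strip_resistance (strip_integral_add A adm ct Qa Qb Qc ab bc) fineD.
by rewrite e addrC addKr.
Qed.

End strip_derive.

Section compare.
Context {R : realType}.
Local Notation mu := (@lebesgue_measure R).
Local Notation mu2 := (mu \x mu)%E.
Variables (lo hi : R) (v v1 v2 w w1 w2 : R -> R).
Hypotheses (A : arc lo hi v v1 v2) (A' : arc lo hi w w1 w2).
Variables (M : R) (g h : R -> R).
Hypotheses (ag : admissible M g) (ah : admissible M h).
Hypotheses (cg : contact M lo hi g v v1) (ch : contact M lo hi h w w1).
Local Notation Q := (fun c : R => c \in `]lo, hi[).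
Variables (a b : R).
Hypotheses (Qa : Q a) (Qb : Q b) (ab : a < b).
Hypotheses (va : v a = w a) (v1a : v1 a = w1 a) (vb : v b = w b) (v1b : v1 b = w1 b).
Hypothesis gh : forall y, y \in `[-1, 1] -> y \notin `]v1 a, v1 b[ -> g y = h y.
Let U := generated M (axis_fun g).
Let W := generated M (axis_fun h).

(** The two integrands agree on the disk off the strip and the null set: the
    functions agree near such points, except on the ruling a itself, where both
    gradients are given by the common slope. *)
Lemma strip_integral_le : (J U <= J W)%E ->
  fine (strip_integral v v1 M g a b) <= fine (strip_integral w w1 M h a b).
Proof.
move=> le_J.
apply: fine_le; [exact: (strip_integral_fin A ag cg)|exact: (strip_integral_fin A' ah ch)|].
have eS : strip w w1 a b = strip v v1 a b.
  by rewrite /strip /side /ordinate va v1a vb v1b.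
rewrite /strip_integral eS.
apply: (@le_integral_local _ _ _ (product_measure1 mu mu) disk _ (disk `\` slit_disk)).
- exact: measurable_disk.
- exact: measurable_strip.
- by apply: measurableD; [exact: measurable_disk|exact: measurable_slit_disk].
- exact: mu2_disk_lty.
- by move=> x [[ox _] _]; exact: open_disk_sub.
- exact: slit_null.
- by move=> x; exact: integrand01.
- by move=> x; exact: integrand01.
- exact: (measurable_integrand A ag cg).
- rewrite -eS; exact: (measurable_integrand A' ah ch).
- move=> x dx nS nN.
  have ix : slit_disk x by apply: contrapT => nix; apply: nN.
  have off : off_arc v v1 a b x -> integrand U x = integrand W x.
    by move=> ox; rewrite /integrand (hull_grad_agree A A' ag ah cg ch Qa Qb va v1a vb v1b gh ox).
  have [sb|sb] := ltP 0 (side v v1 b x); first by apply: off; apply: Or33.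
  have [sa|sa|sa] := ltgtP (side v v1 a x) 0.
  + by apply: off; apply: Or32.
  + by exfalso; exact: (nS (conj ix (conj sa sb))).
  + rewrite (integrand_ruling A ag cg Qa ix sa) (integrand_ruling A' ah ch Qa ix).
      by rewrite /density va.
    by rewrite -sa /side /ordinate va v1a.
- exact: le_J.
Qed.

End compare.

(** * Perturbing the profile *)

Section three_points.
Context {R : realType}.
Implicit Types (f : R -> R).

(** Convexity on [-1, 1] with the denominators cleared. *)
Definition cvx3 f := forall y z x : R, y \in `[-1, 1] -> x \in `[-1, 1] -> y <= z <= x ->
  (x - y) * f z <= (x - z) * f y + (z - y) * f x.

Lemma cvx3_cvx f : cvx3 f -> forall x y t : R, x \in `[-1, 1] -> y \in `[-1, 1] -> 0 <= t <= 1 ->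
  f ((1 - t) * x + t * y) <= (1 - t) * f x + t * f y.
Proof.
move=> H; suff W (x y t : R) : x \in `[-1, 1] -> y \in `[-1, 1] -> 0 <= t <= 1 -> x < y ->
    f ((1 - t) * x + t * y) <= (1 - t) * f x + t * f y.
  move=> x y t hx hy ht; have [xy|yx|->] := ltgtP x y; first exact: W.
  - have ht' : 0 <= 1 - t <= 1 by move: ht => /andP[t0 t1]; apply/andP; split; lra.
    have := W y x (1 - t) hy hx ht' yx.
    have -> : (1 - (1 - t)) * y + (1 - t) * x = (1 - t) * x + t * y by ring.
    by have -> : (1 - (1 - t)) * f y + (1 - t) * f x = (1 - t) * f x + t * f y by ring.
  - by rewrite -!mulrDl subrK !mul1r.
move=> hx hy /andP[t0 t1] xy; have d : 0 < y - x by rewrite subr_gt0.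
have := H x ((1 - t) * x + t * y) y hx hy.
have -> : y - ((1 - t) * x + t * y) = (y - x) * (1 - t) by ring.
have -> : (1 - t) * x + t * y - x = (y - x) * t by ring.
rewrite -!mulrA -mulrDr ler_pM2l //; apply.
by apply/andP; split; nra.
Qed.

Lemma cvx_cvx3 f : (forall x y t : R, x \in `[-1, 1] -> y \in `[-1, 1] -> 0 <= t <= 1 ->
  f ((1 - t) * x + t * y) <= (1 - t) * f x + t * f y) -> cvx3 f.
Proof.
move=> H y z x hy hx /andP[yz zx].
have [yx|yx] := eqVneq y x.
  have -> : z = x by apply/eqP; rewrite eq_le zx -yx.
  by rewrite yx !subrr !mul0r addr0.
have d : 0 < x - y by rewrite subr_gt0 lt_neqAle yx (le_trans yz).
pose t := (z - y) / (x - y).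
have ht : 0 <= t <= 1.
  apply/andP; split; first by rewrite /t divr_ge0 //; lra.
  by rewrite /t ler_pdivrMr //; lra.
have dn : x - y != 0 by rewrite gt_eqF.
have et : (1 - t) * y + t * x = z by rewrite /t; field.
have := H y x t hy hx ht; rewrite et -(ler_pM2l d).
have -> : (x - y) * ((1 - t) * f y + t * f x) = (x - z) * f y + (z - y) * f x.
  by rewrite /t; field.
by [].
Qed.

(** If z lies below the chord from y to m, and m below the chord from y to x,
    then z lies below the chord from y to x. *)
Lemma cvx3_chain f (y z m x : R) : y <= z -> z < m -> m <= x ->
  (m - y) * f z <= (m - z) * f y + (z - y) * f m ->
  (x - y) * f m <= (x - m) * f y + (m - y) * f x ->
  (x - y) * f z <= (x - z) * f y + (z - y) * f x.
Proof.
move=> yz zm mx h1 h2.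
have d : 0 < m - y by lra.
have h3 : 0 <= x - y by lra.
have h4 : 0 <= z - y by lra.
rewrite -(ler_pM2l d).
have := ler_wpM2l h3 h1; have := ler_wpM2l h4 h2; lra.
Qed.

Lemma cvx3_chain' f (y z m x : R) : y <= m -> m < z -> z <= x ->
  (x - m) * f z <= (x - z) * f m + (z - m) * f x ->
  (x - y) * f m <= (x - m) * f y + (m - y) * f x ->
  (x - y) * f z <= (x - z) * f y + (z - y) * f x.
Proof.
move=> yz zm mx h1 h2.
have d : 0 < x - m by lra.
have h3 : 0 <= x - y by lra.
have h4 : 0 <= x - z by lra.
rewrite -(ler_pM2l d).
have := ler_wpM2l h3 h1; have := ler_wpM2l h4 h2; lra.
Qed.

(** At a point of [m1, m2] the supporting line gives convexity directly.  At a
    point outside, say to the left of m1, either both ends are outside and g is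
    used, or the chord passes over m1, where the supporting line applies, and
    g is used between the left end and m1. *)
Lemma cvx3_glue (g h : R -> R) (m1 m2 : R) : cvx3 g ->
  (forall y, y \in `[-1, 1] -> y \notin `]m1, m2[ -> g y = h y) ->
  m1 <= m2 -> m1 \in `[-1, 1] -> m2 \in `[-1, 1] ->
  (forall z, z \in `[m1, m2] -> exists k, forall y, y \in `[-1, 1] -> h z + k * (y - z) <= h y) ->
  cvx3 h.
Proof.
move=> cg gh m12 hm1 hm2 sup.
have mid y z x : y \in `[-1, 1] -> x \in `[-1, 1] -> y <= z <= x -> z \in `[m1, m2] ->
    (x - y) * h z <= (x - z) * h y + (z - y) * h x.
  move=> hy hx /andP[yz zx] /sup[k K].
  have k1 := K y hy; have k2 := K x hx.
  have h3 : 0 <= x - z by lra.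
  have h4 : 0 <= z - y by lra.
  have := ler_wpM2l h3 k1; have := ler_wpM2l h4 k2; lra.
have in1 : m1 \in `[m1, m2] by rewrite in_itv /= lexx.
have in2 : m2 \in `[m1, m2] by rewrite in_itv /= lexx m12.
have gh1 (y : R) : y \in `[-1, 1] -> y <= m1 -> g y = h y.
  by move=> hy ym; apply: gh => //; rewrite in_itv /= negb_and -leNgt ym.
have gh2 (y : R) : y \in `[-1, 1] -> m2 <= y -> g y = h y.
  by move=> hy ym; apply: gh => //; rewrite in_itv /= negb_and -!leNgt ym orbT.
move=> y z x hy hx /andP[yz zx].
have hz : z \in `[-1, 1].
  move: hy hx; rewrite !in_itv /= => /andP[y1 _] /andP[_ x1].
  by rewrite (le_trans y1) //= (le_trans zx).
have [z1|z1] := ltP z m1.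
  have ym : y <= m1 by rewrite (le_trans yz) // ltW.
  have [xm|xm] := leP x m1.
    by rewrite -!gh1 //; [apply: cg => //; rewrite yz|exact: ltW].
  apply: (cvx3_chain yz z1 (ltW xm)).
    by rewrite -!gh1 //; [apply: cg => //; rewrite yz ltW|exact: ltW].
  by apply: mid => //; rewrite ym ltW.
have [z2|z2] := ltP m2 z.
  have xm : m2 <= x by rewrite (le_trans _ zx) // ltW.
  have [ym|ym] := leP m2 y.
    by rewrite -!gh2 //; [apply: cg => //; rewrite yz|exact: ltW].
  apply: (cvx3_chain' (ltW ym) z2 zx).
    by rewrite -!gh2 //; [apply: cg => //; rewrite zx ltW|exact: ltW].
  by apply: mid => //; rewrite xm ltW.
by apply: mid => //; rewrite ?yz ?in_itv /= ?z1.
Qed.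

End three_points.

Section perturb.
Context {R : realType}.
Variables (lo hi : R) (v v1 v2 : R -> R).
Hypothesis A : arc lo hi v v1 v2.
Local Notation Q := (fun c : R => c \in `]lo, hi[).
Variables (M : R) (g : R -> R).
Hypothesis adm : admissible M g.
Hypothesis ct : contact M lo hi g v v1.
Variables (a b : R).
Hypotheses (Qa : Q a) (Qb : Q b) (ab : a < b).
Variables (w w1 w2 : R -> R).
Hypotheses (dw : forall c, Q c -> is_derive c 1 w (w1 c))
  (dw1 : forall c, Q c -> is_derive c 1 w1 (w2 c))
  (w2_gt0 : forall c, Q c -> 0 < w2 c)
  (w2_cont : forall c, Q c -> {for c, continuous w2})
  (wv : forall c, Q c -> c \notin `]a, b[ -> w c = v c)
  (w1v1 : forall c, Q c -> c \notin `]a, b[ -> w1 c = v1 c).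

Let na : a \notin `]a, b[. Proof. by rewrite in_itv /= ltxx. Qed.
Let nb : b \notin `]a, b[. Proof. by rewrite in_itv /= ltxx andbF. Qed.

Let sub c d e : Q c -> Q d -> e \in `[c, d] -> Q e.
Proof. exact: arc_sub. Qed.

Let w1_incr c d : Q c -> Q d -> c < d -> w1 c < w1 d.
Proof.
move=> Qc Qd cd.
have D x : x \in `[c, d] -> is_derive x 1 w1 (w2 x) by move=> xcd; exact: (dw1 (sub Qc Qd xcd)).
have [x xcd e] := mvt cd D.
rewrite -subr_gt0 e mulr_gt0 ?subr_gt0 //; apply: w2_gt0.
by apply: (sub Qc Qd); exact: subset_itv_oo_cc.
Qed.

Let w1_range c : Q c -> -1 < w1 c < 1.
Proof.
move=> Qc; have [cab|cab] := boolP (c \in `]a, b[); last by rewrite w1v1 //; exact: (arc_v1 A).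
move: cab; rewrite in_itv /= => /andP[ac cb].
have := w1_incr Qa Qc ac; have := w1_incr Qc Qb cb; rewrite (w1v1 Qa na) (w1v1 Qb nb).
have /andP[h1 h2] := arc_v1 A Qa; have /andP[h3 h4] := arc_v1 A Qb.
by move=> h5 h6; rewrite (lt_trans h1) //= (lt_trans h5).
Qed.

(** The derivative w1 is increasing and unchanged at a and b, so it stays in
    ]-1, 1[; then w - id decreases and w + id increases, so |c| < w c also
    follows from the values at a and b. *)
Lemma perturb_arc : arc lo hi w w1 w2.
Proof.
split => // c Qc.
have [cab|cab] := boolP (c \in `]a, b[); last by rewrite wv //; exact: (arc_lt A).
move: cab; rewrite in_itv /= => /andP[ac cb].
have D x : x \in `[a, b] -> is_derive x 1 w (w1 x) by move=> xab; exact: (dw (sub Qa Qb xab)).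
have D1 x : x \in `[a, c] -> is_derive x 1 w (w1 x).
  by rewrite in_itv /= => /andP[x1 x2]; apply: D; rewrite in_itv /= x1 (le_trans x2) // ltW.
have D2 x : x \in `[c, b] -> is_derive x 1 w (w1 x).
  by rewrite in_itv /= => /andP[x1 x2]; apply: D; rewrite in_itv /= x2 (le_trans _ x1) // ltW.
have [x xac e] := mvt ac D1.
have [y ycb e'] := mvt cb D2.
have Qx : Q x by apply: (sub Qa Qc); exact: subset_itv_oo_cc.
have Qy : Q y by apply: (sub Qc Qb); exact: subset_itv_oo_cc.
have /andP[x1 x2] := w1_range Qx; have /andP[y1 y2] := w1_range Qy.
have /andP[a1 a2] := arc_lt A Qa; have /andP[b1 b2] := arc_lt A Qb.
rewrite (wv Qa na) in e; rewrite (wv Qb nb) in e'.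
have h1 : 0 < (c - a) * (1 + w1 x) by rewrite mulr_gt0; lra.
have h2 : 0 < (b - c) * (1 - w1 y) by rewrite mulr_gt0; lra.
by apply/andP; split; lra.
Qed.

Let A' := perturb_arc.

(** The profile whose conjugate is w - M: between v1 a and v1 b it is the
    conjugate of w - M, computed at the slope c such that w1 c = y. *)
Definition perturbed (y : R) : R :=
  if y \in `[v1 a, v1 b] then
    let c := xget a [set c | c \in `[a, b] /\ w1 c = y] in c * y - w c + M
  else g y.

Lemma perturbed_in c : c \in `[a, b] -> perturbed (w1 c) = c * w1 c - w c + M.
Proof.
move=> cab; have Qc := sub Qa Qb cab.
rewrite /perturbed ifT.
  case: xgetP => [d _ [/= dab e]|/(_ c) /=]; last by case.
  have -> // : d = c.
  have Qd := sub Qa Qb dab.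
  by apply/eqP; case: ltgtP => // h; [have := w1_incr Qd Qc h|have := w1_incr Qc Qd h]; rewrite e ltxx.
move: cab; rewrite !in_itv /= -(w1v1 Qa na) -(w1v1 Qb nb) => /andP[ac cb].
rewrite le_eqVlt in ac; rewrite le_eqVlt in cb.
apply/andP; split.
  by case/orP: ac => [/eqP <-//|h]; apply: ltW; exact: w1_incr.
by case/orP: cb => [/eqP <-//|h]; apply: ltW; exact: w1_incr.
Qed.

Lemma perturbed_ex y : y \in `[v1 a, v1 b] -> exists2 c, c \in `[a, b] & w1 c = y.
Proof.
rewrite in_itv /= => /andP[y1 y2].
have [||c cab e] := @IVT R w1 a b y (ltW ab).
- apply: continuous_in_subspaceT => c; rewrite inE /= => cab.
  by apply: derive_continuous (dw1 _); exact: (sub Qa Qb).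
- by rewrite !w1v1 // ge_min le_max y1 y2 orbT.
- by exists c.
Qed.

Lemma perturbed_out y : y \in `[-1, 1] -> y \notin `]v1 a, v1 b[ -> g y = perturbed y.
Proof.
move=> hy ny; have [yab|yab] := boolP (y \in `[v1 a, v1 b]); last by rewrite /perturbed (negbTE yab).
have [ya|ya] := eqVneq y (v1 a).
  rewrite ya -{2}(w1v1 Qa na) perturbed_in ?in_itv /= ?lexx ?ltW // wv // w1v1 //.
  exact: (contact_eq ct).
have [yb|yb] := eqVneq y (v1 b).
  rewrite yb -{2}(w1v1 Qb nb) perturbed_in ?in_itv /= ?lexx ?ltW // wv // w1v1 //.
  exact: (contact_eq ct).
by exfalso; move: ny yab; rewrite !in_itv /= !lt_neqAle (eq_sym (v1 a)) ya yb /= => /negP.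
Qed.

Lemma perturbed_contact : contact M lo hi perturbed w w1.
Proof.
split.
- move=> c Qc; have [cab|cab] := boolP (c \in `[a, b]); first exact: perturbed_in.
  have cab' : c \notin `]a, b[.
    by apply: contra cab; exact: subset_itv_oo_cc.
  rewrite w1v1 // wv // -perturbed_out ?(contact_eq ct) //.
    by have /andP[h1 h2] := arc_v1 A Qc; rewrite in_itv /= !ltW.
  move: cab; rewrite !in_itv /= !negb_and -!ltNge -!leNgt => /orP[h|h].
    by rewrite (ltW (arc_v1_incr A Qc Qa h)).
  by rewrite (ltW (arc_v1_incr A Qb Qc h)) orbT.
- move=> c y Qc hy; have [yab|yab] := boolP (y \in `[v1 a, v1 b]).
    have [d dab <-] := perturbed_ex yab.
    rewrite perturbed_in //; have := arc_tangent_le A' (sub Qa Qb dab) Qc; lra.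
  have e : perturbed y = g y by rewrite /perturbed (negbTE yab).
  rewrite e; have [cab|cab] := boolP (c \in `]a, b[); last by rewrite wv //; exact: (contact_le ct).
  move: cab; rewrite in_itv /= => /andP[ac cb].
  move: yab; rewrite in_itv /= negb_and -!ltNge => /orP[h|h].
    have h1 := arc_tangent_le A' Qa Qc; rewrite wv // w1v1 // in h1.
    have h2 := contact_le ct Qa hy.
    have : y * (c - a) <= v1 a * (c - a) by rewrite ler_pM2r ?subr_gt0 // ltW.
    lra.
  have h1 := arc_tangent_le A' Qb Qc; rewrite wv // w1v1 // in h1.
  have h2 := contact_le ct Qb hy.
  have : v1 b * (b - c) <= y * (b - c) by rewrite ler_pM2r ?subr_gt0 // ltW.
  lra.
Qed.

(** A contact point of nonzero slope is not a minimum of g: the profile has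
    nearby contact points, with slopes of the same sign, where it is strictly
    smaller. *)
Lemma contact_min_off x0 : g x0 = 0 -> 0 < a \/ b < 0 -> x0 \notin `[v1 a, v1 b].
Proof.
move=> gx0 ab0; apply/negP; rewrite in_itv /= => /andP[y1 y2].
have [||c cab e] := @IVT R v1 a b x0 (ltW ab).
- apply: continuous_in_subspaceT => c; rewrite inE /= => cab.
  by apply: derive_continuous (arc_d2 A _); exact: (sub Qa Qb).
- by rewrite ge_min le_max y1 y2 orbT.
have Qc := sub Qa Qb cab.
have [d [Qd dc]] : exists d, Q d /\ 0 < d * (v1 c - v1 d).
  move: cab (Qc) Qa Qb; rewrite !in_itv /= => /andP[ac cb] /andP[c1 c2] /andP[a1 a2] /andP[b1 b2].
  case: ab0 => h0.
  - pose d := (c + Num.max lo 0) / 2.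
    have h1 : lo <= Num.max lo 0 by rewrite le_max lexx.
    have h2 : 0 <= Num.max lo 0 by rewrite le_max lexx orbT.
    have h3 : Num.max lo 0 < c by rewrite gt_max c1 (lt_le_trans h0).
    have Qd : Q d by rewrite in_itv /= /d; apply/andP; split; lra.
    exists d; split; first by rewrite in_itv in Qd.
    rewrite mulr_gt0 // ?subr_gt0; first by rewrite /d; lra.
    by apply: (arc_v1_incr A) => //; rewrite ?in_itv /= ?c1 // /d; lra.
  - pose d := (c + Num.min hi 0) / 2.
    have h1 : Num.min hi 0 <= hi by rewrite ge_min lexx.
    have h2 : Num.min hi 0 <= 0 by rewrite ge_min lexx orbT.
    have h3 : c < Num.min hi 0 by rewrite lt_min c2 (le_lt_trans cb).
    have Qd : Q d by rewrite in_itv /= /d; apply/andP; split; lra.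
    exists d; split; first by rewrite in_itv in Qd.
    rewrite nmulr_rgt0 ?subr_lt0; last by rewrite /d; lra.
    by apply: (arc_v1_incr A) => //; rewrite ?in_itv /= ?c1 // /d; lra.
have hx0 : x0 \in `[-1, 1].
  by rewrite -e; have /andP[h1 h2] := arc_v1 A Qc; rewrite in_itv /= !ltW.
have := contact_le ct Qd hx0; rewrite gx0 -e.
have := contact_eq ct Qd.
have /(adm_bnd adm)/andP[] : v1 d \in `[-1, 1].
  by have /andP[h1 h2] := arc_v1 A Qd; rewrite in_itv /= !ltW.
lra.
Qed.

(** The upper bound M comes from convexity and the ends -1 and 1; the lower bound
    0 from the supporting lines at a or at b, according to the sign of the
    slopes; the minimum is attained where it was. *)
Lemma perturbed_admissible : 0 < a \/ b < 0 -> admissible M perturbed.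
Proof.
move=> ab0.
have hv c : Q c -> v1 c \in `[-1, 1].
  by move=> Qc; have /andP[h1 h2] := arc_v1 A Qc; rewrite in_itv /= !ltW.
have v1ab : v1 a < v1 b by exact: (arc_v1_incr A).
have cv3 : cvx3 perturbed.
  apply: (@cvx3_glue R g perturbed (v1 a) (v1 b)) => //.
  - by apply: cvx_cvx3; exact: (adm_cvx adm).
  - exact: perturbed_out.
  - exact: ltW.
  - exact: hv.
  - exact: hv.
  - move=> z /perturbed_ex[c cab <-]; exists c => y hy.
    have := contact_le perturbed_contact (sub Qa Qb cab) hy.
    rewrite perturbed_in //; lra.
have cv := cvx3_cvx cv3.
have end1 (y : R) : y \in `[-1, 1] -> y \notin `]v1 a, v1 b[ -> 0 <= perturbed y <= M.
  by move=> hy ny; rewrite -perturbed_out //; exact: (adm_bnd adm).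
split => //.
- move=> y hy; have [yab|yab] := boolP (y \in `]v1 a, v1 b[); last exact: end1.
  move: yab; rewrite in_itv /= => /andP[ya yb]; apply/andP; split.
    case: ab0 => h0.
    + have h1 := contact_le perturbed_contact Qa hy.
      have h2 := contact_eq ct Qa; have /andP[h3 _] := adm_bnd adm (hv _ Qa).
      rewrite wv // in h1.
      have : 0 < a * (y - v1 a) by rewrite mulr_gt0 // subr_gt0.
      lra.
    + have h1 := contact_le perturbed_contact Qb hy.
      have h2 := contact_eq ct Qb; have /andP[h3 _] := adm_bnd adm (hv _ Qb).
      rewrite wv // in h1.
      have : 0 < b * (y - v1 b) by rewrite nmulr_rgt0 // subr_lt0.
      lra.
  have m1 : (-1 : R) \in `[-1, 1] by rewrite in_itv /=; lra.
  have p1 : (1 : R) \in `[-1, 1] by rewrite in_itv /=; lra.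
  have n1 : -1 \notin `]v1 a, v1 b[.
    by rewrite in_itv /= negb_and -!leNgt; have /andP[h1 _] := arc_v1 A Qa; rewrite ltW.
  have n2 : 1 \notin `]v1 a, v1 b[.
    by rewrite in_itv /= negb_and -!leNgt; have /andP[_ h1] := arc_v1 A Qb; rewrite (ltW h1) orbT.
  have /andP[_ u1] := end1 _ m1 n1; have /andP[_ u2] := end1 _ p1 n2.
  have hy' : -1 <= y <= 1 by move: hy; rewrite in_itv.
  have := cv3 _ _ _ m1 p1 hy'.
  case/andP: hy' => y1 y2.
  have k1 : 0 <= 1 - y by lra.
  have k2 : 0 <= y - -1 by lra.
  have := ler_wpM2l k1 u1; have := ler_wpM2l k2 u2; lra.
- have [x0 hx0 gx0] := adm_min adm; exists x0 => //.
  rewrite -perturbed_out //; apply: contra (contact_min_off gx0 ab0).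
  exact: subset_itv_oo_cc.
Qed.

End perturb.

(** * Rules of differentiation and continuity *)

Section derive_rules.
Context {R : realType}.
Implicit Types (f g : R -> R) (x d e : R).

(** These rules state derivatives of explicit lambda-terms with the product
    of R, in the form produced by composing them. *)
Lemma d_eq f x d e : is_derive x 1 f d -> d = e -> is_derive x 1 f e.
Proof. by move=> h <-. Qed.

Lemma d_cst (k : R) x : is_derive x 1 (fun _ : R => k) 0.
Proof. exact: is_derive_cst. Qed.

Lemma d_id x : is_derive x 1 (fun y : R => y) 1.
Proof. exact: is_derive_id. Qed.

Lemma d_add f g x d e : is_derive x 1 f d -> is_derive x 1 g e ->
  is_derive x 1 (fun y => f y + g y) (d + e).
Proof. by move=> h1 h2; exact: is_deriveD. Qed.

Lemma d_sub f g x d e : is_derive x 1 f d -> is_derive x 1 g e ->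
  is_derive x 1 (fun y => f y - g y) (d - e).
Proof. by move=> h1 h2; exact: is_deriveB. Qed.

Lemma d_mul f g x d e : is_derive x 1 f d -> is_derive x 1 g e ->
  is_derive x 1 (fun y => f y * g y) (d * g x + f x * e).
Proof.
move=> h1 h2; apply: (d_eq (is_deriveM h1 h2)).
by rewrite /GRing.scale /= addrC mulrC.
Qed.

Lemma d_sqr f x d : is_derive x 1 f d -> is_derive x 1 (fun y => f y ^+ 2) (2 * f x * d).
Proof. by move=> h; apply: (d_eq (d_mul h h)); ring. Qed.

Lemma d_comp f g x d e : is_derive (g x) 1 f d -> is_derive x 1 g e ->
  is_derive x 1 (fun y => f (g y)) (d * e).
Proof.
move=> h1 h2; apply: (d_eq (is_derive1_comp h1 h2)).
by rewrite /GRing.scale /= mulrC.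
Qed.

Lemma d_inv f x d : is_derive x 1 f d -> f x != 0 ->
  is_derive x 1 (fun y => (f y)^-1) (- d / f x ^+ 2).
Proof.
move=> h n; apply: (d_eq (is_deriveV n h)).
by rewrite /GRing.scale /=; field.
Qed.

Lemma d_sqrt f x d : is_derive x 1 f d -> 0 < f x ->
  is_derive x 1 (fun y => Num.sqrt (f y)) (d / (2 * Num.sqrt (f x))).
Proof.
move=> h p; apply: (d_eq (d_comp (is_derive1_sqrt p) h)).
by rewrite mulrC.
Qed.

End derive_rules.

Section continuity_rules.
Context {R : realType} {T : topologicalType}.
Implicit Types (f g : T -> R) (x : T).

Lemma cont_cst (k : R) x : {for x, continuous (fun _ : T => k)}.
Proof. exact: cvg_cst. Qed.

Lemma cont_add f g x : {for x, continuous f} -> {for x, continuous g} ->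
  {for x, continuous (fun y => f y + g y)}.
Proof. by move=> h1 h2; exact: cvgD. Qed.

Lemma cont_sub f g x : {for x, continuous f} -> {for x, continuous g} ->
  {for x, continuous (fun y => f y - g y)}.
Proof. by move=> h1 h2; exact: cvgB. Qed.

Lemma cont_mul f g x : {for x, continuous f} -> {for x, continuous g} ->
  {for x, continuous (fun y => f y * g y)}.
Proof. by move=> h1 h2; exact: cvgM. Qed.

Lemma cont_sqr f x : {for x, continuous f} -> {for x, continuous (fun y => f y ^+ 2)}.
Proof. by move=> h; exact: cvgM. Qed.

Lemma cont_inv f x : f x != 0 -> {for x, continuous f} -> {for x, continuous (fun y => (f y)^-1)}.
Proof. by move=> h1 h2; exact: cvgV. Qed.

End continuity_rules.

Lemma cont_id {R : realType} (x : R) : {for x, continuous (fun y : R => y)}.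
Proof. exact: cvg_id. Qed.

(** * The Lagrangian *)

Section lagrangian.
Context {R : realType}.
Implicit Types (c V W : R).

Definition rad c V : R := Num.sqrt (V ^+ 2 - c ^+ 2).

(** V and W stand for v c and its derivative. *)
Definition lagr c V W : R :=
  (V - c * W) / (V * rad c V * (1 + V ^+ 2)) + 2 * W ^+ 2 * rad c V / (1 + V ^+ 2) ^+ 2.

(** Partial derivatives of [lagr] with respect to V and W, see [lagr_eps]. *)
Definition lagrV c V W : R :=
  - V / (rad c V ^+ 3 * (1 + V ^+ 2)) - 2 * V / (rad c V * (1 + V ^+ 2) ^+ 2)
  + c * W * (1 / (V ^+ 2 * rad c V * (1 + V ^+ 2)) + 1 / (rad c V ^+ 3 * (1 + V ^+ 2))
             + 2 / (rad c V * (1 + V ^+ 2) ^+ 2))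
  + 2 * W ^+ 2 * (V / (rad c V * (1 + V ^+ 2) ^+ 2) - 4 * V * rad c V / (1 + V ^+ 2) ^+ 3).

Definition lagrW c V W : R :=
  - c / (V * rad c V * (1 + V ^+ 2)) + 4 * W * rad c V / (1 + V ^+ 2) ^+ 2.

Lemma rad_facts c V : - V < c < V -> [/\ 0 < V, 0 < V ^+ 2 - c ^+ 2, 0 < rad c V & rad c V ^+ 2 = V ^+ 2 - c ^+ 2].
Proof.
move=> /andP[h1 h2]; have v0 : 0 < V by lra.
have p : 0 < V ^+ 2 - c ^+ 2 by have := mulr_gt0 (_ : 0 < V - c) (_ : 0 < V + c); nra.
by split; rewrite ?sqrtr_gt0 ?sqr_sqrtr // ltW.
Qed.

Lemma one_plus_sqr_gt0 V : 0 < 1 + V ^+ 2. Proof. by rewrite ltr_wpDr ?sqr_ge0. Qed.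

Lemma lagr_eps c x y x1 y1 e : - (x + e * y) < c < x + e * y ->
  is_derive e 1 (fun e => lagr c (x + e * y) (x1 + e * y1))
    (lagrV c (x + e * y) (x1 + e * y1) * y + lagrW c (x + e * y) (x1 + e * y1) * y1).
Proof.
move=> /rad_facts[v0 p q0 hq].
have dX : is_derive e 1 (fun e => x + e * y) y.
  by apply: (d_eq (d_add (d_cst x e) (d_mul (d_id e) (d_cst y e)))); ring.
have dX1 : is_derive e 1 (fun e => x1 + e * y1) y1.
  by apply: (d_eq (d_add (d_cst x1 e) (d_mul (d_id e) (d_cst y1 e)))); ring.
have dq : is_derive e 1 (fun e => rad c (x + e * y)) ((x + e * y) * y / rad c (x + e * y)).
  apply: (d_eq (d_sqrt (d_sub (d_sqr dX) (d_cst (c ^+ 2) e)) p)).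
  by rewrite -/(rad c _); field; rewrite gt_eqF.
have o := one_plus_sqr_gt0 (x + e * y).
have n1 : (x + e * y) * rad c (x + e * y) * (1 + (x + e * y) ^+ 2) != 0.
  by rewrite gt_eqF // !mulr_gt0.
have n2 : (1 + (x + e * y) ^+ 2) ^+ 2 != 0 by rewrite sqrf_eq0 gt_eqF.
have d1 := d_add (d_cst 1 e) (d_sqr dX).
have dd := d_add (d_mul (d_sub dX (d_mul (d_cst c e) dX1)) (d_inv (d_mul (d_mul dX dq) d1) n1))
  (d_mul (d_mul (d_mul (d_cst 2 e) (d_sqr dX1)) dq) (d_inv (d_sqr d1) n2)).
apply: (d_eq dd) => {dd}.
rewrite /lagrV /lagrW; move: (rad c (x + e * y)) q0 hq n1 n2 o {dq p} => q q0 hq n1 n2 o.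
set V := x + e * y in v0 hq n1 n2 o *; set W := x1 + e * y1.
field.
by rewrite !gt_eqF.
Qed.

End lagrangian.

(** * The Lagrangian along an arc *)

Section along_arc.
Context {R : realType}.
Variables (lo hi : R) (v v1 v2 : R -> R).
Hypothesis A : arc lo hi v v1 v2.
Local Notation Q := (fun c : R => c \in `]lo, hi[).

(** The part of the resistance of a strip that only depends on its two limiting
    rulings. *)
Definition boundary (v v1 : R -> R) (c : R) : R := v1 c * ordinate v c / (v c * (1 + v c ^+ 2)).

Lemma d_ordinate c : Q c -> is_derive c 1 (ordinate v) ((v c * v1 c - c) / ordinate v c).
Proof.
move=> Qc; have [v0 p q0 hq] := rad_facts (arc_lt A Qc).
apply: (d_eq (d_sqrt (d_sub (d_sqr (arc_d1 A Qc)) (d_sqr (d_id c))) p)).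
by rewrite -/(ordinate v c); field; rewrite gt_eqF // (ordinate_gt0 A).
Qed.

(** With k = c / v and s = q / v the area has derivative k' / s + (v1 s)'.  The
    second summand times the density is integrated by parts, which removes
    the second derivative of v. *)
Lemma strip_resistance_boundary (M : R) (g : R -> R) a c : admissible M g -> contact M lo hi g v v1 ->
  Q a -> Q c -> a < c ->
  is_derive c 1 (fun c => strip_resistance v v1 M g a c - boundary v v1 c) (lagr c (v c) (v1 c)).
Proof.
move=> adm ct Qa Qc ac.
have q0 := ordinate_gt0 A Qc; have hq := ordinate_sqr A Qc; have v0 := arc_pos_v A Qc.
have dv := arc_d1 A Qc; have dv1 := arc_d2 A Qc; have dq := d_ordinate Qc.
have vn : v c != 0 by rewrite gt_eqF.
have o := one_plus_sqr_gt0 (v c).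
have qn : ordinate v c != 0 by rewrite gt_eqF.
have dk := d_mul (d_id c) (d_inv dv vn).
have ds := d_mul dq (d_inv dv vn).
have k1 : -1 < c / v c < 1.
  have /andP[h1 h2] := arc_lt A Qc.
  by rewrite ltr_pdivrMr // ltr_pdivlMr // mul1r mulN1r h1.
have dcap := @d_comp R (@cap_area R) (fun y => y / v y) c _ _ (is_derive_cap_area k1) dk.
have dS := d_add dcap (d_mul ds (d_sub dv1 dk)).
have dG := strip_resistance_derive A adm ct Qa Qc ac dS.
have nb : v c * (1 + v c ^+ 2) != 0 by rewrite gt_eqF // mulr_gt0.
have db := d_mul (d_mul dv1 dq) (d_inv (d_mul dv (d_add (d_cst 1 c) (d_sqr dv))) nb).
apply: (d_eq (d_sub dG db)) => {dG db dS dcap dk ds}.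
have -> : Num.sqrt (1 - (c / v c) ^+ 2) = ordinate v c / v c.
  have -> : 1 - (c / v c) ^+ 2 = (ordinate v c / v c) ^+ 2.
    by rewrite -(arc_unit A Qc) addrC addKr.
  by rewrite sqrtr_sqr ger0_norm // divr_ge0 // ltW.
rewrite /lagr /density -/(ordinate v c).
have -> : rad c (v c) = ordinate v c by [].
move: (ordinate v c) q0 hq qn {dq} => q q0 hq qn.
move: (v c) (v1 c) (v2 c) v0 hq vn o nb {dv dv1 k1} => V W Z v0 hq vn o nb.
apply/eqP; rewrite -subr_eq0; apply/eqP.
transitivity ((q ^+ 2 - (V ^+ 2 - c ^+ 2)) / (V ^+ 2 * q * (1 + V ^+ 2))).
  by field; rewrite vn qn gt_eqF.
by rewrite hq subrr mul0r.
Qed.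

Definition ode_rhs (v v1 : R -> R) (c : R) : R :=
  (v c - c * v1 c) / (c ^+ 2 - v c ^+ 2) + 2 * v c * v1 c ^+ 2 / (v c ^+ 2 + 1)
  + v c * (v1 c ^+ 2 - 1) / (2 * (c ^+ 2 - v c ^+ 2)).

(** The Euler expression of [lagr] along v, in factored form; [lagrW_along]
    identifies it. *)
Definition euler (v v1 v2 : R -> R) (c : R) : R :=
  - 4 * ordinate v c / (1 + v c ^+ 2) ^+ 2 * (v2 c - ode_rhs v v1 c).

Lemma lagrW_along c : Q c ->
  is_derive c 1 (fun c => lagrW c (v c) (v1 c)) (lagrV c (v c) (v1 c) - euler v v1 v2 c).
Proof.
move=> Qc; have q0 := ordinate_gt0 A Qc; have hq := ordinate_sqr A Qc; have v0 := arc_pos_v A Qc.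
have dv := arc_d1 A Qc; have dv1 := arc_d2 A Qc; have dq := d_ordinate Qc.
have vn : v c != 0 by rewrite gt_eqF.
have o := one_plus_sqr_gt0 (v c).
have qn : ordinate v c != 0 by rewrite gt_eqF.
have n1 : v c * ordinate v c * (1 + v c ^+ 2) != 0 by rewrite gt_eqF // !mulr_gt0.
have n2 : (1 + v c ^+ 2) ^+ 2 != 0 by rewrite sqrf_eq0 gt_eqF.
have d1 := d_add (d_cst 1 c) (d_sqr dv).
have dd := d_add (d_mul (d_sub (d_cst 0 c) (d_id c)) (d_inv (d_mul (d_mul dv dq) d1) n1))
  (d_mul (d_mul (d_mul (d_cst 4 c) dv1) dq) (d_inv (d_sqr d1) n2)).
have e : (fun c => lagrW c (v c) (v1 c)) = (fun c => (0 - c) * (v c * ordinate v c * (1 + v c ^+ 2))^-1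
  + 4 * v1 c * ordinate v c * ((1 + v c ^+ 2) ^+ 2)^-1).
  by apply/funext => y; rewrite /lagrW sub0r.
rewrite e; apply: (d_eq dd) => {dd e}.
rewrite /euler /ode_rhs /lagrV.
have -> : rad c (v c) = ordinate v c by [].
have -> : c ^+ 2 - v c ^+ 2 = - ordinate v c ^+ 2 by rewrite hq opprB.
move: (ordinate v c) q0 hq qn n1 {dq} => q q0 hq qn n1.
move: (v c) (v1 c) (v2 c) v0 hq vn o n1 n2 {dv dv1 d1} => V W Z v0 hq vn o n1 n2.
have on : 1 + V ^+ 2 != 0 by rewrite gt_eqF.
have on' : V ^+ 2 + 1 != 0 by rewrite addrC.
apply/eqP; rewrite -subr_eq0; apply/eqP.
transitivity (((V ^+ 2 - c ^+ 2) - q ^+ 2) / (V * q ^+ 3 * (1 + V ^+ 2))).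
  by field; rewrite vn qn on.
by rewrite hq subrr mul0r.
Qed.

Lemma euler_cont c : Q c -> {for c, continuous (euler v v1 v2)}.
Proof.
move=> Qc.
have cv := derive_continuous (arc_d1 A Qc).
have cv1 := derive_continuous (arc_d2 A Qc).
have cv2 := arc_cont A Qc.
have cq := ordinate_cont A Qc.
have q0 := ordinate_gt0 A Qc; have hq := ordinate_sqr A Qc.
have n1 : c ^+ 2 - v c ^+ 2 != 0.
  by rewrite -oppr_eq0 opprB -hq sqrf_eq0 gt_eqF.
have o := one_plus_sqr_gt0 (v c).
have ci := @cont_id R c; have ck k := @cont_cst R R k c.
apply: cont_mul.
  apply: cont_mul; first exact: cont_mul.
  apply: cont_inv; first by rewrite sqrf_eq0 gt_eqF.
  by apply: (@cont_sqr _ _ (fun c => 1 + v c ^+ 2)); apply: cont_add => //; exact: cont_sqr.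
apply: cont_sub => //; apply: cont_add; first apply: cont_add.
- apply: cont_mul; first by apply: cont_sub => //; exact: cont_mul.
  by apply: cont_inv => //; apply: cont_sub; exact: cont_sqr.
- apply: cont_mul; first by apply: cont_mul; [exact: cont_mul|exact: cont_sqr].
  apply: cont_inv; first by rewrite addrC gt_eqF.
  by apply: cont_add => //; exact: cont_sqr.
- apply: cont_mul; first by apply: cont_mul => //; apply: cont_sub => //; exact: cont_sqr.
  apply: cont_inv; first by rewrite mulf_neq0 // pnatr_eq0.
  by apply: cont_mul => //; apply: cont_sub; exact: cont_sqr.
Qed.

Lemma euler_eq0 c : Q c -> euler v v1 v2 c = 0 -> v2 c = ode_rhs v v1 c.
Proof.
move=> Qc /eqP; rewrite mulf_eq0 subr_eq0 => /orP[|/eqP //].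
rewrite mulf_eq0 invr_eq0 sqrf_eq0 (gt_eqF (one_plus_sqr_gt0 _)) orbF mulf_eq0.
by rewrite (gt_eqF (ordinate_gt0 A Qc)) orbF oppr_eq0 pnatr_eq0.
Qed.

End along_arc.

(** * A bump of class C2 *)

Section bump.
Context {R : realType}.

Lemma d_near_eq (f g : R -> R) (x d : R) :
  (\forall y \near x, f y = g y) -> is_derive x 1 f d -> is_derive x 1 g d.
Proof. by move=> h1 h2; exact: (near_eq_is_derive h1 h2). Qed.

(** The square and the cube of the positive part of y are polynomials in y and
    y |y|, so this derivative gives theirs. *)
Lemma derive_mul_norm (y : R) : is_derive y 1 (fun y : R => y * `|y|) (2 * `|y|).
Proof.
have [y0|y0|->] := ltgtP y 0.
- apply: (@d_near_eq (fun y => 0 - y ^+ 2)).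
    near=> z; have z0 : z < 0 by near: z; exact: lt_nbhsl.
    by rewrite ltr0_norm // mulrN sub0r.
  by apply: (d_eq (d_sub (d_cst 0 y) (d_sqr (d_id y)))); rewrite ltr0_norm //; ring.
- apply: (@d_near_eq (fun y => y ^+ 2)).
    near=> z; have z0 : 0 < z by near: z; exact: lt_nbhsr.
    by rewrite gtr0_norm.
  by apply: (d_eq (d_sqr (d_id y))); rewrite gtr0_norm //; ring.
- rewrite normr0 mulr0.
  suff K : (fun h : R => h^-1 *: (((fun y : R => y * `|y|) \o shift 0) (h *: (1 : R)) - 0 * `|0 : R|)) @ 0^' --> (0 : R).
    by apply: DeriveDef; [apply/cvg_ex; exists 0|exact: cvg_lim K].
  apply/cvgrPdist_le => e e0; near=> h.
  have hn : h != 0 by near: h; exact: nbhs_dnbhs_neq.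
  have he : `|h| <= e.
    near: h; apply: nbhs_dnbhs; apply: filterS (nbhsx_ballx (0 : R) e e0) => h.
    by rewrite /ball /= sub0r normrN => /ltW.
  rewrite /GRing.scale /= mulr1 addr0 mul0r subr0 mulKf // sub0r normrN normr_id //.
Unshelve. all: by end_near. Qed.

Definition pos_part (y : R) : R := (y + `|y|) / 2.

Lemma pos_part_id y : 0 <= y -> pos_part y = y.
Proof. by move=> h; rewrite /pos_part ger0_norm //; field. Qed.

Lemma pos_part_eq0 y : y <= 0 -> pos_part y = 0.
Proof. by move=> h; rewrite /pos_part ler0_norm // subrr mul0r. Qed.

Lemma pos_part_ge0 y : 0 <= pos_part y.
Proof. by have [h|/ltW h] := leP 0 y; [rewrite pos_part_id|rewrite pos_part_eq0]. Qed.

Lemma mul_pos_part y : y * pos_part y = pos_part y ^+ 2.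
Proof. by have [h|/ltW h] := leP 0 y; [rewrite pos_part_id|rewrite pos_part_eq0 // expr0n mulr0]. Qed.

Lemma pos_part_cont (y : R) : {for y, continuous pos_part}.
Proof.
apply: cont_mul; last exact: cont_cst.
by apply: cont_add; [exact: cont_id|exact: norm_continuous].
Qed.

Lemma d_pos_part2 (y : R) : is_derive y 1 (fun y => pos_part y ^+ 2) (2 * pos_part y).
Proof.
have e : (fun y => pos_part y ^+ 2) = (fun y => (y ^+ 2 + y * `|y|) * 2^-1).
  apply/funext => z; rewrite /pos_part.
  transitivity ((z ^+ 2 + `|z| ^+ 2 + 2 * (z * `|z|)) / 4); first by field.
  by rewrite real_normK ?num_real //; field.
rewrite e; apply: (d_eq (d_mul (d_add (d_sqr (d_id y)) (derive_mul_norm y)) (d_cst 2^-1 y))).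
by rewrite /pos_part; field.
Qed.

Lemma d_pos_part3 (y : R) : is_derive y 1 (fun y => pos_part y ^+ 3) (3 * pos_part y ^+ 2).
Proof.
have e : (fun y => pos_part y ^+ 3) = (fun y => y * pos_part y ^+ 2).
  by apply/funext => z; rewrite [in RHS]expr2 mulrA mul_pos_part -exprSr.
rewrite e; apply: (d_eq (d_mul (d_id y) (d_pos_part2 y))).
rewrite mul1r mulrCA mul_pos_part; ring.
Qed.

Variables (m r : R).
Hypothesis r0 : 0 < r.

Definition bump_arg (c : R) : R := 1 - ((c - m) / r) ^+ 2.
(** Cubing the positive part makes the bump twice continuously differentiable. *)
Definition bump (c : R) : R := pos_part (bump_arg c) ^+ 3.
Definition bump1 (c : R) : R := 3 * pos_part (bump_arg c) ^+ 2 * (- 2 * (c - m) / r ^+ 2).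
Definition bump2 (c : R) : R := 
  6 * pos_part (bump_arg c) * (- 2 * (c - m) / r ^+ 2) ^+ 2 + 3 * pos_part (bump_arg c) ^+ 2 * (- 2 / r ^+ 2).
(** A primitive of [bump] on its support; its increment, 32 r / 35, measures the
    first variation. *)
Definition bump_prim (c : R) : R :=
  let x := (c - m) / r in r * (x * (1 + x ^+ 2 * (x ^+ 2 * (3 / 5 - x ^+ 2 / 7) - 1))).

Let rn : r != 0. Proof. by rewrite gt_eqF. Qed.

Lemma d_bump_arg (c : R) : is_derive c 1 bump_arg (- 2 * (c - m) / r ^+ 2).
Proof.
apply: (d_eq (d_sub (d_cst 1 c) (d_sqr (d_mul (d_sub (d_id c) (d_cst m c)) (d_cst r^-1 c))))).
by field.
Qed.

Lemma d_bump (c : R) : is_derive c 1 bump (bump1 c).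
Proof. exact: (@d_comp R (fun y => pos_part y ^+ 3) bump_arg c _ _ (d_pos_part3 _) (d_bump_arg c)). Qed.

Lemma d_bump1 (c : R) : is_derive c 1 bump1 (bump2 c).
Proof.
have d2 := @d_comp R (fun y => pos_part y ^+ 2) bump_arg c _ _ (d_pos_part2 _) (d_bump_arg c).
have d3 := d_mul (d_mul (d_cst (- 2) c) (d_sub (d_id c) (d_cst m c))) (d_cst (r ^+ 2)^-1 c).
apply: (d_eq (d_mul (d_mul (d_cst 3 c) d2) d3)).
by rewrite /bump2; field.
Qed.

Lemma bump_arg_cont (c : R) : {for c, continuous bump_arg}.
Proof. exact: derive_continuous (d_bump_arg c). Qed.

Lemma pos_part_arg_cont (c : R) : {for c, continuous (fun c => pos_part (bump_arg c))}.
Proof. by apply: (@continuous_comp _ _ _ bump_arg pos_part); [exact: bump_arg_cont|exact: pos_part_cont]. Qed.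

Lemma bump2_cont (c : R) : {for c, continuous bump2}.
Proof.
have k1 := @pos_part_arg_cont c.
have k2 : {for c, continuous (fun c : R => - 2 * (c - m) / r ^+ 2)}.
  by apply: cont_mul; [apply: cont_mul; [exact: cont_cst|apply: cont_sub; [exact: cont_id|exact: cont_cst]]|exact: cont_cst].
apply: cont_add; apply: cont_mul.
- by apply: cont_mul => //; exact: cont_cst.
- exact: cont_sqr.
- by apply: cont_mul; [exact: cont_cst|exact: cont_sqr].
- exact: cont_cst.
Qed.

Lemma bump_arg_out c : c \notin `]m - r, m + r[ -> bump_arg c <= 0.
Proof.
rewrite in_itv /= negb_and -!leNgt => h.
rewrite /bump_arg subr_le0 expr_div_n ler_pdivlMr ?exprn_gt0 // mul1r.
case/orP: h => h.
  have h1 : 0 <= m - c - r by lra.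
  have h2 : 0 <= m - c + r by have := r0; lra.
  have := mulr_ge0 h1 h2; rewrite !expr2; lra.
have h1 : 0 <= c - m - r by lra.
have h2 : 0 <= c - m + r by have := r0; lra.
have := mulr_ge0 h1 h2; rewrite !expr2; lra.
Qed.

Lemma bump_arg_in c : c \in `[m - r, m + r] -> 0 <= bump_arg c.
Proof.
rewrite in_itv /= => /andP[h1 h2].
rewrite /bump_arg subr_ge0 expr_div_n ler_pdivrMr ?exprn_gt0 // mul1r.
have k1 : 0 <= r - (c - m) by lra.
have k2 : 0 <= r + (c - m) by lra.
have := mulr_ge0 k1 k2; rewrite !expr2; lra.
Qed.

Lemma bump_out c : c \notin `]m - r, m + r[ -> [/\ bump c = 0, bump1 c = 0 & bump2 c = 0].
Proof.
move=> /bump_arg_out h; rewrite /bump /bump1 /bump2 pos_part_eq0 //.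
by split; rewrite ?expr0n /= ?mulr0 ?mul0r ?addr0.
Qed.

Lemma bump_ge0 c : 0 <= bump c.
Proof. by rewrite exprn_ge0 ?pos_part_ge0. Qed.

Lemma d_bump_prim (c : R) : c \in `[m - r, m + r] -> is_derive c 1 bump_prim (bump c).
Proof.
move=> /bump_arg_in h.
have dx := d_mul (d_sub (d_id c) (d_cst m c)) (d_cst r^-1 c).
have dx2 := d_sqr dx.
apply: (d_eq (d_mul (d_cst r c) (d_mul dx (d_add (d_cst 1 c) (d_mul dx2
  (d_sub (d_mul dx2 (d_sub (d_cst (3 / 5) c) (d_mul dx2 (d_cst 7^-1 c)))) (d_cst 1 c))))))).
by rewrite /bump pos_part_id // /bump_arg; field.
Qed.

Lemma bump_prim_diff : bump_prim (m + r) - bump_prim (m - r) = 32 / 35 * r.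
Proof. by rewrite /bump_prim; field. Qed.

(** Tube lemma: by compactness a property that holds near every (0, c) holds for
    all small e uniformly in c. *)
Lemma near_forall_segment (P : R -> R -> Prop) (a b : R) :
  (forall c, c \in `[a, b] -> \forall p \near ((0, c) : R * R), P p.1 p.2) ->
  \forall e \near (0 : R), forall c, c \in `[a, b] -> P e c.
Proof.
move=> H; have /compact_near_coveringP K := @segment_compact R a b.
apply: (K R (nbhs (0 : R)) (fun e c => P e c)) => c cab.
have [[/= X Y] [nX nY] XY] := H c cab.
by exists (Y, X) => //= -[c' e] [/= Yc Xe]; exact: (XY (e, c')).
Qed.

Lemma mvt_from0 (f df : R -> R) (e : R) : (forall x : R, `|x| <= `|e| -> is_derive x 1 f (df x)) ->
  exists2 x, `|x| <= `|e| & f e - f 0 = df x * e.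
Proof.
move=> H; have [e0|e0|->] := ltgtP e 0; last first.
- by exists 0; rewrite ?normr0 // subrr mulr0.
- have D (x : R) : x \in `[0, e] -> is_derive x 1 f (df x).
    by rewrite in_itv /= => /andP[h1 h2]; apply: H; rewrite !ger0_norm // ltW.
  have [x + ->] := mvt e0 D; rewrite subr0 in_itv /= => /andP[h1 h2].
  by exists x => //; rewrite !ger0_norm ltW.
- have D (x : R) : x \in `[e, 0] -> is_derive x 1 f (df x).
    by rewrite in_itv /= => /andP[h1 h2]; apply: H; rewrite !ler0_norm ?lerN2 // ltW.
  have [x + E] := mvt e0 D; rewrite in_itv /= => /andP[h1 h2].
  by exists x; [rewrite !ler0_norm ?lerN2 ltW|lra].
Qed.

End bump.

Section lagr_cont.
Context {R : realType} {T : topologicalType}.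

Lemma rad_cont (c V : T -> R) x : {for x, continuous c} -> {for x, continuous V} ->
  {for x, continuous (fun y => rad (c y) (V y))}.
Proof.
move=> hc hV; apply: (@continuous_comp _ _ _ (fun y => V y ^+ 2 - c y ^+ 2) Num.sqrt); last exact: sqrt_continuous.
by apply: cont_sub; exact: cont_sqr.
Qed.

Lemma cont_cube (f : T -> R) x : {for x, continuous f} -> {for x, continuous (fun y => f y ^+ 3)}.
Proof. by move=> h; exact: (cont_mul h (cont_sqr h)). Qed.

Lemma lagrV_cont (c V W : T -> R) x : {for x, continuous c} -> {for x, continuous V} ->
  {for x, continuous W} -> - V x < c x < V x ->
  {for x, continuous (fun y => lagrV (c y) (V y) (W y))}.
Proof.
move=> hc hV hW /rad_facts[v0 _ q0 _].
have hq := rad_cont hc hV; have kk (k : R) := @cont_cst R T k x.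
have o := one_plus_sqr_gt0 (V x).
have ho : {for x, continuous (fun y => 1 + V y ^+ 2)} by apply: cont_add => //; exact: cont_sqr.
have i1 : {for x, continuous (fun y => (rad (c y) (V y) ^+ 3 * (1 + V y ^+ 2))^-1)}.
  by apply: cont_inv; [rewrite gt_eqF // mulr_gt0 // exprn_gt0|apply: cont_mul => //; exact: cont_cube].
have i2 : {for x, continuous (fun y => (rad (c y) (V y) * (1 + V y ^+ 2) ^+ 2)^-1)}.
  by apply: cont_inv; [rewrite gt_eqF // mulr_gt0 // exprn_gt0|apply: cont_mul => //; exact: cont_sqr].
have i3 : {for x, continuous (fun y => (V y ^+ 2 * rad (c y) (V y) * (1 + V y ^+ 2))^-1)}.
  apply: cont_inv; first by rewrite gt_eqF // !mulr_gt0 // exprn_gt0.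
  by apply: cont_mul => //; apply: cont_mul => //; exact: cont_sqr.
have i4 : {for x, continuous (fun y => ((1 + V y ^+ 2) ^+ 3)^-1)}.
  by apply: cont_inv; [rewrite gt_eqF // exprn_gt0|exact: cont_cube].
have hN : {for x, continuous (fun y => - V y)} by exact: continuousN.
apply: cont_add; first apply: cont_add; first apply: cont_sub.
- exact: cont_mul.
- by apply: cont_mul => //; exact: cont_mul.
- apply: cont_mul; first exact: cont_mul.
  by apply: cont_add; [apply: cont_add; exact: cont_mul|exact: cont_mul].
- apply: cont_mul; first by apply: cont_mul => //; exact: cont_sqr.
  apply: cont_sub; first exact: cont_mul.
  by apply: cont_mul => //; apply: cont_mul => //; exact: cont_mul.
Qed.

Lemma lagrW_cont (c V W : T -> R) x : {for x, continuous c} -> {for x, continuous V} ->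
  {for x, continuous W} -> - V x < c x < V x ->
  {for x, continuous (fun y => lagrW (c y) (V y) (W y))}.
Proof.
move=> hc hV hW /rad_facts[v0 _ q0 _].
have hq := rad_cont hc hV; have kk (k : R) := @cont_cst R T k x.
have o := one_plus_sqr_gt0 (V x).
have ho : {for x, continuous (fun y => 1 + V y ^+ 2)} by apply: cont_add => //; exact: cont_sqr.
have hN : {for x, continuous (fun y => - c y)} by exact: continuousN.
apply: cont_add; apply: cont_mul => //.
- apply: cont_inv; first by rewrite gt_eqF // !mulr_gt0.
  by apply: cont_mul => //; exact: cont_mul.
- by apply: cont_mul => //; exact: cont_mul.
- by apply: cont_inv; [rewrite gt_eqF // exprn_gt0|exact: cont_sqr].
Qed.

End lagr_cont.

(** * The first variation *)

Section arithmetic.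
Context {R : realType}.

Lemma mid_between (x y : R) : x < y -> x < (x + y) / 2 < y.
Proof. by move=> h; apply/andP; split; lra. Qed.

(** With e = - s t the term linear in e is at most - t e0 times the bump p, and
    the error of the linearization is at most t e0 / 5. *)
Lemma variation_sign (e t s E e0 D1 D0 p p1 L1 L0 LV LW : R) :
  L1 - L0 = D1 * e -> D0 = LV * p + LW * p1 -> `|D1 - D0| <= e0 / 5 ->
  e = - s * t -> `|e| = t -> 0 < t -> e0 <= s * E -> 0 <= p ->
  L1 - L0 - e * ((LV - E) * p + LW * p1) - t * (e0 / 5 - e0 * p) <= 0.
Proof.
move=> hL hD hd he ne t0 hE p0.
have -> : L1 - L0 - e * ((LV - E) * p + LW * p1) - t * (e0 / 5 - e0 * p) =
    e * (D1 - D0) - t * (e0 / 5) - t * (s * E - e0) * p.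
  by rewrite hL hD he; ring.
have k1 : e * (D1 - D0) <= t * (e0 / 5).
  by apply: le_trans (ler_norm _) _; rewrite normrM ne ler_pM2l.
have k2 : 0 <= t * (s * E - e0) * p by rewrite !mulr_ge0 ?subr_ge0 // ltW.
lra.
Qed.

(** The fraction 1/5 is small enough: over a bump of radius r the error adds up
    to 2 r e0 t / 5, less than the gain 32 r e0 t / 35. *)
Lemma variation_total (I0 I1 G1b G1a G0b G0a Bb Ba Lb La e t e0 Pb Pa x y r : R) :
  G0b - G0a = I0 -> G1b - G1a = I1 -> I0 <= I1 -> Pb - Pa = 32 / 35 * r -> y - x = 2 * r -> 0 < t * (e0 * r) ->
  (G1b - Bb - (G0b - Bb) - e * (Lb * 0) - t * (e0 / 5 * y - e0 * Pb))
  - (G1a - Ba - (G0a - Ba) - e * (La * 0) - t * (e0 / 5 * x - e0 * Pa)) <= 0 -> False.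
Proof.
move=> <- <- h1 h2 h3 h4.
have -> : Pb = Pa + 32 / 35 * r by rewrite -h2 addrC subrK.
have -> : y = x + 2 * r by rewrite -h3 addrC subrK.
lra.
Qed.

End arithmetic.

Section variation.
Context {R : realType}.
Variables (lo hi : R) (v v1 v2 : R -> R).
Hypothesis A : arc lo hi v v1 v2.
Local Notation Q := (fun c : R => c \in `]lo, hi[).
Variables (M : R) (g : R -> R).
Hypothesis adm : admissible M g.
Hypothesis ct : contact M lo hi g v v1.
Let U := generated M (axis_fun g).
Hypothesis lscU : lower_semicontinuous U.
Hypothesis opt : forall h, admissible M h -> lower_semicontinuous (generated M (axis_fun h)) ->
  (J U <= J (generated M (axis_fun h)))%E.

Section one_bump.
Variables (m r : R).
Hypotheses (r0 : 0 < r) (Qa : Q (m - r)) (Qb : Q (m + r)).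
Hypothesis off0 : 0 < m - r \/ m + r < 0.
Let a := m - r.
Let b := m + r.
Local Notation phi := (bump m r).
Local Notation phi1 := (bump1 m r).
Local Notation phi2 := (bump2 m r).
Let w e c := v c + e * phi c.
Let w1 e c := v1 c + e * phi1 c.
Let w2 e c := v2 c + e * phi2 c.

Let ab : a < b. Proof. by rewrite /a /b; have := r0; lra. Qed.

Let dw e c : Q c -> is_derive c 1 (w e) (w1 e c).
Proof.
move=> Qc; apply: (d_eq (d_add (arc_d1 A Qc) (d_mul (d_cst e c) (d_bump m r0 c)))).
by rewrite /w1; ring.
Qed.

Let dw1 e c : Q c -> is_derive c 1 (w1 e) (w2 e c).
Proof.
move=> Qc; apply: (d_eq (d_add (arc_d2 A Qc) (d_mul (d_cst e c) (d_bump1 m r0 c)))).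
by rewrite /w2; ring.
Qed.

Let w2_cont e c : Q c -> {for c, continuous (w2 e)}.
Proof.
move=> Qc; apply: cont_add; first exact: (arc_cont A Qc).
by apply: cont_mul; [exact: cont_cst|exact: (bump2_cont r0)].
Qed.

Let w_out e c : Q c -> c \notin `]a, b[ -> w e c = v c.
Proof. by move=> _ /(bump_out r0)[h _ _]; rewrite /w h mulr0 addr0. Qed.

Let w1_out e c : Q c -> c \notin `]a, b[ -> w1 e c = v1 c.
Proof. by move=> _ /(bump_out r0)[_ h _]; rewrite /w1 h mulr0 addr0. Qed.

Let near_pos : \forall e \near (0 : R), forall c, Q c -> 0 < w2 e c.
Proof.
have T : \forall e \near (0 : R), forall c, c \in `[a, b] -> 0 < w2 e c.
  apply: near_forall_segment => c cab; have Qc : Q c by exact: (arc_sub Qa Qb).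
  pose F (p : R * R) := v2 p.2 + p.1 * phi2 p.2.
  have cF : {for (0, c), continuous F}.
    apply: cont_add.
      by apply: (@continuous_comp _ _ _ snd v2); [exact: snd_cont|exact: (arc_cont A Qc)].
    apply: cont_mul; first exact: fst_cont.
    by apply: (@continuous_comp _ _ _ snd phi2); [exact: snd_cont|exact: (bump2_cont r0)].
  apply: (near_gt cF); rewrite /F /= mul0r addr0; exact: (arc_pos A Qc).
apply: filterS T => e H c Qc; have [cab|cab] := boolP (c \in `[a, b]); first exact: H.
have cab' : c \notin `]a, b[ by apply: contra cab; exact: subset_itv_oo_cc.
have [_ _ h] := bump_out r0 cab'.
by rewrite /w2 h mulr0 addr0; exact: (arc_pos A Qc).
Qed.

Definition first_variation (e c : R) : R :=
  lagrV c (w e c) (w1 e c) * phi c + lagrW c (w e c) (w1 e c) * phi1 c.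

Let near_var (eta : R) : 0 < eta ->
  \forall e \near (0 : R), forall c, c \in `[a, b] ->
    `|first_variation e c - first_variation 0 c| <= eta.
Proof.
move=> eta0; apply: near_forall_segment => c cab; have Qc : Q c by exact: (arc_sub Qa Qb).
pose F (p : R * R) := first_variation p.1 p.2.
have cv2 (f : R -> R) : {for c, continuous f} ->
    {for ((0, c) : R * R), continuous (fun p : R * R => f p.2)}.
  by move=> h; apply: (@continuous_comp _ _ _ snd f); [exact: snd_cont|exact: h].
have cphi := cv2 phi (derive_continuous (d_bump m r0 c)).
have cphi1 := cv2 phi1 (derive_continuous (d_bump1 m r0 c)).
have cV : {for ((0, c) : R * R), continuous (fun p : R * R => w p.1 p.2)}.
  apply: cont_add; first exact: cv2 (derive_continuous (arc_d1 A Qc)).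
  by apply: cont_mul; [exact: fst_cont|exact: cphi].
have cW : {for ((0, c) : R * R), continuous (fun p : R * R => w1 p.1 p.2)}.
  apply: cont_add; first exact: cv2 (derive_continuous (arc_d2 A Qc)).
  by apply: cont_mul; [exact: fst_cont|exact: cphi1].
have bd : - w 0 c < c < w 0 c by rewrite /w mul0r addr0; exact: (arc_lt A Qc).
have cF : {for ((0, c) : R * R), continuous F}.
  have c2 := @snd_cont R (0, c).
  by apply: cont_add; [exact: cont_mul (lagrV_cont c2 cV cW bd) cphi|exact: cont_mul (lagrW_cont c2 cV cW bd) cphi1].
have h2 : 0 < eta / 2 by rewrite divr_gt0.
have n1 : \forall p \near ((0, c) : R * R), `|F (0, c) - F p| <= eta / 2.
  by have /cvgrPdist_le := cF; apply.
have cf0 : {for c, continuous (first_variation 0)}.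
  have k0 := @cont_id R c.
  have cV0 := derive_continuous (dw 0 Qc); have cW0 := derive_continuous (dw1 0 Qc).
  apply: cont_add; [apply: cont_mul (lagrV_cont k0 cV0 cW0 bd) _|apply: cont_mul (lagrW_cont k0 cV0 cW0 bd) _].
    exact: derive_continuous (d_bump m r0 c).
  exact: derive_continuous (d_bump1 m r0 c).
have cF0 := cv2 _ cf0.
have n2 : \forall p \near ((0, c) : R * R), `|F (0, c) - F (0, p.2)| <= eta / 2.
  by have /cvgrPdist_le := cF0; apply.
move: n1 n2; apply: filterS2 => -[e c'] /=; rewrite /F /= => k1 k2.
move: k1 k2; rewrite !ler_norml => /andP[? ?] /andP[? ?]; apply/andP; split; lra.
Qed.

(** The function Y below is the gain of resistance accumulated between the ruling a
    and the ruling c, made comparable with the first variation by subtracting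
    the terms that cancel at a and b.  It is nonincreasing, while optimality
    bounds its total increment from below. *)
Lemma bump_contradiction (s e0 : R) : 0 < e0 -> s = 1 \/ s = -1 ->
  (forall c, c \in `[a, b] -> e0 <= s * euler v v1 v2 c) -> False.
Proof.
move=> e00 hs hE.
have eta0 : 0 < e0 / 5 by rewrite divr_gt0.
have nn : \forall x \near (0 : R), (forall c, Q c -> 0 < w2 x c) /\
    forall c, c \in `[a, b] -> `|first_variation x c - first_variation 0 c| <= e0 / 5.
  by move: near_pos (near_var eta0); apply: filterS2 => x.
have /nbhs_ballP[d /= d0 hd] := nn.
have dP x : `|x| < d -> (forall c, Q c -> 0 < w2 x c) /\
    forall c, c \in `[a, b] -> `|first_variation x c - first_variation 0 c| <= e0 / 5.
  by move=> xd; apply: hd; rewrite /ball /= sub0r normrN.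
pose t := d / 2; pose e := - s * t.
have t0 : 0 < t by rewrite divr_gt0.
have ss : s * s = 1 by case: hs => ->; rewrite ?mulr1 ?mulN1r ?opprK.
have ne : `|e| = t.
  by rewrite /e normrM normrN (gtr0_norm t0); case: hs => ->; rewrite ?normrN normr1 mul1r.
have td : t < d by rewrite /t; lra.
have Ax x : `|x| < d -> arc lo hi (w x) (w1 x) (w2 x).
  move=> /dP[p _]; exact: (perturb_arc A Qa Qb (@dw x) (@dw1 x) p (@w2_cont x) (@w_out x) (@w1_out x)).
have ed : `|e| < d by rewrite ne.
have [pe _] := dP e ed.
have Ae := Ax e ed.
pose h := perturbed v1 M g a b (w e) (w1 e).
have ch : contact M lo hi h (w e) (w1 e).
  exact: (perturbed_contact A ct Qa Qb ab (@dw e) (@dw1 e) pe (@w2_cont e) (@w_out e) (@w1_out e)).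
have ah : admissible M h.
  exact: (perturbed_admissible A adm ct Qa Qb ab (@dw e) (@dw1 e) pe (@w2_cont e) (@w_out e) (@w1_out e) off0).
have gh y : y \in `[-1, 1] -> y \notin `]v1 a, v1 b[ -> g y = h y.
  exact: (perturbed_out ct Qa Qb ab (@dw1 e) pe (@w_out e) (@w1_out e)).
have na : a \notin `]a, b[ by rewrite in_itv /= ltxx.
have nb : b \notin `]a, b[ by rewrite in_itv /= ltxx andbF.
have wa := w_out e Qa na; have wb := w_out e Qb nb.
have w1a := w1_out e Qa na; have w1b := w1_out e Qb nb.
have lscW : lower_semicontinuous (generated M (axis_fun h)).
  exact: (hull_lsc A Ae adm ah ct ch Qa Qb ab (esym wa) (esym w1a) (esym wb) (esym w1b) gh lscU).
have le_int := strip_integral_le A Ae adm ah ct ch Qa Qb ab (esym wa) (esym w1a) (esym wb) (esym w1b) gh (opt ah lscW).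
have [loa ahi] : lo < a /\ a < hi by move: Qa; rewrite in_itv /= => /andP.
have /andP[loa0 a0a] := mid_between loa.
set a0 := (lo + a) / 2 in loa0 a0a.
have Qa0 : Q a0 by rewrite in_itv /= loa0 (lt_trans a0a ahi).
pose G c := (strip_resistance (w e) (w1 e) M h a0 c - boundary (w e) (w1 e) c)
  - (strip_resistance v v1 M g a0 c - boundary v v1 c).
pose Y c := G c - e * (lagrW c (v c) (v1 c) * phi c) - t * (e0 / 5 * c - e0 * bump_prim m r c).
pose dY c := lagr c (w e c) (w1 e c) - lagr c (v c) (v1 c)
  - e * ((lagrV c (v c) (v1 c) - euler v v1 v2 c) * phi c + lagrW c (v c) (v1 c) * phi1 c)
  - t * (e0 / 5 - e0 * phi c).
have DY c : c \in `[a, b] -> is_derive c 1 Y (dY c).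
  move=> cab; have Qc : Q c by exact: (arc_sub Qa Qb).
  have a0c : a0 < c by move: cab; rewrite in_itv /= => /andP[/(lt_le_trans a0a)].
  have D1 := strip_resistance_boundary Ae ah ch Qa0 Qc a0c.
  have D2 := strip_resistance_boundary A adm ct Qa0 Qc a0c.
  have D3 := d_mul (d_cst e c) (d_mul (lagrW_along A Qc) (d_bump m r0 c)).
  have D4 := d_mul (d_cst t c) (d_sub (d_mul (d_cst (e0 / 5) c) (d_id c)) (d_mul (d_cst e0 c) (d_bump_prim r0 cab))).
  by apply: (d_eq (d_sub (d_sub (d_sub D1 D2) D3) D4)); rewrite /dY; ring.
have dY0 c : c \in `[a, b] -> dY c <= 0.
  move=> cab; have Qc : Q c by exact: (arc_sub Qa Qb).
  have [|x hx] := @mvt_from0 R (fun x => lagr c (v c + x * phi c) (v1 c + x * phi1 c))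
      (fun x => first_variation x c) e.
    move=> x hx; apply: lagr_eps.
    have xd : `|x| < d by rewrite (le_lt_trans hx).
    exact: (arc_lt (Ax x xd) Qc).
  rewrite !mul0r !addr0 => E.
  have xd : `|x| < d by rewrite (le_lt_trans hx).
  have [_ /(_ c cab) V1] := dP x xd.
  have V0 : first_variation 0 c = lagrV c (v c) (v1 c) * phi c + lagrW c (v c) (v1 c) * phi1 c.
    by rewrite /first_variation /w /w1 !mul0r !addr0.
  exact: (variation_sign E V0 V1 (erefl e) ne t0 (hE c cab) (bump_ge0 _ _ _)).
have [x xab EY] := mvt ab DY.
have xab' : x \in `[a, b] by exact: subset_itv_oo_cc xab.
have YN : Y b - Y a <= 0.
  by rewrite EY mulr_le0_ge0 ?dY0 // subr_ge0 ltW.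
have [phia _ _] := bump_out r0 na; have [phib _ _] := bump_out r0 nb.
have Bb : boundary (w e) (w1 e) b = boundary v v1 b by rewrite /boundary /ordinate wb w1b.
have Ba : boundary (w e) (w1 e) a = boundary v v1 a by rewrite /boundary /ordinate wa w1a.
have S1 := strip_resistance_sub A adm ct Qa0 Qa Qb a0a ab.
have S2 := strip_resistance_sub Ae ah ch Qa0 Qa Qb a0a ab.
have tp : 0 < t * (e0 * r) by rewrite !mulr_gt0.
have ba : b - a = 2 * r by rewrite /a /b; ring.
apply: (variation_total S1 S2 le_int (bump_prim_diff m r0) ba tp (Bb := boundary v v1 b) (Ba := boundary v v1 a)
  (Lb := lagrW b (v b) (v1 b)) (La := lagrW a (v a) (v1 a)) (e := e)).
by move: YN; rewrite /Y /G phia phib Ba Bb.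
Qed.

End one_bump.

(** A nonzero value persists, with its sign, on an interval of slopes that can be
    chosen away from 0: this excludes all slopes but 0, and there continuity
    applies. *)
Lemma euler_vanishes c : Q c -> euler v v1 v2 c = 0.
Proof.
suff W x : Q x -> x != 0 -> euler v v1 v2 x = 0.
  move=> Qc; have [c0|c0] := eqVneq c 0; last exact: W.
  apply/eqP; apply: contraT => En.
  have cE := euler_cont A Qc.
  have nE : \forall x \near c, euler v v1 v2 x != 0.
    have := cE; move/cvgrPdist_lt => /(_ `|euler v v1 v2 c|); rewrite normr_gt0 => /(_ En).
    apply: filterS => x; apply: contraTneq => ->; rewrite subr0 ltxx //.
  have nQ : \forall x \near c, Q x by exact: near_in_itvoo.
  have nn : \forall x \near c, euler v v1 v2 x != 0 /\ Q x by move: nE nQ; apply: filterS2.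
  have /nbhs_ballP[d /= d0 hd] := nn.
  have [|E Qx] := hd (c + d / 2).
    by rewrite /ball /= opprD addrA subrr add0r normrN gtr0_norm ?divr_gt0 //; lra.
  by move: E; rewrite W ?eqxx // c0 add0r mulf_neq0 ?gt_eqF ?invr_gt0.
move=> Qx xn; apply/eqP; apply: contraT => En.
set E := euler v v1 v2 in En *.
pose s : R := if 0 < E x then 1 else -1.
have hs : s = 1 \/ s = -1 by rewrite /s; case: ifP; [left|right].
have sE : 0 < s * E x.
  rewrite /s; case: ifPn => h; first by rewrite mul1r.
  by rewrite mulN1r oppr_gt0 lt_neqAle En leNgt.
have cE : {for x, continuous (fun y => s * E y)} by apply: cont_mul; [exact: cont_cst|exact: (euler_cont A Qx)].
have n1 : \forall y \near x, s * E x / 2 < s * E y.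
  by apply: (cvgr_gt _ cE); lra.
have n2 : \forall y \near x, Q y by exact: near_in_itvoo.
have n3 : \forall y \near x, 0 < y * x.
  have cx : {for x, continuous (fun y : R => y * x)} by apply: cont_mul; [exact: cont_id|exact: cont_cst].
  apply: (cvgr_gt _ cx); rewrite -expr2 lt_neqAle sqr_ge0 andbT eq_sym sqrf_eq0 //.
have nn : \forall y \near x, [/\ s * E x / 2 < s * E y, Q y & 0 < y * x].
  by move: n1 n2 n3; apply: filterS3.
have /nbhs_ballP[d /= d0 hd] := nn.
pose r := d / 2.
have r0 : 0 < r by rewrite divr_gt0.
have hr y : y \in `[x - r, x + r] -> [/\ s * E x / 2 < s * E y, Q y & 0 < y * x].
  rewrite in_itv /= => /andP[h1 h2].
  by apply: hd; rewrite /ball /= ltr_norml /r in h1 h2 *; apply/andP; split; lra.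
have [_ Qa pa] : [/\ s * E x / 2 < s * E (x - r), Q (x - r) & 0 < (x - r) * x].
  by apply: hr; rewrite in_itv /= lexx; lra.
have [_ Qb pb] : [/\ s * E x / 2 < s * E (x + r), Q (x + r) & 0 < (x + r) * x].
  by apply: hr; rewrite in_itv /= lexx andbT; lra.
have off0 : 0 < x - r \/ x + r < 0.
  have [x0|x0|x0] := ltgtP x 0; last by rewrite x0 eqxx in xn.
  - by right; rewrite nmulr_lgt0 in pb.
  - by left; rewrite pmulr_lgt0 in pa.
exfalso; apply: (@bump_contradiction x r r0 Qa Qb off0 s (s * E x / 2)) => //.
  by rewrite divr_gt0.
by move=> y /hr[h _ _]; exact: ltW.
Qed.

End variation.

(** * The Legendre transform of the profile *)

Section within.
Context {R : realType}.

Lemma near_within_dnbhs (A : set R) (x : R) (P : set R) :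
  (\forall y \near within A x^', P y) -> \forall y \near x, y != x -> A y -> P y.
Proof. exact. Qed.

Lemma derivable_within_cvg (A : set R) (f : R -> R) (x : R) : derivable_within A f x ->
  forall e : R, 0 < e -> \forall y \near x, y != x -> A y ->
    `|derive_within A f x - (y - x)^-1 * (f y - f x)| <= e.
Proof.
move=> h e e0; apply: near_within_dnbhs.
by have /cvgrPdist_le := h; apply.
Qed.

Lemma derive_within_interior (A : set R) (f : R -> R) (x : R) : nbhs x A ->
  derivable_within A f x -> is_derive x 1 f (derive_within A f x).
Proof.
move=> nA df.
suff K : (fun h : R => h^-1 *: ((f \o shift x) (h *: (1 : R)) - f x)) @ 0^' --> derive_within A f x.
  by apply: DeriveDef; [apply/cvg_ex; exists (derive_within A f x)|exact: cvg_lim K].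
apply/cvgrPdist_le => e e0.
have nn : \forall y \near x, A y /\ (y != x -> A y ->
    `|derive_within A f x - (y - x)^-1 * (f y - f x)| <= e).
  by move: nA (derivable_within_cvg df e0); apply: filterS2.
have /nbhs_ballP[d /= d0 hd] := nn.
have nB : \forall h \near (0 : R)^', `|h| < d.
  apply: nbhs_dnbhs; have := nbhsx_ballx (0 : R) d d0.
  by apply: filterS => h; rewrite /ball /= sub0r normrN.
near=> h.
have hn : h != 0 by near: h; exact: nbhs_dnbhs_neq.
have hb : `|h| < d by near: h.
have [|Ay] := hd (h + x); first by rewrite /ball /= opprD addrCA subrr addr0 normrN.
rewrite addrK -subr_eq0 addrK => /(_ hn Ay).
by rewrite /GRing.scale /= mulr1.
Unshelve. all: by end_near. Qed.

Lemma derivable_within_continuous_itv (a b : R) (f : R -> R) :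
  (forall x, x \in `[a, b] -> derivable_within `[a, b]%classic f x) ->
  {within `[a, b], continuous f}.
Proof.
move=> H; apply/subspace_continuousP => x xab.
have df := H x xab; apply/cvgrPdist_le => e e0.
have := derivable_within_cvg df (ltr01 : 0 < 1 :> R).
set D := derive_within _ f x => n1.
have k0 : 0 < `|D| + 1 by rewrite ltr_wpDl.
have n2 : \forall y \near x, `|x - y| <= e / (`|D| + 1).
  have p : 0 < e / (`|D| + 1) by rewrite divr_gt0.
  by apply: filterS (nbhsx_ballx x _ p) => y; exact: ltW.
move: n1 n2; rewrite /within /=; apply: filterS2 => y h1 h2 yab.
have [->|yx] := eqVneq y x; first by rewrite subrr normr0 ltW.
have := h1 yx yab; set q := (y - x)^-1 * (f y - f x) => hq.
have yx0 : y - x != 0 by rewrite subr_eq0.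
have -> : f x - f y = q * (x - y) by rewrite /q; field.
have q1 : `|q| <= `|D| + 1.
  have -> : q = D - (D - q) by ring.
  by apply: le_trans (ler_normB _ _) _; rewrite lerD2l.
rewrite normrM; apply: le_trans (ler_wpM2r (normr_ge0 _) q1) _.
apply: le_trans (ler_wpM2l (ltW k0) h2) _.
by rewrite mulrCA divff ?mulr1 // gt_eqF.
Qed.

End within.

Section legendre.
Context {R : realType}.
Variables (M : R) (g : R -> R) (alpha beta : R).
Hypotheses (ha : -1 <= alpha) (hab : alpha < beta) (hb : beta <= 1).
Hypothesis adm : admissible M g.
Let I : set R := `[alpha, beta]%classic.
Let g1 := derive_within I g.
Let g2 := derive_within I g1.
Hypothesis C2 : C2_within I g.
Hypothesis g2_gt0 : forall x, x \in `]alpha, beta[ -> 0 < g2 x.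
Local Notation In := (fun x : R => x \in `]alpha, beta[).

Let nbhs_I x : In x -> nbhs x I.
Proof. by move=> h; apply: filterS (near_in_itvoo h) => y; exact: subset_itv_oo_cc. Qed.

Let I_of x : In x -> I x.
Proof. by move=> /subset_itv_oo_cc. Qed.

Let dg x : In x -> is_derive x 1 g (g1 x).
Proof. by move=> hx; have [d _ _] := C2; apply: derive_within_interior; [exact: nbhs_I|exact/d/I_of]. Qed.

Let dg1 x : In x -> is_derive x 1 g1 (g2 x).
Proof. by move=> hx; have [_ d _] := C2; apply: derive_within_interior; [exact: nbhs_I|exact/d/I_of]. Qed.

Let g2_cont x : In x -> {for x, continuous g2}.
Proof.
move=> hx; have [_ _ c] := C2.
have [c0 _ _] := (continuous_within_itvP g2 hab).1 c.
exact: c0.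
Qed.

Let sub x y z : In x -> In y -> z \in `[x, y] -> In z.
Proof. exact: arc_sub. Qed.

Let g1_incr x y : In x -> In y -> x < y -> g1 x < g1 y.
Proof.
move=> hx hy xy.
have D z : z \in `[x, y] -> is_derive z 1 g1 (g2 z) by move=> h; exact: dg1 (sub hx hy h).
have [z zxy e] := mvt xy D.
rewrite -subr_gt0 e mulr_gt0 ?subr_gt0 //; apply: g2_gt0.
by apply: (sub hx hy); exact: subset_itv_oo_cc.
Qed.

Let g1_inj x y : In x -> In y -> g1 x = g1 y -> x = y.
Proof.
move=> hx hy e; apply/eqP; case: ltgtP => // h.
  by have := g1_incr hx hy h; rewrite e ltxx.
by have := g1_incr hy hx h; rewrite e ltxx.
Qed.

Let g1_onto p : p \in `](g1 alpha), (g1 beta)[ -> exists2 x, In x & g1 x = p.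
Proof.
rewrite in_itv /= => /andP[p1 p2].
have [||x + e] := @IVT R g1 alpha beta p (ltW hab).
- by apply: derivable_within_continuous_itv => x hx; have [_ d _] := C2; exact: d.
- by rewrite ge_min le_max (ltW p1) (ltW p2) orbT.
rewrite in_itv /= => /andP[x1 x2]; exists x => //.
rewrite in_itv /= !lt_neqAle x1 x2 !andbT; apply/andP; split.
  by apply: contraTneq p1 => ->; rewrite e ltxx.
by apply: contraTneq p2 => <-; rewrite e ltxx.
Qed.

Let In11 x : In x -> -1 < x < 1.
Proof.
rewrite /= in_itv /= => /andP[h1 h2]; apply/andP; split.
  exact: le_lt_trans ha h1.
exact: lt_le_trans h2 hb.
Qed.

Let In_mem x : In x -> x \in `[-1, 1].
Proof. by move=> /In11/andP[h1 h2]; rewrite in_itv /= !ltW. Qed.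

(** For z close to x on the side of y, the mean value theorem compares the slope
    of g between x and z with the derivative at x, since g1 is strictly
    increasing on the interval; convexity transfers the comparison to y. *)
Lemma strict_support x y : In x -> y \in `[-1, 1] -> y != x -> g x + g1 x * (y - x) < g y.
Proof.
move=> hx hy yx; have cv := cvx_cvx3 (adm_cvx adm).
have hx1 := In_mem hx.
have [x1 x2] : alpha < x /\ x < beta by move: hx; rewrite in_itv /= => /andP.
move: yx; rewrite neq_lt => /orP[yx|xy].
- have [z [hz zx yz]] : exists z, [/\ In z, z < x & y <= z].
    have /andP[m1 m2] := mid_between x1.
    exists (Num.max y ((alpha + x) / 2)); split.
    + by rewrite in_itv /= lt_max m1 orbT gt_max (lt_trans yx) // (lt_trans m2).
    + by rewrite gt_max yx.
    + by rewrite le_max lexx.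
  have D w : w \in `[z, x] -> is_derive w 1 g (g1 w) by move=> h; exact: dg (sub hz hx h).
  have [w wzx e] := mvt zx D.
  have hw : In w by apply: (sub hz hx); exact: subset_itv_oo_cc.
  have wx : w < x by move: wzx; rewrite in_itv => /andP[].
  have g1w := g1_incr hw hx wx.
  have K : y <= z <= x by rewrite yz ltW.
  have := cv y z x hy hx1 K.
  have zx0 : 0 < x - z by rewrite subr_gt0.
  have yx0 : 0 < x - y by rewrite subr_gt0.
  have -> : g z = g x - g1 w * (x - z) by rewrite -e opprB addrC subrK.
  move=> H; rewrite -(ltr_pM2l zx0).
  have k : (x - z) * (g1 w * (x - y)) < (x - z) * (g1 x * (x - y)).
    by rewrite ltr_pM2l // ltr_pM2r.
  lra.
- have [z [hz xz zy]] : exists z, [/\ In z, x < z & z <= y].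
    have /andP[m1 m2] := mid_between x2.
    exists (Num.min y ((x + beta) / 2)); split.
    + by rewrite in_itv /= lt_min (lt_trans x1 xy) (lt_trans x1 m1) /= gt_min m2 orbT.
    + by rewrite lt_min xy.
    + by rewrite ge_min lexx.
  have D w : w \in `[x, z] -> is_derive w 1 g (g1 w) by move=> h; exact: dg (sub hx hz h).
  have [w wzx e] := mvt xz D.
  have hw : In w by apply: (sub hx hz); exact: subset_itv_oo_cc.
  have wx : x < w by move: wzx; rewrite in_itv => /andP[].
  have g1w := g1_incr hx hw wx.
  have K : x <= z <= y by rewrite zy ltW.
  have := cv x z y hx1 hy K.
  have zx0 : 0 < z - x by rewrite subr_gt0.
  have yx0 : 0 < y - x by rewrite subr_gt0.
  have -> : g z = g x + g1 w * (z - x) by rewrite -e addrC subrK.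
  move=> H; rewrite -(ltr_pM2l zx0).
  have k : (z - x) * (g1 x * (y - x)) < (z - x) * (g1 w * (y - x)).
    by rewrite ltr_pM2l // ltr_pM2r.
  lra.
Qed.

Lemma support x y : In x -> y \in `[-1, 1] -> g x + g1 x * (y - x) <= g y.
Proof.
move=> hx hy; have [->|yx] := eqVneq y x; first by rewrite subrr mulr0 addr0.
exact: ltW (strict_support hx hy yx).
Qed.

(** The inverse of the derivative of g, which is the derivative of the
    conjugate. *)
Definition contact_pt (p : R) : R := xget 0 [set x | In x /\ g1 x = p].
Definition dual_profile (p : R) : R := p * contact_pt p - g (contact_pt p) + M.
Definition dual_profile2 (p : R) : R := (g2 (contact_pt p))^-1.
Local Notation Q := (fun p : R => p \in `](g1 alpha), (g1 beta)[).

Let ptK x : In x -> contact_pt (g1 x) = x.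
Proof.
move=> hx; rewrite /contact_pt; case: xgetP => [y _ [hy e]|/(_ x) /=]; first exact: g1_inj.
by case.
Qed.

Let ptP p : Q p -> In (contact_pt p) /\ g1 (contact_pt p) = p.
Proof. by move=> /g1_onto[x hx <-]; rewrite ptK. Qed.

Let dpt p : Q p -> is_derive p 1 contact_pt (dual_profile2 p).
Proof.
move=> Qp; have [hx e] := ptP Qp.
rewrite /dual_profile2 -{1}e; apply: (@is_derive_inverse R g1).
- by apply: filterS (near_in_itvoo hx) => y; exact: ptK.
- by apply: filterS (near_in_itvoo hx) => y hy; exact: derive_continuous (dg1 hy).
- exact: dg1.
- by rewrite gt_eqF // g2_gt0.
Qed.

(** Differentiating p x(p) - g (x(p)) gives x(p), because g' (x(p)) = p, and the
    inverse function theorem differentiates x.  The bound |p| < v is the strict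
    support inequality at the ends -1 and 1, where g <= M. *)
Lemma dual_arc : arc (g1 alpha) (g1 beta) dual_profile contact_pt dual_profile2.
Proof.
split => p Qp; have [hx e] := ptP Qp.
- have d1 := @d_comp R g contact_pt p _ _ (dg hx) (dpt Qp).
  by apply: (d_eq (d_add (d_sub (d_mul (d_id p) (dpt Qp)) d1) (d_cst M p))); rewrite e; ring.
- exact: dpt.
- by rewrite invr_gt0 g2_gt0.
- apply: (@cont_inv _ _ (fun p => g2 (contact_pt p))); first by rewrite gt_eqF // g2_gt0.
  apply: (@continuous_comp _ _ _ contact_pt g2); last exact: g2_cont.
  exact: derive_continuous (dpt Qp).
- exact: In11.
- have /andP[h1 h2] := In11 hx.
  have m1 : (-1 : R) \in `[-1, 1] by rewrite in_itv /=; lra.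
  have p1 : (1 : R) \in `[-1, 1] by rewrite in_itv /=; lra.
  have s1 := strict_support hx m1 (negbT (lt_eqF h1)).
  have s2 := strict_support hx p1 (negbT (gt_eqF h2)).
  have /andP[_ b1] := adm_bnd adm m1; have /andP[_ b2] := adm_bnd adm p1.
  rewrite e in s1 s2; rewrite /dual_profile; apply/andP; split; lra.
Qed.

Lemma dual_contact : contact M (g1 alpha) (g1 beta) g dual_profile contact_pt.
Proof.
split => [p Qp|p y Qp hy]; first by rewrite /dual_profile; ring.
have [hx e] := ptP Qp; have := support hx hy; rewrite e /dual_profile; lra.
Qed.

Lemma conjugateE p : Q p -> (conjugate (axis_fun g) (p, 0%R) + M%:E)%E = (dual_profile p)%:E.
Proof.
move=> Qp; have [hx e] := ptP Qp.
rewrite /dual_profile EFinD; congr (_ + _)%E; apply/eqP; rewrite eq_le; apply/andP; split.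
- apply: ge_ereal_sup => _ [[y z] _ <-]; rewrite /axis_fun /=; case: ifP => [/andP[hy _]|_]; last exact: leNye.
  rewrite mul0r addr0 -EFinB lee_fin; have := support hx hy; rewrite e; lra.
- apply: ereal_sup_ubound; exists (contact_pt p, 0) => //.
  by rewrite /axis_fun /= In_mem // eqxx /= mul0r addr0.
Qed.

End legendre.

Theorem theorem6 (R : realType) (M : R) (hM : 0 <= M)
  (u u0 : R * R -> \bar R)
  (hu : Cm M u)
  (hopt : forall w : R * R -> \bar R, Cm M w -> (J u <= J w)%E)
  (hu0 : generator M u0)
  (huu0 : u = generated M u0)
  (alpha beta : R)
  (ha : -1 <= alpha) (hab : alpha < beta) (hb : beta <= 1) :
  let I : set R := `[alpha, beta]%classic in
  let g : R -> R := fun x1 => fine (u0 (x1, 0)) in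
  let g' : R -> R := derive_within I g in
  let g'' : R -> R := derive_within I g' in
  let v : R -> R := fun p1 => fine (conjugate u0 (p1, 0%R) + M%:E)%E in
  let v' : R -> R := derive1 v in
  let v'' : R -> R := derive1 v' in
  C2_within I g ->
  (forall x1 : R, x1 \in `]alpha, beta[ -> 0 < g'' x1) ->
  forall p1 : R, p1 \in `](g' alpha), (g' beta)[ ->
    [/\ derivable v p1 1, derivable v' p1 1,
        p1 ^+ 2 - v p1 ^+ 2 != 0
      & v'' p1 =
          (v p1 - p1 * v' p1) / (p1 ^+ 2 - v p1 ^+ 2)
          + 2 * v p1 * v' p1 ^+ 2 / (v p1 ^+ 2 + 1)
          + v p1 * (v' p1 ^+ 2 - 1) / (2 * (p1 ^+ 2 - v p1 ^+ 2))].
Proof.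
move=> I g g' g'' v v' v'' C2 g2_gt0 p Qp.
have [adm u0E] := generator_axis_fun hu0.
have A := dual_arc ha hab hb adm C2 g2_gt0.
have ct := dual_contact ha hab hb adm C2 g2_gt0.
set V := dual_profile _ _ _ _ in A ct; set X := contact_pt _ _ _ in A ct.
set X' := dual_profile2 _ _ _ in A.
have uE : u = generated M (axis_fun g) by rewrite huu0 u0E.
have lscU : lower_semicontinuous (generated M (axis_fun g)).
  by rewrite -uE; case: hu => -[].
have opt h : admissible M h -> lower_semicontinuous (generated M (axis_fun h)) ->
    (J (generated M (axis_fun g)) <= J (generated M (axis_fun h)))%E.
  move=> ah lh; rewrite -uE; apply: hopt; split; first exact: hull_in_C.
  by exists (axis_fun h) => //; exact: axis_fun_generator.
have ode c : c \in `](g' alpha), (g' beta)[ -> X' c = ode_rhs V X c.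
  by move=> Qc; apply: (euler_eq0 A Qc); exact: (euler_vanishes A adm ct lscU opt Qc).
have vE c : c \in `](g' alpha), (g' beta)[ -> v c = V c.
  move=> Qc; rewrite /v u0E.
  by rewrite (conjugateE ha hab hb adm C2 g2_gt0 Qc).
have dv c : c \in `](g' alpha), (g' beta)[ -> is_derive c 1 v (X c).
  move=> Qc; apply: d_near_eq (arc_d1 A Qc).
  by apply: filterS (near_in_itvoo Qc) => y Qy; rewrite vE.
have v'E c : c \in `](g' alpha), (g' beta)[ -> v' c = X c.
  by move=> Qc; rewrite /v' derive1E; case: (dv c Qc).
have dv' c : c \in `](g' alpha), (g' beta)[ -> is_derive c 1 v' (X' c).
  move=> Qc; apply: d_near_eq (arc_d2 A Qc).
  by apply: filterS (near_in_itvoo Qc) => y Qy; rewrite v'E.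
split.
- by case: (dv p Qp).
- by case: (dv' p Qp).
- rewrite vE // -oppr_eq0 opprB -(ordinate_sqr A Qp) sqrf_eq0.
  by rewrite gt_eqF // (ordinate_gt0 A Qp).
- rewrite /v'' derive1E; case: (dv' p Qp) => _ ->.
  by rewrite vE // v'E // ode.
Qed.
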